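(* Suppose that $$\int_1^\infty g^{-1/m}(\zeta)\,\zeta^{1/m-1}\,d\zeta<\infty \qquad\text{and}\qquad \int_{\Omega\setminus S}\gamma\left(\frac{1}{f(x)}\right)dx<\infty .$$ Let $k=\overline{\dim}_F\,\partial S$ be the upper fractal dimension of $\partial S$, and suppose that there exists a real number $\delta>0$ such that $$\lim_{r\to+0} r^{\,n-k-m-\delta}\,G^{-1}\left(C\,r\,\operatorname{ess\,inf}_{S_r\setminus S} f^{1/m}\right)=0$$ for all real numbers $C>0$, where $G^{-1}$ is the inverse function to $$G(t)=\int_t^\infty g^{-1/m}(\zeta)\,\zeta^{1/m-1}\,d\zeta .$$ Then the singular set $S$ is removable for any weak solution $u$ of the inequality $$\sum_{|\alpha|=m}\partial^\alpha a_\alpha(x,u)\ge f(x)\,g(|u|)\quad\text{in }\Omega\setminus S .$$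
   Context: Setting. $m,n\ge1$ are integers, $\Omega\subset\mathbb R^n$ is a bounded domain, $S$ is a compact subset of $\Omega$. For each multi-index $\alpha$ with $|\alpha|=m$, $a_\alpha:\Omega\times\mathbb R\to\mathbb R$ is a Caratheodory function, and there is a constant $A>0$ with $|a_\alpha(x,\zeta)|\le A|\zeta|$ for almost all $x\in\Omega$ and all $\zeta\in\mathbb R$. $f:\Omega\to[0,\infty)$ is measurable. $g:[0,\infty)\to[0,\infty)$ is twice continuously differentiable, $g(0)=0$, and $g(\zeta)>0$, $g'(\zeta)>0$, $g''(\zeta)>0$ for all $\zeta\in(0,\infty)$. Notation. For $\omega\subset\mathbb R^n$ and $r>0$, $\omega_r$ is the set of points of $\mathbb R^n$ whose distance to $\omega$ is less than $r$. $\operatorname{mes}$ is Lebesgue measure on $\mathbb R^n$. Weak solution. $u$ is a weak solution of $\sum_{|\alpha|=m}\partial^\alpha a_\alpha(x,u)\ge f(x)g(|u|)$ in $\Omega\setminus S$ if $u\in L_1(\Omega\setminus S_r)$ and $f(x)g(|u|)\in L_1(\Omega\setminus S_r)$ for any $r>0$, and $$\int_\Omega\sum_{|\alpha|=m}(-1)^m a_\alpha(x,u)\,\partial^\alpha\varphi\,dx\ge\int_\Omega f(x)g(|u|)\varphi\,dx\qquad( * )$$ for any non-negative $\varphi\in C_0^\infty(\Omega\setminus S)$. Removability. The singular set $S$ is removable (for $u$) if $u\in L_1(\Omega)$, $f(x)g(|u|)\in L_1(\Omega)$, and $( * )$ holds for all non-negative $\varphi\in C_0^\infty(\Omega)$;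 here $u$ is extended by zero to $S$. The function $\gamma$. The Legendre transformation of $g$ is $g^*(\xi)=\int_{g'(0)}^{\xi}(g')^{-1}(\zeta)\,d\zeta$ for $\xi>g'(0)$ and $g^*(\xi)=0$ for $\xi\le g'(0)$, where $(g')^{-1}$ is the inverse function to $g'$; and $\gamma(\xi)=g^*(\xi)/\xi$ for $\xi>0$. Conventions: $\gamma(1/f(x))=+\infty$ where $f(x)=0$, and $G^{-1}(0)=+\infty$. Fractal dimension. For a bounded set $\omega$, let $N_r(\omega)$ be the minimal number of sets of diameter at most $r$ which can cover $\omega$. The upper fractal dimension is $\overline{\dim}_F\,\omega=\limsup_{r\to+0}\frac{\log N_r(\omega)}{\log(1/r)}$ (equivalently, $n-\liminf_{r\to+0}\frac{\log\operatorname{mes}\omega_r}{\log r}$). *)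

(* Defs.v *)
From HB Require Import structures.
From mathcomp Require Import all_boot all_order all_algebra.
From mathcomp Require Import all_classical all_reals all_analysis.
From mathcomp Require Import ess_sup_inf.

Set Implicit Arguments.
Unset Strict Implicit.
Unset Printing Implicit Defensive.

Import Order.TTheory GRing.Theory Num.Theory.
Import numFieldNormedType.Exports.

Local Open Scope classical_set_scope.
Local Open Scope ring_scope.

(* The points of R^n are the row vectors ['rV[R]_n], whose library topology is
   the usual one. The library has Lebesgue measure on the line only. *)

Section lebesgue_outer_measure.
Context {R : realType} {n : nat}.

(* [Some (a, b)] is the half-open box of the x with a_i < x_i <= b_i for all i;
   [None] is the empty box, needed to cover the empty set at cost 0 if n = 0. *)
Definition box := option ('rV[R]_n * 'rV[R]_n).

Definition box_set (B : box) : set 'rV[R]_n :=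
  if B is Some (a, b) then [set x | forall i, a ord0 i < x ord0 i <= b ord0 i]
  else set0.

Definition box_volume (B : box) : R :=
  if B is Some (a, b) then \prod_(i < n) Num.max 0 (b ord0 i - a ord0 i) else 0.

Definition lebesgue_outer (A : set 'rV[R]_n) : \bar R :=
  ereal_inf [set (\sum_(0 <= k <oo) (box_volume (F k))%:E)%E |
             F in [set F : nat -> box | A `<=` \bigcup_k box_set (F k)]].

Local Open Scope ereal_scope.

Lemma box_volume_ge0 B : 0 <= (box_volume B)%:E.
Proof.
rewrite lee_fin; case: B => [[a b]|] //=.
by apply: prodr_ge0 => i _; rewrite le_max lexx.
Qed.

Lemma lebesgue_outer_ge0 A : 0 <= lebesgue_outer A.
Proof.
apply: le_ereal_inf_tmp => x [F _ <-].
by apply: nneseries_ge0 => k _ _; exact: box_volume_ge0.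
Qed.

Lemma lebesgue_outer0 : lebesgue_outer set0 = 0.
Proof.
apply/eqP; rewrite eq_le lebesgue_outer_ge0 andbT.
apply: ereal_inf_lbound; exists (fun=> None) => //=.
by rewrite eseries0.
Qed.

Lemma le_lebesgue_outer : {homo lebesgue_outer : A B / A `<=` B >-> A <= B}.
Proof.
move=> A B AB; apply/ereal_inf_le_tmp => x [F BF <-].
by exists F => //; exact: subset_trans BF.
Qed.

Lemma lebesgue_outer_sigma_subadditive : sigma_subadditive lebesgue_outer.
Proof.
move=> A; have [[i ioo]|] := pselect (exists i, lebesgue_outer (A i) = +oo).
  rewrite (eseries_pinfty _ _ ioo) ?leey// => k _.
  by rewrite -ltNye (lt_le_trans _ (lebesgue_outer_ge0 _)).
rewrite -forallNE => Aoo.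
suff add2e (e : {posnum R}) :
    lebesgue_outer (\bigcup_n A n)
      <= \sum_(0 <= i <oo) lebesgue_outer (A i) + e%:num%:E.
  by apply/lee_addgt0Pr => _/posnumP[].
rewrite (le_trans _ (epsilon_trick _ _ _))//; last first.
  by move=> k; exact: lebesgue_outer_ge0.
pose P k (B : nat -> box) := A k `<=` \bigcup_j box_set (B j) /\
  \sum_(0 <= j <oo) (box_volume (B j))%:E
    <= lebesgue_outer (A k) + (e%:num / (2 ^ k.+1)%:R)%:E.
have [G PG] : {G : nat -> nat -> box & forall k, P k (G k)}.
  apply: (@choice _ _ P) => k; rewrite /P.
  have fink : lebesgue_outer (A k) \is a fin_num.
    by rewrite ge0_fin_numE ?lebesgue_outer_ge0// ltey; exact/eqP/Aoo.
  have ek : (0 < e%:num / (2 ^ k.+1)%:R)%R by [].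
  have [x [B AB Bx] xS] := lb_ereal_inf_adherent ek fink.
  by exists B; split => //; rewrite Bx; exact/ltW.
pose v (p : nat * nat) := (box_volume (uncurry G p))%:E.
have v_ge0 p : 0 <= v p by exact: box_volume_ge0.
apply: (@le_trans _ _ (\esum_(p in setT) v p)).
  apply: ereal_inf_lbound => /=.
  have /card_esym/ppcard_eqP[h] := card_nat2.
  exists (uncurry G \o h).
    move=> t [i _ /(PG i).1 [j _ Bijt]]; exists (h^-1%FUN (i, j)) => //=.
    by rewrite invK ?inE.
  rewrite -(esum_pred_image v _ xpredT) ?[fun=> _]set_true//.
  by rewrite image_eq.
rewrite (_ : esum _ _ = \sum_(0 <= i <oo) \sum_(0 <= j <oo) v (i, j)); last first.
  pose J : nat -> set (nat * nat) := fun i => [set (i, j) | j in setT].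
  rewrite (_ : setT = \bigcup_k J k); last first.
    by rewrite predeqE => -[a b]; split => // _; exists a => //; exists b.
  rewrite esum_bigcupT /=; last 2 first.
  - apply/trivIsetP => i j _ _ ij.
    rewrite predeqE => -[k l] /=; split => //= -[] [_] _ [<-{k} _].
    by move=> [l' _] [] /esym/eqP; rewrite (negbTE ij).
  - by move=> p; exact: v_ge0.
  rewrite -(image_id [set: nat]) -fun_true esum_pred_image//; last first.
    by move=> k _; exact: esum_ge0.
  apply: eq_eseriesr => /= j _.
  rewrite -(esum_pred_image v (pair j) predT)//=; last first.
    by move=> ? ? _ _; exact: (@can_inj _ _ _ snd).
  by congr esum; rewrite predeqE => -[a b]; split; move=> [i _ <-]; exists i.
apply: lee_lim.
- by apply: is_cvg_nneseries => k *; apply: nneseries_ge0.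
- apply: is_cvg_nneseries => k *; apply: adde_ge0 => //.
  exact: lebesgue_outer_ge0.
- by near=> k; apply: lee_sum => i _; exact: (PG i).2.
Unshelve. all: by end_near. Qed.

HB.instance Definition _ := isOuterMeasure.Build R _ lebesgue_outer
  lebesgue_outer0 lebesgue_outer_ge0 le_lebesgue_outer
  lebesgue_outer_sigma_subadditive.

End lebesgue_outer_measure.

(* R^n with the sigma-algebra of the Lebesgue measurable sets, that is, of the
   Caratheodory measurable sets of the outer measure. *)
Notation Rn R n := (caratheodory_type (@lebesgue_outer R n)).

Section lebesgue_measure_Rn.
Context {R : realType} {n : nat}.

Definition mes : set (Rn R n) -> \bar R := lebesgue_outer.

HB.instance Definition _ := isMeasure.Build _ _ _ mes
  (caratheodory_measure0 (@lebesgue_outer R n))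
  (@caratheodory_measure_ge0 _ _ (@lebesgue_outer R n))
  (@caratheodory_measure_sigma_additive _ _ (@lebesgue_outer R n)).

End lebesgue_measure_Rn.

(* The library norm on ['rV[R]_n] is the maximum norm, hence [eucl_dist]. *)

Section geometry.
Context {R : realType} {n : nat}.
Implicit Types (x y : 'rV[R]_n) (w : set 'rV[R]_n) (r : R).

Definition eucl_dist x y : R :=
  Num.sqrt (\sum_(i < n) (x ord0 i - y ord0 i) ^+ 2).

Definition neighborhood w r : set 'rV[R]_n :=
  [set x | exists2 y, w y & eucl_dist x y < r].

Definition domain w : Prop := [/\ w !=set0, open w & connected w].

Definition boundary w : set 'rV[R]_n := closure w `\` interior w.

Definition diameter_le w r : Prop := forall x y, w x -> w y -> eucl_dist x y <= r.

Definition coverable w r (N : nat) : Prop :=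
  exists F : 'I_N -> set 'rV[R]_n,
    (forall i, diameter_le (F i) r) /\ w `<=` \bigcup_i F i.

Definition covering_number w r : \bar R :=
  ereal_inf [set N%:R%:E | N in coverable w r].

Definition upper_fractal_dim w : \bar R :=
  limf_esup (fun r => (lne (covering_number w r) * ((ln r^-1)^-1)%:E)%E) 0^'+.

Definition ess_inf_on w (h : 'rV[R]_n -> R) : \bar R :=
  ess_inf mes (patch (cst +oo%E) w (EFin \o h)).

End geometry.

Section derivatives.
Context {R : realType} {n : nat}.
Implicit Types (phi : 'rV[R]_n -> R).

Definition partial (i : 'I_n) phi : 'rV[R]_n -> R :=
  fun x => 'D_(delta_mx ord0 i) phi x.

Definition smooth phi : Prop :=
  forall s : seq 'I_n, let psi := foldr partial phi s in
    continuous psi /\ forall i x, derivable psi x (delta_mx ord0 i).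

(* The functions of C_0^infty(U), extended by zero to R^n. *)
Definition test_function (U : set 'rV[R]_n) phi : Prop :=
  [/\ smooth phi, compact (closure [set x | phi x != 0])
    & closure [set x | phi x != 0] `<=` U].

(* Multi-indices with all entries at most m; this includes every multi-index of
   order m. *)
Definition multi_index (m : nat) := {ffun 'I_n -> 'I_m.+1}.

Definition multi_order m (alpha : multi_index m) : nat := (\sum_(i < n) alpha i)%N.

Definition multi_partial m (alpha : multi_index m) phi : 'rV[R]_n -> R :=
  foldr (fun i psi => iter (alpha i) (partial i) psi) phi (enum 'I_n).

End derivatives.
Arguments multi_index n m : clear implicits.

Section half_line.
Context {R : realType}.
Implicit Types (g : R -> R).

(* The differential quotients of a function of [0, +oo) at x; in particular
   [hderiv g 0] is a one-sided derivative. *)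
Definition hquot g (x y : R) : R := (g y - g x) / (y - x).

Definition hfilter (x : R) := within `[0, +oo[%classic (dnbhs x).

Definition hderivable g x : Prop := cvg (hquot g x y @[y --> hfilter x]).

Definition hderiv g (x : R) : R := lim (hquot g x y @[y --> hfilter x]).

Definition C2_half_line g : Prop :=
  [/\ forall x, 0 <= x -> hderivable g x,
      forall x, 0 <= x -> hderivable (hderiv g) x
    & {within `[0, +oo[%classic, continuous (hderiv (hderiv g))}].

Definition hderiv_inv g : R -> R :=
  'pinv_(fun=> 0) `[0, +oo[%classic (hderiv g).

Definition legendre g (xi : R) : \bar R :=
  if xi <= hderiv g 0 then 0%E
  else (\int[lebesgue_measure]_(z in `]hderiv g 0, xi]) (hderiv_inv g z)%:E)%E.

Definition gamma g (xi : R) : \bar R := (legendre g xi * (xi^-1)%:E)%E.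

(* gamma (1 / y) for y >= 0, with value +oo at y = 0 *)
Definition gamma_recip g (y : R) : \bar R :=
  if y == 0 then +oo%E else gamma g y^-1.

Definition tail_integral (m : nat) g (t : R) : \bar R :=
  (\int[lebesgue_measure]_(z in `[t, +oo[)
     (g z `^ (- m%:R^-1) * z `^ (m%:R^-1 - 1))%:E)%E.

(* The inverse of G = tail_integral m g on (0, +oo), with value +oo at 0. At +oo
   the value is the default 0, since G(t) tends to +oo as t tends to 0. *)
Definition tail_integral_inv (m : nat) g (s : \bar R) : \bar R :=
  if s == 0%E then +oo%E
  else ('pinv_(fun=> 0) `]0, +oo[%classic (tail_integral m g) s)%:E.

End half_line.

Section inequality.
Context {R : realType} {n m : nat}.
Variables (a : multi_index n m -> 'rV[R]_n -> R -> R).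
Variables (f : 'rV[R]_n -> R) (g : R -> R) (Omega S : set 'rV[R]_n).
Implicit Types (u phi : 'rV[R]_n -> R).

Definition caratheodory_function (b : 'rV[R]_n -> R -> R) : Prop :=
  (forall z, measurable_fun (Omega : set (Rn R n)) (b ^~ z)) /\
  {ae @mes R n, forall x, Omega x -> continuous (b x)}.

Definition integral_inequality u phi : Prop :=
  (\int[mes]_(x in Omega) (f x * g `|u x| * phi x)%:E
   <= \int[mes]_(x in Omega)
        (\sum_(alpha : multi_index n m | multi_order alpha == m)
           (-1) ^+ m * a alpha x (u x) * multi_partial alpha phi x)%:E)%E.

Definition L1 (D : set 'rV[R]_n) u : Prop :=
  (@mes R n).-integrable D (EFin \o u).

Definition weak_solution u : Prop :=
  (forall r, 0 < r ->
     L1 (Omega `\` neighborhood S r) u /\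
     L1 (Omega `\` neighborhood S r) (fun x => f x * g `|u x|)) /\
  (forall phi, test_function (Omega `\` S) phi -> (forall x, 0 <= phi x) ->
     integral_inequality u phi).

Definition removable u : Prop :=
  let u0 := patch (cst 0) (~` S) u in
  [/\ L1 Omega u0, L1 Omega (fun x => f x * g `|u0 x|)
    & forall phi, test_function Omega phi -> (forall x, 0 <= phi x) ->
        integral_inequality u0 phi].

End inequality.

(* Main.v *)
(* Multiply a non-negative test function by a cut-off eta that is 0 near S and
   1 off S_r, with derivatives of order j bounded by K r^(-j). The weak
   inequality then bounds the mass of f g(|u|) off S_r, up to a constant, by
   C r^(-m) times the mass of |u| on the shell between S_(r/2) and S_r.
   If f g(|u|) is not integrable near S, the constant is absorbed, and Jensen's
   inequality turns this bound into J(r1) >= J(r2) + g(kappa (r2 - r1)^m J(r2))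
   for the normalised masses J. Summing the steps needed to pass from one level
   to the next, as in the Keller-Osserman estimate, gives J < g(2 T) with
   T = G^-1(C r ess inf f^(1/m)), so that the mean of |u| over the shell is
   less than 2 T. Covering the boundary of S gives
   mes(S_r \ S) <= C r^(n - k - delta), so that the hypothesis makes the masses
   off S_r tend to 0, a contradiction. As f is bounded below near S and g is
   superlinear, u is integrable. The same estimates show that the error terms
   produced by the cut-off tend to 0, and the inequality extends to all of Omega. *)
Require Import Defs.
From mathcomp Require Import all_boot all_order all_algebra.
From mathcomp Require Import all_classical all_reals all_analysis.
From mathcomp Require Import measurable_realfun ess_sup_inf.
From mathcomp Require Import ring lra.

Set Implicit Arguments.
Unset Strict Implicit.
Unset Printing Implicit Defensive.

Import Order.TTheory GRing.Theory Num.Theory.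
Import numFieldNormedType.Exports.

Local Open Scope classical_set_scope.
Local Open Scope ring_scope.

(** * Smooth functions on the line *)

(** The quantifier over all C in the hypothesis is needed because C is fixed only at the end, from
    the constant of the cut-off: it is the value for which the Keller-Osserman steps, started at
    r/2, add up to at most r/4. The contradiction lies in finiteness: the normalised mass at r/4 is
    a real number, yet it would exceed g(2^i T) for every i. The essential infimum is positive for
    small r, since G^-1(0) = +oo is incompatible with a limit equal to 0; this is where the lower
    bound of f near S comes from. S may have positive measure. Hence only S_r \ S is ever estimated,
    u is set to 0 on S, and smallness near S means smallness on sets that shrink to the empty set.
    The bound K r^(-j) must have the same K for all radii, and the distance to a general compact set
    is not smooth. The cut-offs are therefore sums of product bumps on a grid whose mesh is
    proportional to the width of the shell, and all constants come from one function of one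
    variable. *)

Section smooth_line.
Context {R : realType}.
Implicit Types (f g : R -> R) (k : nat).

(** The derivative is carried as a witness, so that products, quotients and affine substitutions are
    treated by induction on [k] with explicit formulas; iterated [derive1] is recovered in
    [times_differentiable_derive1n]. *)
Fixpoint times_differentiable k f : Prop :=
  if k is k'.+1 then
    exists2 df, forall x : R, is_derive x 1 f (df x)
              & times_differentiable k' df
  else True.

Lemma times_differentiableW k f :
  times_differentiable k.+1 f -> times_differentiable k f.
Proof.
elim: k f => [//|k IH] f [df fdf cdf]; exists df => //; exact: IH.
Qed.

Lemma times_differentiableD k f g :
  times_differentiable k f -> times_differentiable k g ->
  times_differentiable k (fun x => f x + g x).
Proof.
elim: k f g => [//|k IH] f g [df fdf cdf] [dg gdg cdg].
exists (fun x => df x + dg x); last exact: IH.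
by move=> x; exact: is_deriveD.
Qed.

Lemma times_differentiableM k f g :
  times_differentiable k f -> times_differentiable k g ->
  times_differentiable k (fun x => f x * g x).
Proof.
elim: k f g => [//|k IH] f g cf cg.
have [cf' cg'] := (times_differentiableW cf, times_differentiableW cg).
case: cf cg => [df fdf cdf] [dg gdg cdg].
exists (fun x => f x * dg x + g x * df x).
  by move=> x; exact: is_deriveM.
by apply: times_differentiableD; exact: IH.
Qed.

Lemma times_differentiable_cst k (c : R) : times_differentiable k (fun=> c).
Proof.
elim: k c => [//|k IH] c; exists (fun=> 0) => // x; exact: is_derive_cst.
Qed.

(** The derivative of 1/f is -(1/f)^2 f', which involves only f' and 1/f itself, the latter one
    order lower and so covered by the induction. *)
Lemma times_differentiableV k f : (forall x, f x != 0) ->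
  times_differentiable k f -> times_differentiable k (fun x => (f x)^-1).
Proof.
move=> f0; elim: k => [//|k IH] cf.
have cV := IH (times_differentiableW cf).
case: cf => df fdf cdf.
exists (fun x => -1 * ((f x)^-1 * (f x)^-1) * df x); last first.
  do 2!apply: times_differentiableM => //; first exact: times_differentiable_cst.
  exact: times_differentiableM.
move=> x; have := is_deriveV (f0 x) (fdf x).
rewrite /GRing.scale/= => h; apply: (@is_derive_eq _ _ _ _ _ _ _ _ h).
by rewrite -exprVn expr2; ring.
Qed.

Lemma times_differentiable_affine k f (c d : R) : times_differentiable k f ->
  times_differentiable k (fun x => f (c * x + d)).
Proof.
elim: k f => [//|k IH] f [df fdf cdf].
exists (fun x => df (c * x + d) * c).
  move=> x; apply: (@is_derive1_comp _ f (fun x => c * x + d)) => //.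
  have h : is_derive x 1 (fun x : R => c * x + d) (c *: 1 + 0).
    by apply: is_deriveD.
  by apply: (@is_derive_eq _ _ _ _ _ _ _ _ h); rewrite addr0 /GRing.scale/= mulr1.
apply: times_differentiableM; [exact: IH|exact: times_differentiable_cst].
Qed.

(* The span of the functions [flat_exp N] is stable under differentiation. *)
Definition flat_exp (N : nat) (t : R) : R :=
  if 0 < t then t^-1 ^+ N * expR (- t^-1) else 0.

(** For y = 1/t > 0, exp y is at least y^(N+1) / (N+1)!. A bound that is linear in t is what
    continuity at 0 requires. *)
Lemma flat_exp_le N (t : R) : `|flat_exp N t| <= (N.+1)`!%:R * `|t|.
Proof.
rewrite /flat_exp; case: ifPn => [t0|_]; last by rewrite normr0 mulr_ge0.
rewrite !gtr0_norm// ?mulr_gt0 ?exprn_gt0 ?invr_gt0 ?expR_gt0//.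
have := expR_ge1Dxn N (ltW (_ : 0 < t^-1)); rewrite invr_gt0 => /(_ t0) h.
rewrite expRN -ler_pdivlMr ?invr_gt0 ?expR_gt0// invrK.
have f0 : 0 < (N.+1)`!%:R :> R by rewrite ltr0n fact_gt0.
rewrite -mulrA mulrC -ler_pdivrMr//.
rewrite -(ler_pM2l (_ : 0 < t^-1)) ?invr_gt0//.
rewrite [leRHS]mulrA mulVf ?gt_eqF// mul1r.
by rewrite mulrA -exprS (le_trans _ h)// lerDr.
Qed.

Lemma is_derive_flat_exp N (t : R) :
  is_derive t 1 (flat_exp N) (- N%:R * flat_exp N.+1 t + flat_exp N.+2 t).
Proof.
have [t0|t0|->] := ltgtP t 0.
- rewrite /flat_exp !ltNge !(ltW t0)/= mulr0 addr0.
  apply: (@near_eq_is_derive _ _ _ (fun=> 0)).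
  near=> x; rewrite ltNge (_ : x <= 0)//; apply: ltW; near: x.
  exact: lt_nbhsl.
- rewrite /flat_exp t0.
  apply: (@near_eq_is_derive _ _ _ (fun t : R => t^-1 ^+ N * expR (- t^-1))).
    by near=> x; rewrite ifT//; near: x; exact: lt_nbhsr.
  have dV : is_derive t 1 (fun y : R => y^-1) (- t ^- 2 *: 1).
    by apply: is_deriveV => //; rewrite gt_eqF.
  have dVN : is_derive t 1 (fun y : R => y^-1 ^+ N)
      ((N%:R * t^-1 ^+ N.-1) *: (- t ^- 2 *: 1)).
    by have := @is_deriveX _ _ _ N _ _ _ dV; rewrite exprfctE.
  have dE : is_derive t 1 (fun y : R => expR (- y^-1))
      (expR (- t^-1) * (- (- t ^- 2 *: 1))).
    by apply: (@is_derive1_comp _ expR (fun y : R => - y^-1)).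
  apply: (@is_derive_eq _ _ _ _ _ _ _ _ (is_deriveM dVN dE)).
  rewrite /GRing.scale/= !mulr1 -!exprVn.
  case: N dVN => [|N] dVN /=; first by rewrite !expr0 !expr1 ; ring.
  by rewrite !exprS expr0; ring.
(* At 0 the slope of [flat_exp N] is again a function of the family: dividing by t raises the index
   by 1, and [flat_exp_le] makes the slope continuous at 0. *)
- apply/is_derive1_caratheodory; exists (flat_exp N.+1); split => //=.
  + move=> z; rewrite /flat_exp ltxx !subr0; case: ifPn => z0; last by rewrite mul0r.
    by rewrite exprS; field; rewrite gt_eqF.
  + apply/cvgrPdist_le => e e0.
    near=> x; rewrite [X in X - _]/flat_exp ltxx sub0r normrN (le_trans (flat_exp_le _ _))//.
    rewrite -ler_pdivlMl ?ltr0n ?fact_gt0//.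
    near: x; apply: (@nbhs0_le _ R).
    by rewrite mulr_gt0 // invr_gt0 ltr0n fact_gt0.
  + by rewrite /flat_exp ltxx mulr0 addr0.
Unshelve. all: end_near. Qed.

Lemma times_differentiable_flat_exp k N : times_differentiable k (flat_exp N).
Proof.
elim: k N => [//|k IH] N.
exists (fun t => - N%:R * flat_exp N.+1 t + flat_exp N.+2 t).
  exact: is_derive_flat_exp.
apply: times_differentiableD => //; apply: times_differentiableM => //.
exact: times_differentiable_cst.
Qed.

(** The form [-1 * t + 1] is the one to which [times_differentiable_affine] applies. *)
Definition smooth_step (t : R) : R :=
  flat_exp 0 t * (flat_exp 0 t + flat_exp 0 (-1 * t + 1))^-1.

Lemma flat_exp_ge0 N t : 0 <= flat_exp N t.
Proof.
rewrite /flat_exp; case: ifPn => // t0.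
by rewrite mulr_ge0 ?exprn_ge0 ?expR_ge0// invr_ge0 ltW.
Qed.

Lemma flat_exp_gt0 N t : 0 < t -> 0 < flat_exp N t.
Proof.
move=> t0; rewrite /flat_exp t0.
by rewrite mulr_gt0 ?exprn_gt0 ?expR_gt0// invr_gt0.
Qed.

Lemma smooth_step_den_gt0 t : 0 < flat_exp 0 t + flat_exp 0 (-1 * t + 1).
Proof.
have [t0|t0] := ltP 0 t.
  by rewrite ltr_wpDr ?flat_exp_ge0 ?flat_exp_gt0.
by rewrite ltr_wpDl ?flat_exp_ge0 ?flat_exp_gt0//; lra.
Qed.

Lemma times_differentiable_smooth_step k : times_differentiable k smooth_step.
Proof.
apply: times_differentiableM; first exact: times_differentiable_flat_exp.
apply: times_differentiableV; first by move=> t; rewrite gt_eqF ?smooth_step_den_gt0.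
apply: times_differentiableD; first exact: times_differentiable_flat_exp.
by apply: times_differentiable_affine; exact: times_differentiable_flat_exp.
Qed.

Lemma smooth_step_le0 t : t <= 0 -> smooth_step t = 0.
Proof. by move=> t0; rewrite /smooth_step /flat_exp ltNge t0/= mul0r. Qed.

Lemma smooth_step_ge1 t : 1 <= t -> smooth_step t = 1.
Proof.
move=> t1; rewrite /smooth_step [flat_exp _ (_ * _ + _)]/flat_exp ifF; last by lra.
by rewrite addr0 mulfV// gt_eqF ?flat_exp_gt0//; lra.
Qed.

Lemma smooth_step_ge0 t : 0 <= smooth_step t.
Proof. by rewrite /smooth_step mulr_ge0 ?flat_exp_ge0// invr_ge0 ltW ?smooth_step_den_gt0. Qed.

Lemma smooth_step_le1 t : smooth_step t <= 1.
Proof.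
by rewrite /smooth_step ler_pdivrMr ?smooth_step_den_gt0// mul1r lerDl flat_exp_ge0.
Qed.

Lemma times_differentiable_derive1n k f :
  (forall l, times_differentiable l f) ->
  forall x : R, is_derive x 1 f^`(k)%classic (f^`(k.+1)%classic x).
Proof.
move=> cf x.
suff {x} : forall l, times_differentiable l f^`(k)%classic.
  move=> /(_ 1%N) [df fdf _]; rewrite derive1nS derive1E.
  by apply: derivableP; exact: (@ex_derive _ _ _ _ _ _ _ (fdf x)).
elim: k => [//|k IH] l; case: (IH l.+1) => df fdf.
rewrite derive1nS; suff -> : (f^`(k))^`()%classic = df by [].
by apply/funext => x; rewrite derive1E; apply: derive_val.
Qed.

(** As a difference of two consecutive translates of a step, its integer translates telescope, which
    yields a partition of unity in [sum_unit_bump]. *)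
Definition unit_bump (t : R) : R := smooth_step (1 * t + 1) + -1 * smooth_step t.

Lemma is_derive_unit_bump k (x : R) :
  is_derive x 1 unit_bump^`(k)%classic (unit_bump^`(k.+1)%classic x).
Proof.
apply: times_differentiable_derive1n => l.
apply: times_differentiableD.
  by apply: times_differentiable_affine; exact: times_differentiable_smooth_step.
apply: times_differentiableM; first exact: times_differentiable_cst.
exact: times_differentiable_smooth_step.
Qed.

Lemma unit_bump_ge0 t : 0 <= unit_bump t.
Proof.
rewrite /unit_bump; have [t0|t0] := leP 0 t.
  rewrite [smooth_step (_ + _)]smooth_step_ge1; last by lra.
  by have := smooth_step_le1 t; lra.
by rewrite [smooth_step t]smooth_step_le0; [have := smooth_step_ge0 (1 * t + 1); lra|lra].
Qed.

Lemma unit_bump_out (t : R) : 1 <= `|t| -> unit_bump t = 0.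
Proof.
rewrite /unit_bump => t1; have [t0|t0] := leP 0 t.
  move: t1; rewrite ger0_norm// => t1.
  by rewrite !smooth_step_ge1; lra.
move: t1; rewrite ltr0_norm// => t1.
by rewrite !smooth_step_le0; lra.
Qed.

(** Where |t| > 1 the function vanishes locally, and so do its derivatives. At |t| = 1 continuity
    decides: a nonzero value would persist at the point [y], slightly further out. *)
Lemma derive_unit_bump_out k (t : R) : 1 <= `|t| -> unit_bump^`(k)%classic t = 0.
Proof.
have lt1 j (x : R) : 1 < `|x| -> unit_bump^`(j)%classic x = 0.
  elim: j x => [x x1|j IH x x1]; first by rewrite /= unit_bump_out// ltW.
  rewrite derive1nS derive1E.
  transitivity ('D_1 (fun=> 0 : R) x); last exact: derive_cst.
  apply: near_eq_derive; near=> y; apply: IH; near: y.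
  exact: (cvgr_gt _ (@norm_continuous _ R x) _ x1).
rewrite le_eqVlt => /orP[/eqP t1|/lt1//].
have cb : {for t, continuous unit_bump^`(k)%classic}.
  apply: differentiable_continuous; apply/derivable1_diffP.
  exact: (@ex_derive _ _ _ _ _ _ _ (is_derive_unit_bump k t)).
apply/eqP/negPn/negP => /eqP/eqP bt0.
have b0 : 0 < `|unit_bump^`(k)%classic t| by rewrite normr_gt0.
have : \forall y \near t, 0 < `|unit_bump^`(k)%classic y|.
  exact: (cvgr_norm_gt _ cb _ b0).
move=> /nbhs_ballP[e /= e0 he].
pose y := t + Num.sg t * (e / 2).
have st : `|Num.sg t| = 1 by rewrite normr_sg -normr_gt0 -t1 ltr01.
have y1 : 1 < `|y|.
  rewrite /y; move: t1; have [t0|t0] := leP 0 t.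
    rewrite ger0_norm// => t1.
    by rewrite gtr0_sg -?t1// ger0_norm; lra.
  by rewrite ltr0_norm// => t1; rewrite ltr0_sg// ltr0_norm; lra.
have /he : ball t e y.
  rewrite /ball/= opprD addNKr normrN normrM st mul1r.
  by rewrite gtr0_norm; lra.
by rewrite lt1// normr0 ltxx.
Unshelve. all: end_near. Qed.

Lemma derive_unit_bump_bounded k :
  exists2 B : R, 0 < B & forall t, `|unit_bump^`(k)%classic t| <= B.
Proof.
have cb : continuous unit_bump^`(k)%classic.
  move=> t; apply: differentiable_continuous; apply/derivable1_diffP.
  exact: (@ex_derive _ _ _ _ _ _ _ (is_derive_unit_bump k t)).
have : compact (unit_bump^`(k)%classic @` `[-1, 1]).
  apply: continuous_compact; last exact: segment_compact.
  exact: continuous_subspaceT.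
move=> /compact_bounded[M [_ hM]].
exists (Num.max 1 (M + 1)); first by rewrite lt_max ltr01.
move=> t; rewrite le_max; apply/orP; right.
have [t1|t1] := leP 1 `|t|.
  rewrite derive_unit_bump_out// normr0.
  have := hM (M + 1); rewrite ltrDl => /(_ ltr01) h.
  apply: le_trans (h (unit_bump^`(k)%classic 0) _) => //.
  by exists 0 => //=; rewrite in_itv/=; apply/andP; split; lra.
apply: (hM (M + 1)); first by rewrite ltrDl.
by exists t => //=; rewrite in_itv/= -ler_norml ltW.
Qed.

Lemma sum_unit_bump N t : \sum_(j < N) unit_bump (t - j%:R) =
  smooth_step (t + 1) - smooth_step (t + 1 - N%:R).
Proof.
elim: N => [|N IH]; first by rewrite big_ord0 subr0 subrr.
rewrite big_ord_recr/= IH /unit_bump.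
rewrite (_ : t + 1 - N.+1%:R = t - N%:R); last by rewrite -natr1; ring.
rewrite (_ : 1 * (t - N%:R) + 1 = t + 1 - N%:R); last by ring.
by ring.
Qed.

Lemma sum_unit_bump_le1 N t : \sum_(j < N) unit_bump (t - j%:R) <= 1.
Proof.
rewrite sum_unit_bump; have := smooth_step_le1 (t + 1).
by have := smooth_step_ge0 (t + 1 - N%:R); lra.
Qed.

Lemma sum_unit_bump_eq1 N t : 0 <= t -> t + 1 <= N%:R ->
  \sum_(j < N) unit_bump (t - j%:R) = 1.
Proof.
move=> t0 tN; rewrite sum_unit_bump smooth_step_ge1; last by lra.
by rewrite smooth_step_le0 ?subr0//; lra.
Qed.

Lemma sum_derive_unit_bump_bounded k :
  exists2 B : R, 0 < B & forall N t,
    \sum_(j < N) `|unit_bump^`(k)%classic (t - j%:R)| <= B.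
Proof.
have [B B0 hB] := derive_unit_bump_bounded k.
exists (B * 2); first by rewrite mulr_gt0.
move=> N t.
(* At most two translates are nonzero at t, and the bound telescopes with the
   Heaviside function H, as 1_{|t| < 1} <= H (t + 1) - H (t - 1). *)
pose H (x : R) : R := ((0 < x)%R)%:R.
apply: (@le_trans _ _ (\sum_(j < N) B * (H (t - j%:R + 1) - H (t - j%:R - 1)))).
  apply: ler_sum => j _; set x := t - j%:R; rewrite /H.
  have [x1|x1] := leP 1 `|x|.
    rewrite derive_unit_bump_out// normr0; apply: mulr_ge0; first exact: ltW.
    rewrite subr_ge0 ler_nat.
    have [h|//] := boolP (0 < x - 1); first by rewrite (_ : (0 < x + 1) = true)//; lra.
  have := x1; rewrite ltr_norml => /andP[xl xr].
  rewrite (_ : (0 < x + 1) = true); last by lra.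
  by rewrite (_ : (0 < x - 1) = false); [rewrite subr0 mulr1; exact: hB|lra].
rewrite -mulr_sumr ler_pM2l//.
have -> : \sum_(j < N) (H (t - j%:R + 1) - H (t - j%:R - 1)) =
  H (t + 1) + H t - (H (t + 1 - N%:R) + H (t - N%:R)).
  elim: N => [|N IH]; first by rewrite big_ord0 !subr0 subrr.
  rewrite big_ord_recr/= IH.
  rewrite (_ : t + 1 - N.+1%:R = t - N%:R); last by rewrite -natr1; ring.
  rewrite (_ : t - N.+1%:R = t - N%:R - 1); last by rewrite -natr1; ring.
  rewrite (_ : t - N%:R + 1 = t + 1 - N%:R); last by ring.
  by ring.
have H1 x : H x <= 1 by rewrite /H lern1 leq_b1.
have H0 x : 0 <= H x by rewrite /H ler0n.
have := H1 (t + 1); have := H1 t; have := H0 (t + 1 - N%:R); have := H0 (t - N%:R).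
by lra.
Qed.

End smooth_line.

(** * Smooth functions of several variables *)

Section smooth_space.
Context {R : realType} {n : nat}.
Implicit Types (phi psi : 'rV[R]_n -> R) (x : 'rV[R]_n) (s : seq 'I_n).

Definition iter_partial phi s := foldr partial phi s.

Lemma smooth_continuous phi : smooth phi -> continuous phi.
Proof. by move=> /(_ [::])[]. Qed.

Lemma smooth_derivable phi i x : smooth phi -> derivable phi x (delta_mx ord0 i).
Proof. by move=> /(_ [::])[_]; exact. Qed.

Lemma smooth_partial phi i : smooth phi -> smooth (partial i phi).
Proof. by move=> sphi s; have := sphi (rcons s i); rewrite foldr_rcons. Qed.

Lemma smooth_iter_partial phi s : smooth phi -> smooth (iter_partial phi s).
Proof. by elim: s => [//|i s IH] /IH; exact: smooth_partial. Qed.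

Lemma smooth_is_derive phi i x : smooth phi ->
  is_derive x (delta_mx ord0 i) phi (partial i phi x).
Proof. by move=> sphi; apply: derivableP; exact: smooth_derivable. Qed.

Lemma smooth_coind (P : ('rV[R]_n -> R) -> Prop) :
  (forall phi, P phi -> [/\ continuous phi,
     forall i x, derivable phi x (delta_mx ord0 i) & forall i, P (partial i phi)]) ->
  forall phi, P phi -> smooth phi.
Proof.
move=> Pcont phi Pphi s /=.
suff /Pcont[] : P (foldr partial phi s) by [].
by elim: s => [//|i s IH] /=; have [_ _] := Pcont _ IH; exact.
Qed.

Lemma partialD phi psi i : smooth phi -> smooth psi ->
  partial i (fun x => phi x + psi x) = (fun x => partial i phi x + partial i psi x).
Proof.
move=> sphi spsi; apply/funext => x.
have := smooth_is_derive i x sphi; have := smooth_is_derive i x spsi => dpsi dphi.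
exact: (@derive_val _ _ _ _ _ _ _ (is_deriveD dphi dpsi)).
Qed.

Lemma partialM phi psi i : smooth phi -> smooth psi ->
  partial i (fun x => phi x * psi x) =
  (fun x => partial i phi x * psi x + phi x * partial i psi x).
Proof.
move=> sphi spsi; apply/funext => x.
have := smooth_is_derive i x sphi; have := smooth_is_derive i x spsi => dpsi dphi.
rewrite [LHS](@derive_val _ _ _ _ _ _ _ (is_deriveM dphi dpsi)).
by rewrite addrC /GRing.scale/= [_ * psi x]mulrC.
Qed.

(* Closed under [partial], so that [smooth_coind] applies to sums and products. *)
Inductive smooth_gen : ('rV[R]_n -> R) -> Prop :=
| smooth_gen_base phi : smooth phi -> smooth_gen phi
| smooth_genD phi psi : smooth_gen phi -> smooth_gen psi ->
    smooth_gen (fun x => phi x + psi x)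
| smooth_genM phi psi : smooth phi -> smooth psi ->
    smooth_gen (fun x => phi x * psi x).

Lemma smooth_gen_smooth phi : smooth_gen phi -> smooth phi.
Proof.
apply: smooth_coind => {}phi; elim=> {phi}
    [phi sphi|phi psi _ [cphi dphi pphi] _ [cpsi dpsi ppsi]|phi psi sphi spsi].
- split; [exact: smooth_continuous|by move=> i x; exact: smooth_derivable|].
  by move=> i; apply: smooth_gen_base; exact: smooth_partial.
- split; first by move=> x; exact: (continuousD (cphi x) (cpsi x)).
    by move=> i x; apply: derivableD; [exact: dphi|exact: dpsi].
  move=> i; rewrite [partial _ _](_ : _ = fun x => partial i phi x + partial i psi x).
    exact: smooth_genD.
  by apply/funext => x; rewrite /partial deriveD.
- split.
  + by move=> x; apply: continuousM; exact: smooth_continuous.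
  + by move=> i x; apply: derivableM; exact: smooth_derivable.
  + move=> i; rewrite partialM//.
    exact: (smooth_genD (smooth_genM (smooth_partial i sphi) spsi)
                        (smooth_genM sphi (smooth_partial i spsi))).
Qed.

Lemma smoothD phi psi : smooth phi -> smooth psi -> smooth (fun x => phi x + psi x).
Proof.
move=> sphi spsi; apply: smooth_gen_smooth.
by apply: smooth_genD; exact: smooth_gen_base.
Qed.

Lemma smoothM phi psi : smooth phi -> smooth psi -> smooth (fun x => phi x * psi x).
Proof. by move=> sphi spsi; exact: (smooth_gen_smooth (smooth_genM sphi spsi)). Qed.

Lemma partial_cst (c : R) i : partial i (fun=> c) = (fun _ : 'rV[R]_n => 0).
Proof. by apply/funext => x; rewrite /partial derive_cst. Qed.

Lemma iter_partial_cst (c : R) s :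
  iter_partial (fun=> c) s = (fun=> if s is [::] then c else 0).
Proof.
elim: s => [//|i s IH]; rewrite [LHS]/= -/(iter_partial _ _) IH.
exact: partial_cst.
Qed.

Lemma smooth_cst (c : R) : smooth (fun _ : 'rV[R]_n => c).
Proof.
move=> s /=; rewrite -/(iter_partial _ _) iter_partial_cst; split.
  exact: cst_continuous.
by move=> i x; exact: derivable_cst.
Qed.

Lemma iter_partialD phi psi s : smooth phi -> smooth psi ->
  iter_partial (fun x => phi x + psi x) s =
  (fun x => iter_partial phi s x + iter_partial psi s x).
Proof.
move=> sphi spsi; elim: s => [//|i s IH] /=.
by rewrite IH (partialD i (smooth_iter_partial s sphi) (smooth_iter_partial s spsi)).
Qed.

Lemma iter_partial_rcons phi s i :
  iter_partial phi (rcons s i) = iter_partial (partial i phi) s.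
Proof. by rewrite /iter_partial foldr_rcons. Qed.

(* Leibniz' rule, with the number of terms bounded by [2 ^ k]. *)
Lemma iter_partialM_le phi psi k (h K1 K2 : R) x : 0 < h ->
  smooth phi -> smooth psi ->
  (forall s, (size s <= k)%N -> `|iter_partial phi s x| <= K1 / h ^+ size s) ->
  (forall s, (size s <= k)%N -> `|iter_partial psi s x| <= K2 / h ^+ size s) ->
  forall s, (size s <= k)%N ->
    `|iter_partial (fun y => phi y * psi y) s x| <= 2 ^+ size s * K1 * K2 / h ^+ size s.
Proof.
move=> h0 sphi spsi bphi bpsi s.
(* The induction peels off the innermost derivative. It turns the product into two products, for
   which the hypothesis holds with K1 / h or K2 / h; each step doubles the number of terms. *)
elim/last_ind: s k phi psi K1 K2 sphi spsi bphi bpsi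
    => [|s i IH] [|k] phi psi K1 K2 sphi spsi bphi bpsi //.
- move=> _ /=; rewrite !expr0 invr1 mul1r mulr1 normrM.
  have := bphi [::] isT; have := bpsi [::] isT.
  by rewrite /= !expr0 invr1 !mulr1 => ? ?; exact: ler_pM.
- move=> _ /=; rewrite !expr0 invr1 mul1r mulr1 normrM.
  have := bphi [::] isT; have := bpsi [::] isT.
  by rewrite /= !expr0 invr1 !mulr1 => ? ?; exact: ler_pM.
- by rewrite size_rcons.
rewrite size_rcons ltnS => sk.
have partial_le ph K : (forall s, (size s <= k.+1)%N ->
      `|iter_partial ph s x| <= K / h ^+ size s) ->
    forall j s, (size s <= k)%N ->
      `|iter_partial (partial j ph) s x| <= K / h / h ^+ size s.
  move=> bK j t tk; have := bK (rcons t j).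
  by rewrite size_rcons iter_partial_rcons -mulrA -invfM -exprS; exact.
have restrict ph K : (forall s, (size s <= k.+1)%N ->
      `|iter_partial ph s x| <= K / h ^+ size s) ->
    forall s, (size s <= k)%N -> `|iter_partial ph s x| <= K / h ^+ size s.
  by move=> bK t tk; apply: bK; rewrite ltnW.
rewrite iter_partial_rcons partialM// iter_partialD; last 2 first.
- exact: (smoothM (smooth_partial i sphi) spsi).
- exact: (smoothM sphi (smooth_partial i spsi)).
rewrite (le_trans (ler_normD _ _))//.
have := IH k _ _ _ _ (smooth_partial i sphi) spsi (partial_le _ _ bphi i)
  (restrict _ _ bpsi) sk.
have := IH k _ _ _ _ sphi (smooth_partial i spsi) (restrict _ _ bphi)
  (partial_le _ _ bpsi i) sk.
move=> h1 h2; rewrite (le_trans (lerD h2 h1))// le_eqVlt.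
apply/orP; left; apply/eqP; rewrite (exprS 2) (exprS h) (_ : (h * _)^-1 = h^-1 * (h ^+ size s)^-1).
  by ring.
exact: invfM.
Qed.

Lemma iter_partial_local phi psi (U : set 'rV[R]_n) s : open U ->
  (forall x, U x -> phi x = psi x) ->
  forall x, U x -> iter_partial phi s x = iter_partial psi s x.
Proof.
move=> oU eqU; elim: s => [//|i s IH] x Ux /=.
apply: near_eq_derive; near=> y; apply: IH; near: y.
exact: open_nbhs_nbhs.
Unshelve. all: end_near. Qed.

(** Bounds are proved for lists of directions, where induction is easy, and reach multi-indices
    through this list. *)
Lemma multi_partialE m (alpha : multi_index n m) phi :
  multi_partial alpha phi =
  iter_partial phi (flatten [seq nseq (alpha i) i | i <- enum 'I_n]).
Proof.
rewrite /multi_partial; elim: (enum _) => [//|i l IH] /=.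
rewrite IH /iter_partial foldr_cat.
by elim: (nat_of_ord (alpha i)) => [//|k IHk] /=; rewrite IHk.
Qed.

Lemma size_multi_order m (alpha : multi_index n m) :
  size (flatten [seq nseq (alpha i) i | i <- enum 'I_n]) = multi_order alpha.
Proof.
rewrite size_flatten /shape -map_comp sumnE big_map /multi_order big_enum/=.
by apply: eq_bigr => i _; rewrite size_nseq.
Qed.

Lemma is_derive_sumf (I : finType) (P : pred I) (F : I -> 'rV[R]_n -> R)
    (dF : I -> R) x v :
  (forall j, P j -> is_derive x v (F j) (dF j)) ->
  is_derive x v (fun y => \sum_(j | P j) F j y) (\sum_(j | P j) dF j).
Proof.
move=> dFF; rewrite (_ : (fun y => _) = \sum_(j | P j) F j); last first.
  by apply/funext => y; rewrite fct_sumE.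
elim/big_ind2 : _ => //; first exact: is_derive_cst.
by move=> f df g dg ? ?; exact: is_deriveD.
Qed.

(** Along the line through [x] in direction [i] only the factor [F i] moves; the others form the
    constant [c], and the claim becomes one about functions of one variable. *)
Lemma is_derive_prod_coord (F dF : 'I_n -> R -> R) i x :
  (forall l (t : R), is_derive t 1 (F l) (dF l t)) ->
  is_derive x (delta_mx ord0 i) (fun y => \prod_l F l (y ord0 l))
    (\prod_l (if l == i then dF l else F l) (x ord0 l)).
Proof.
move=> dFF.
pose c := \prod_(l | l != i) F l (x ord0 l).
have Eline (t : R) : \prod_l F l ((t *: delta_mx ord0 i + x) ord0 l) =
    F i (t + x ord0 i) * c.
  rewrite (bigD1 i)//=; congr (_ * _); first by rewrite !mxE !eqxx/= mulr1.
  by apply: eq_bigr => l /negbTE li; rewrite !mxE li andbF mulr0 add0r.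
have -> : \prod_l (if l == i then dF l else F l) (x ord0 l) = dF i (x ord0 i) * c.
  rewrite (bigD1 i)//= eqxx; congr (_ * _).
  by apply: eq_bigr => l /negbTE ->.
have dline : is_derive (0 : R) 1
    (fun t : R => \prod_l F l ((t *: delta_mx ord0 i + x) ord0 l)) (dF i (x ord0 i) * c).
  rewrite (_ : (fun t => _) = (fun t => F i (t + x ord0 i) * c)); last exact/funext.
  have d1 : is_derive (0 : R) 1 (fun t : R => F i (t + x ord0 i)) (dF i (x ord0 i) * 1).
    apply: (@is_derive1_comp _ (F i) (fun t => t + x ord0 i)); first by rewrite add0r.
    have h : is_derive (0 : R) 1 (fun t : R => t + x ord0 i) (1 + 0).
      by apply: is_deriveD.
    by apply: (is_derive_eq h); rewrite addr0.
  have d2 : is_derive (0 : R) 1 (fun t : R => c) 0 by exact: is_derive_cst.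
  apply: (is_derive_eq (is_deriveM d1 d2)).
  by rewrite /GRing.scale/= mulr0 add0r mulr1 mulrC.
have [dl1 dl2] := dline.
apply: DeriveDef; first exact/derivable1P.
rewrite -dl2 /derive.
set g1 := fun h => h^-1 *: _; set g2 := fun h => h^-1 *: _; suff -> : g1 = g2 by [].
by apply/funext => t; rewrite /g1 /g2 /= addr0 scale0r add0r [_%:A]mulr1.
Qed.

End smooth_space.

(** * Cut-off functions *)

Section cutoff.
Context {R : realType} {n : nat}.
Implicit Types (x : 'rV[R]_n) (s : seq 'I_n).

Lemma continuous_prod_seq (T : topologicalType) (I : Type) (r : seq I) (F : I -> T -> R) :
  (forall i, continuous (F i)) -> continuous (fun x : T => \prod_(i <- r) F i x).
Proof.
move=> cF; elim: r => [|i r IH].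
  rewrite (_ : (fun x : T => _) = fun=> 1 : R); first exact: cst_continuous.
  by apply/funext => x; rewrite big_nil.
rewrite (_ : (fun x : T => _) = fun x : T => F i x * \prod_(i <- r) F i x); last first.
  by apply/funext => x; rewrite big_cons.
by move=> x; apply: continuousM; [exact: cF|exact: IH].
Qed.

Lemma continuous_sum_seq (T : topologicalType) (I : Type) (r : seq I) (P : pred I)
    (F : I -> T -> R) :
  (forall i, continuous (F i)) -> continuous (fun x : T => \sum_(i <- r | P i) F i x).
Proof.
move=> cF; elim: r => [|i r IH].
  rewrite (_ : (fun x : T => _) = fun=> 0 : R); first exact: cst_continuous.
  by apply/funext => x; rewrite big_nil.
have [Pi|Pi] := boolP (P i); last first.
  rewrite (_ : (fun x : T => _) = fun x : T => \sum_(i <- r | P i) F i x)//.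
  by apply/funext => x; rewrite big_cons (negbTE Pi).
rewrite (_ : (fun x : T => _) = fun x : T => F i x + \sum_(i <- r | P i) F i x); last first.
  by apply/funext => x; rewrite big_cons Pi.
by move=> x; exact: (continuousD (cF _ _) (IH _)).
Qed.

Section bumps.
Variables (h : R) (L N : nat) (P : pred {ffun 'I_n -> 'I_N}).
Hypothesis h0 : 0 < h.
Implicit Type e : 'I_n -> nat.

Let scaled (k c : nat) (t : R) : R :=
  h^-1 ^+ k * unit_bump^`(k)%classic (h^-1 * t + (L%:R - c%:R)).

Let is_derive_scaled k c (t : R) : is_derive t 1 (scaled k c) (scaled k.+1 c t).
Proof.
have d1 : is_derive t 1 (fun t : R => h^-1 * t + (L%:R - c%:R)) (h^-1 *: 1 + 0).
  by apply: is_deriveD.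
have d2 : is_derive t 1 (fun t : R => unit_bump^`(k)%classic (h^-1 * t + (L%:R - c%:R)))
    (unit_bump^`(k.+1)%classic (h^-1 * t + (L%:R - c%:R)) * (h^-1 *: 1 + 0)).
  apply: (@is_derive1_comp _ (unit_bump^`(k)%classic) (fun t : R => h^-1 * t + (L%:R - c%:R))).
  exact: is_derive_unit_bump.
have d3 : is_derive t 1 (fun t : R => h^-1 ^+ k) 0 by exact: is_derive_cst.
apply: (is_derive_eq (is_deriveM d3 d2)).
by rewrite /scaled /GRing.scale/= !addr0 mulr1 mulr0 addr0 exprS; ring.
Qed.

(* For [e = 0], a sum of grid bumps of mesh [h], equal to 1 far inside the union
   of the cells of [P] since the translates of [unit_bump] add up to 1. *)
Definition bumps e x : R := \sum_(j | P j)
  \prod_l (h^-1 ^+ e l *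
           unit_bump^`(e l)%classic (h^-1 * x ord0 l + (L%:R - (j l)%:R))).

Definition incr_at (i : 'I_n) e : 'I_n -> nat := fun l => (e l + (l == i))%N.

Lemma is_derive_bumps e i x :
  is_derive x (delta_mx ord0 i) (bumps e) (bumps (incr_at i e) x).
Proof.
have key (j : {ffun 'I_n -> 'I_N}) : P j -> is_derive x (delta_mx ord0 i)
    (fun y : 'rV[R]_n => \prod_l scaled (e l) (j l) (y ord0 l))
    (\prod_l scaled (incr_at i e l) (j l) (x ord0 l)).
  move=> _.
  have := @is_derive_prod_coord R n (fun l => scaled (e l) (j l))
    (fun l => scaled (e l).+1 (j l)) i x (fun l t => is_derive_scaled _ _ t).
  move=> H; apply: (is_derive_eq H); apply: eq_bigr => l _.
  by rewrite /incr_at; case: eqP => _; rewrite ?addn1 ?addn0.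
exact: is_derive_sumf key.
Qed.

Lemma continuous_bumps e : continuous (bumps e).
Proof.
apply: continuous_sum_seq => j; apply: continuous_prod_seq => l.
have cs : continuous (scaled (e l) (j l)).
  move=> t; apply: differentiable_continuous; apply/derivable1_diffP.
  exact: (@ex_derive _ _ _ _ _ _ _ (is_derive_scaled _ _ t)).
move=> x; exact: (continuous_comp (@coord_continuous _ _ _ ord0 l x) (cs _)).
Qed.

Lemma partial_bumps e i : partial i (bumps e) = bumps (incr_at i e).
Proof.
apply/funext => x.
exact: (@derive_val _ _ _ _ _ _ _ (is_derive_bumps e i x)).
Qed.

Lemma iter_partial_bumps e s : iter_partial (bumps e) s = bumps (foldr incr_at e s).
Proof. by elim: s => [//|i s IH] /=; rewrite IH partial_bumps. Qed.

Lemma smooth_bumps e : smooth (bumps e).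
Proof.
move=> s /=; rewrite -/(iter_partial _ _) iter_partial_bumps; split.
  exact: continuous_bumps.
by move=> i x; have [] := is_derive_bumps (foldr incr_at e s) i x.
Qed.

Lemma sum_incr_at e s : (\sum_l foldr incr_at e s l = \sum_l e l + size s)%N.
Proof.
elim: s => [|i s IH] /=; first by rewrite addn0.
rewrite /incr_at big_split/= IH addnS -addn1; congr (_ + _)%N.
by rewrite (bigD1 i)//= eqxx big1 ?addn0// => l /negbTE ->.
Qed.

(** Once the restriction to [P] is dropped, the sum over the grid of products is a product of [n]
    one-dimensional sums. This is why the bound depends neither on [N] nor on [P]. *)
Lemma bumps_le (B : R) e x :
  (forall l t, \sum_(c < N) `|unit_bump^`(e l)%classic (t - c%:R)| <= B) ->
  `|bumps e x| <= h^-1 ^+ (\sum_l e l) * B ^+ n.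
Proof.
move=> bB; rewrite /bumps (le_trans (ler_norm_sum _ _ _))//.
pose F l (c : 'I_N) : R := h^-1 ^+ e l *
  `|unit_bump^`(e l)%classic (h^-1 * x ord0 l + L%:R - c%:R)|.
have F0 l c : 0 <= F l c by rewrite mulr_ge0// exprn_ge0// invr_ge0 ltW.
apply: (@le_trans _ _ (\sum_(j : {ffun 'I_n -> 'I_N}) \prod_l F l (j l))).
  rewrite big_mkcond/=; apply: ler_sum => j _; case: ifPn => _; last first.
    by apply: prodr_ge0 => l _.
  rewrite normr_prod; apply: ler_prod => l _; rewrite normr_ge0/= /F normrM addrA.
  by rewrite ger0_norm// exprn_ge0// invr_ge0 ltW.
rewrite -bigA_distr_bigA/= -[X in B ^+ X](card_ord n) -prodr_const.
rewrite expr_sum -big_split/=; apply: ler_prod => l _.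
rewrite sumr_ge0//= /F -mulr_sumr ler_wpM2l//.
by rewrite exprn_ge0// invr_ge0 ltW.
Qed.

Lemma bumps0_ge0 x : 0 <= bumps (fun=> 0%N) x.
Proof.
apply: sumr_ge0 => j _; apply: prodr_ge0 => l _.
by rewrite expr0 mul1r; exact: unit_bump_ge0.
Qed.

Lemma bumps0_le1 x : bumps (fun=> 0%N) x <= 1.
Proof.
pose F l (c : 'I_N) := unit_bump (h^-1 * x ord0 l + L%:R - c%:R).
apply: (@le_trans _ _ (\sum_(j : {ffun 'I_n -> 'I_N}) \prod_l F l (j l))).
  rewrite /bumps big_mkcond/=; apply: ler_sum => j _; case: ifPn => _; last first.
    by apply: prodr_ge0 => l _; exact: unit_bump_ge0.
  by rewrite le_eqVlt; apply/orP; left; apply/eqP; apply: eq_bigr => l _; rewrite expr0 mul1r /F addrA.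
rewrite -bigA_distr_bigA/=.
apply: (@le_trans _ _ (\prod_(l < n) (1 : R))); last by rewrite big1.
apply: ler_prod => l _; rewrite sumr_ge0/= => [|c _]; last exact: unit_bump_ge0.
exact: sum_unit_bump_le1.
Qed.

(** The bumps left out by [P] vanish at [x], so they may be added back; the full sum factors into
    one-dimensional partitions of unity. The last two hypotheses keep each coordinate in the range
    covered by the [N] translates. *)
Lemma bumps0_eq1 x :
  (forall j : {ffun 'I_n -> 'I_N}, ~~ P j ->
    exists l, 1 <= `|h^-1 * x ord0 l + L%:R - (j l)%:R|) ->
  (forall l, 0 <= h^-1 * x ord0 l + L%:R) ->
  (forall l, h^-1 * x ord0 l + L%:R + 1 <= N%:R) ->
  bumps (fun=> 0%N) x = 1.
Proof.
move=> xP x0 xN.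
pose F l (c : 'I_N) := unit_bump (h^-1 * x ord0 l + L%:R - c%:R).
transitivity (\sum_(j : {ffun 'I_n -> 'I_N}) \prod_l F l (j l)).
  rewrite /bumps big_mkcond/=; apply: eq_bigr => j _; case: ifPn => [_|/xP[l jl]].
    by apply: eq_bigr => l _; rewrite expr0 mul1r /F addrA.
  by rewrite (bigD1 l)//= /F unit_bump_out ?mul0r.
rewrite -bigA_distr_bigA/= big1// => l _.
exact: sum_unit_bump_eq1.
Qed.

End bumps.

Lemma eucl_dist_le (d : R) (x y : 'rV[R]_n) : 0 <= d -> (forall l, `|x ord0 l - y ord0 l| <= d) ->
  eucl_dist x y <= n%:R * d.
Proof.
move=> d0 xyd; rewrite /eucl_dist -[leRHS]ger0_norm ?mulr_ge0// -sqrtr_sqr.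
rewrite ler_sqrt ?sqr_ge0//; apply: (@le_trans _ _ (\sum_(l < n) d ^+ 2)).
  by apply: ler_sum => l _; rewrite -real_normK ?num_real// ler_sqr.
rewrite sumr_const card_ord -[leLHS]mulr_natl exprMn ler_wpM2r ?sqr_ge0//.
by rewrite -natrX ler_nat expnS expn1; case: (n) => // k; rewrite leq_pmulr.
Qed.

Lemma eucl_dist_ge0 (x y : 'rV[R]_n) : 0 <= eucl_dist x y.
Proof. exact: sqrtr_ge0. Qed.

Lemma eucl_distC (x y : 'rV[R]_n) : eucl_dist x y = eucl_dist y x.
Proof. by congr Num.sqrt; apply: eq_bigr => l _; rewrite -sqrrN opprB. Qed.

Lemma eucl_distxx (x : 'rV[R]_n) : eucl_dist x x = 0.
Proof.
by rewrite /eucl_dist big1 ?sqrtr0// => l _; rewrite subrr expr0n.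
Qed.

Lemma sqr_eucl_dist (x y : 'rV[R]_n) :
  eucl_dist x y ^+ 2 = \sum_(l < n) (x ord0 l - y ord0 l) ^+ 2.
Proof. by rewrite sqr_sqrtr// sumr_ge0// => l _; exact: sqr_ge0. Qed.

Lemma coord_le_eucl_dist (x y : 'rV[R]_n) l : `|x ord0 l - y ord0 l| <= eucl_dist x y.
Proof.
rewrite -ler_sqr ?nnegrE ?eucl_dist_ge0// real_normK ?num_real// sqr_eucl_dist.
by rewrite (bigD1 l)//= lerDl sumr_ge0// => j _; exact: sqr_ge0.
Qed.

(** With C, A, B as set below, the squares of [a i * B - b i * C] add up to B (A B - C^2). *)
Lemma Cauchy_Schwarz_sum (I : finType) (a b : I -> R) :
  (\sum_i a i * b i) ^+ 2 <= (\sum_i a i ^+ 2) * \sum_i b i ^+ 2.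
Proof.
set C := \sum_i a i * b i; set A := \sum_i a i ^+ 2; set B := \sum_i b i ^+ 2.
have B0 : 0 <= B by apply: sumr_ge0 => i _; exact: sqr_ge0.
have [B_eq0|B_neq0] := eqVneq B 0.
  have b0 i : b i = 0.
    have := psumr_eq0P (fun i _ => sqr_ge0 (b i)) B_eq0.
    by move=> /(_ i isT)/eqP; rewrite sqrf_eq0 => /eqP.
  by rewrite /C big1 ?expr0n/= ?B_eq0 ?mulr0// => i _; rewrite b0 mulr0.
have Bgt0 : 0 < B by rewrite lt_def B_neq0.
have : 0 <= \sum_i (a i * B - b i * C) ^+ 2 by apply: sumr_ge0 => i _; exact: sqr_ge0.
have -> : \sum_i (a i * B - b i * C) ^+ 2 = B * (A * B - C ^+ 2).
  rewrite (eq_bigr (fun i => a i ^+ 2 * B ^+ 2 - (a i * b i) * (2 * B * C) + b i ^+ 2 * C ^+ 2)).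
    by rewrite !big_split/= sumrN -!mulr_suml -/A -/B -/C; ring.
  by move=> i _; ring.
by rewrite pmulr_rge0// subr_ge0.
Qed.

Lemma eucl_dist_triangle (y x z : 'rV[R]_n) :
  eucl_dist x z <= eucl_dist x y + eucl_dist y z.
Proof.
rewrite -ler_sqr ?nnegrE ?addr_ge0 ?eucl_dist_ge0//.
rewrite sqrrD !sqr_eucl_dist.
pose a l := x ord0 l - y ord0 l; pose b l := y ord0 l - z ord0 l.
rewrite (eq_bigr (fun l => a l ^+ 2 + (a l * b l) *+ 2 + b l ^+ 2)); last first.
  by move=> l _; rewrite /a /b; ring.
rewrite !big_split/= lerD2r lerD2l -mulr2n lerMn2r/=.
apply: (le_trans (ler_norm _)).
rewrite -ler_sqr ?nnegrE ?normr_ge0 ?mulr_ge0 ?eucl_dist_ge0//.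
by rewrite real_normK ?num_real// exprMn !sqr_eucl_dist; exact: Cauchy_Schwarz_sum.
Qed.

Lemma neighborhood_widen (S : set 'rV[R]_n) (r d : R) x y :
  neighborhood S r y -> eucl_dist x y <= d -> neighborhood S (r + d) x.
Proof.
move=> [z Sz yz] xy; exists z => //; rewrite addrC.
by rewrite (le_lt_trans (eucl_dist_triangle y _ _))// ler_ltD.
Qed.

Lemma neighborhoodS (S : set 'rV[R]_n) (r d : R) : r <= d ->
  neighborhood S r `<=` neighborhood S d.
Proof. by move=> rd x [y Sy xy]; exists y => //; exact: lt_le_trans rd. Qed.

Lemma neighborhood_sub (S : set 'rV[R]_n) (r : R) : 0 < r -> S `<=` neighborhood S r.
Proof. by move=> r0 x Sx; exists x => //; rewrite eucl_distxx. Qed.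

Lemma le_ball_eucl_dist (x y : 'rV[R]_n) (e : R) : 0 < e -> ball x e y ->
  eucl_dist x y <= n%:R * e.
Proof.
move=> e0 [_ xy]; apply: eucl_dist_le; first exact: ltW.
by move=> l; apply: ltW; exact: xy.
Qed.

Lemma eucl_dist_ball (x y : 'rV[R]_n) (e : R) : eucl_dist x y < e -> ball x e y.
Proof.
move=> xye; split; first by exact: le_lt_trans (eucl_dist_ge0 _ _) xye.
move=> i j; rewrite ord1; exact: le_lt_trans (coord_le_eucl_dist _ _ _) xye.
Qed.

Lemma open_neighborhood (S : set 'rV[R]_n) (r : R) : open (neighborhood S r).
Proof.
rewrite openE => x [y Sy xy].
have d0 : 0 < (r - eucl_dist x y) / (n%:R + 1).
  by rewrite divr_gt0 ?subr_gt0// ltr_wpDl.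
apply/nbhs_ballP; exists ((r - eucl_dist x y) / (n%:R + 1)) => //= z.
move=> /(le_ball_eucl_dist d0) xz; exists y => //.
rewrite (le_lt_trans (eucl_dist_triangle x _ _))// eucl_distC -ltrBrDr.
rewrite (le_lt_trans xz)// mulrA ltr_pdivrMr ?ltr_wpDl//.
by rewrite mulrC ltr_pM2l ?subr_gt0// ltrDl.
Qed.

End cutoff.

(** * Cut-off functions near an arbitrary bounded set *)

Section cutoff_existence.
Context {R : realType} {n : nat}.
Implicit Types (x : 'rV[R]_n) (S : set 'rV[R]_n) (s : seq 'I_n).

Lemma bounded_coord S : bounded_set S ->
  exists2 D : R, 0 < D & forall x, S x -> forall l, `|x ord0 l| <= D.
Proof.
move=> [M [_ hM]]; exists (Num.max 0 (M + 1) + 1).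
  by rewrite ltr_wpDl// le_max lexx.
move=> x Sx l; have xM : `|x| < Num.max 0 (M + 1) + 1.
  by rewrite (le_lt_trans (hM (M + 1) _ x Sx)) ?ltrDl// ltr_pwDr// le_max lexx orbT.
have : ball (0 : 'rV[R]_n) (Num.max 0 (M + 1) + 1) x.
  by rewrite -ball_normE /ball_/= sub0r normrN.
by move=> [_ /(_ ord0 l)]; rewrite /ball/= mxE sub0r normrN => /ltW.
Qed.

Lemma coord_bounded S (D : R) : (forall x, S x -> forall l, `|x ord0 l| <= D) ->
  bounded_set S.
Proof.
move=> SD; exists (Num.max 0 D); split; first exact: num_real.
move=> M DM x Sx /=; apply: ltW.
have M0 : 0 < M by rewrite (le_lt_trans _ DM)// le_max lexx.
have : ball (0 : 'rV[R]_n) M x.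
  split=> // i j; rewrite /ball/= mxE sub0r normrN ord1.
  by rewrite (le_lt_trans (SD _ Sx j))// (le_lt_trans _ DM)// le_max lexx orbT.
by rewrite -ball_normE /ball_/= sub0r normrN.
Qed.

Lemma bounded_neighborhood S (r : R) : bounded_set S -> bounded_set (neighborhood S r).
Proof.
move=> /bounded_coord[D D0 SD]; apply: (@coord_bounded _ (D + r)) => x [y Sy xy] l.
rewrite -[x ord0 l](subrK (y ord0 l)) addrC (le_trans (ler_normD _ _))// lerD ?SD//.
exact/ltW/(le_lt_trans (coord_le_eucl_dist _ _ _) xy).
Qed.

(** The function is the sum of the grid bumps whose support meets S_r1. [K] is chosen before the set
    and the radii, as the blow-up argument varies the radii. The support stops at the middle radius,
    which leaves an open margin inside S_r2. *)
Lemma smooth_cutoff (k : nat) :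
  exists2 K : R, 0 < K & forall S (r1 r2 : R), bounded_set S -> r1 < r2 ->
    exists theta : 'rV[R]_n -> R,
    [/\ smooth theta, forall x, 0 <= theta x <= 1,
        forall x, neighborhood S r1 x -> theta x = 1,
        forall x, theta x != 0 -> neighborhood S ((r1 + r2) / 2) x
      & forall s, (size s <= k)%N -> forall x,
          `|iter_partial theta s x| <= K / (r2 - r1) ^+ size s].
Proof.
have [B B1 hB] : exists2 B : R, 1 <= B & forall e N t, (e <= k)%N ->
    \sum_(j < N) `|unit_bump^`(e)%classic (t - j%:R)| <= B.
  elim: (k) => [|k' [B B1 IH]].
    have [B B0 hB] := @sum_derive_unit_bump_bounded R 0.
    exists (1 + B); first by rewrite lerDl ltW.
    by move=> [|//] N t _; rewrite (le_trans (hB N t))// lerDr.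
  have [B' B'0 hB'] := @sum_derive_unit_bump_bounded R k'.+1.
  exists (B + B'); first by rewrite (le_trans B1)// lerDl ltW.
  move=> e N t; rewrite leq_eqVlt => /orP[/eqP->|ek].
    by rewrite (le_trans (hB' N t))// lerDr (le_trans _ B1).
  by rewrite (le_trans (IH _ N t _))// lerDl ltW.
(* With mesh h = (r2 - r1) / c, two points in the support of one bump are at distance at most 2 n h
   <= (r2 - r1) / 2, which keeps the support within the middle radius. *)
pose c : R := 4 * (n%:R + 1).
have c1 : 1 <= c by rewrite /c; have := ler0n R n; lra.
have B0 : 0 < B by rewrite (lt_le_trans _ B1).
exists (c ^+ k * B ^+ n).
  by rewrite mulr_gt0 ?exprn_gt0// (lt_le_trans _ c1).
move=> S r1 r2 bS r12.
have d0 : 0 < r2 - r1 by rewrite subr_gt0.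
have c0 : 0 < c by rewrite (lt_le_trans _ c1).
pose h := (r2 - r1) / c; have h0 : 0 < h by rewrite divr_gt0.
have [D D0 SD] := bounded_coord (bounded_neighborhood r1 bS).
pose L := Num.bound (D / h).
have DL : D / h <= L%:R by apply/ltW/archi_boundP; rewrite divr_ge0// ltW.
(* On S_r1 the coordinates divided by h lie in [-L, L]; shifted by L they lie in [0, 2L], and the
   partition of unity needs one more translate than that. *)
pose N := (L + L).+1.
pose P : pred {ffun 'I_n -> 'I_N} := fun j => `[< exists2 x, neighborhood S r1 x &
  forall l, `|h^-1 * x ord0 l + L%:R - (j l)%:R| < 1 >].
exists (bumps h L P (fun=> 0%N)); split.
- exact: smooth_bumps.
- by move=> x; rewrite bumps0_ge0 bumps0_le1.
- move=> x Sx.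
  have xL l : `|h^-1 * x ord0 l| <= L%:R.
    rewrite normrM gtr0_norm ?invr_gt0// (le_trans _ DL)// mulrC ler_wpM2r//.
      by rewrite invr_ge0 ltW.
    exact: SD.
  apply: bumps0_eq1.
  + move=> j /asboolPn Pj; apply: contrapT => jl; apply: Pj; exists x => // l.
    by rewrite ltNge; apply/negP => jl1; apply: jl; exists l.
  + by move=> l; have := xL l; rewrite ler_norml => /andP[+ _]; rewrite -subr_ge0 opprK.
  + move=> l; have := xL l; rewrite ler_norml => /andP[_ +].
    by rewrite /N -natr1 natrD lerD2r lerD2r.
- move=> x tx.
  have [j Pj jx] : exists2 j, P j &
      forall l, `|h^-1 * x ord0 l + L%:R - (j l)%:R| < 1.
    apply: contrapT => nj; move/eqP: tx; apply; rewrite /bumps big1// => j Pj.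
    have [l jl] : exists l, 1 <= `|h^-1 * x ord0 l + L%:R - (j l)%:R|.
      apply: contrapT => jl; apply: nj; exists j => // l.
      by rewrite ltNge; apply/negP => jl1; apply: jl; exists l.
    by rewrite (bigD1 l)//= expr0 mul1r addrA unit_bump_out ?mul0r.
  move/asboolP : Pj => [y Sy jy].
  rewrite (_ : (r1 + r2) / 2 = r1 + (r2 - r1) / 2); last by field.
  apply: neighborhood_widen Sy _.
  apply: (@le_trans _ _ (n%:R * (2 * h))).
    apply: eucl_dist_le; first by rewrite mulr_ge0// ltW.
    move=> l; rewrite -ler_pdivrMr// -[X in _ / X](gtr0_norm h0) -normfV -normrM.
    rewrite (_ : _ / h = (h^-1 * x ord0 l + L%:R - (j l)%:R) -
                         (h^-1 * y ord0 l + L%:R - (j l)%:R)); last by ring.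
    rewrite (le_trans (ler_normB _ _))//.
    by rewrite (_ : 2 = 1 + 1)//; apply: lerD; exact: ltW.
  rewrite /h /c; have n0 := ler0n R n.
  rewrite (_ : _ * _ = (r2 - r1) / 2 * (n%:R / (n%:R + 1))); last by field; lra.
  by rewrite ler_piMr ?divr_ge0 ?(ltW d0)// ler_pdivrMr; lra.
- move=> s sk x; rewrite iter_partial_bumps//.
  have es l : (foldr incr_at (fun=> 0%N) s l <= k)%N.
    rewrite (leq_trans _ sk)//; have := sum_incr_at (fun=> 0%N) s.
    rewrite [X in (X + _)%N]big1// add0n => <-.
    by rewrite (bigD1 l)//= leq_addr.
  apply: le_trans; first by apply: (@bumps_le _ _ _ _ _ _ h0 B) => l t; exact: hB.
  rewrite sum_incr_at [X in (X + _)%N]big1// add0n /h invf_div expr_div_n mulrAC ler_pM2r.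
    by rewrite ler_pM2r ?exprn_gt0// ler_weXn2l.
  by rewrite invr_gt0 exprn_gt0.
Qed.

End cutoff_existence.

(** * Lebesgue measure of neighbourhoods *)

Section lebesgue_sets.
Context {R : realType} {n : nat}.
Implicit Types (x : 'rV[R]_n) (S : set 'rV[R]_n).
Local Open Scope ereal_scope.

Lemma lebesgue_outer_box (B : @box R n) S : S `<=` box_set B ->
  lebesgue_outer S <= (box_volume B)%:E.
Proof.
move=> SB; apply: ereal_inf_lbound.
exists (fun k => if k is 0%N then B else None) => [x /SB Bx|]; first by exists 0%N.
rewrite (@nneseries_split _ _ 0 1)/=; last by move=> k _; exact: box_volume_ge0.
rewrite big_nat1 eseries0 ?adde0// => -[|i]//.
Qed.

(** The hyperplane cuts every box of a cover of [X] into two half-open boxes whose volumes add up,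
    and the two families cover the two parts of [X]. *)
Lemma caratheodory_half_space (i : 'I_n) (c : R) :
  (@lebesgue_outer R n).-caratheodory [set x | (x ord0 i <= c)%R].
Proof.
set H := [set x | _].
apply: le_caratheodory_measurable => X.
apply: le_ereal_inf_tmp => _ [F XF <-].
pose setc (v : 'rV[R]_n) (t : R) : 'rV[R]_n := \row_l if l == i then t else v ord0 l.
pose lo (B : @box R n) : @box R n :=
  if B is Some (a, b) then Some (a, setc b (Num.min (b ord0 i) c)) else None.
pose hi (B : @box R n) : @box R n :=
  if B is Some (a, b) then Some (setc a (Num.max (a ord0 i) c), b) else None.
have volE B : (box_volume B)%:E = (box_volume (lo B))%:E + (box_volume (hi B))%:E.
  rewrite -EFinD; congr EFin; case: B => [[a b]|] /=; last by rewrite addr0.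
  rewrite [LHS](bigD1 i)// [X in (_ = X + _)%R](bigD1 i)// [X in (_ = _ + X)%R](bigD1 i)//=.
  have e1 : (\prod_(l < n | l != i)
      Num.max 0 (setc b (Num.min (b ord0 i) c) ord0 l - a ord0 l) =
      \prod_(l < n | l != i) Num.max 0 (b ord0 l - a ord0 l))%R.
    by apply: eq_bigr => l /negbTE li; rewrite mxE li.
  have e2 : (\prod_(l < n | l != i)
      Num.max 0 (b ord0 l - setc a (Num.max (a ord0 i) c) ord0 l) =
      \prod_(l < n | l != i) Num.max 0 (b ord0 l - a ord0 l))%R.
    by apply: eq_bigr => l /negbTE li; rewrite mxE li.
  rewrite e1 e2 -mulrDl !mxE eqxx; congr (_ * _)%R.
  rewrite minEle maxEle; set u := a ord0 i; set v := b ord0 i.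
  by rewrite !maxEle; case: (leP u c); case: (leP v c); repeat case: ifPn; lra.
rewrite (eq_eseriesr (fun k _ => volE (F k))) nneseriesD; last 2 first.
- by move=> k _ _; exact: box_volume_ge0.
- by move=> k _ _; exact: box_volume_ge0.
apply: leeD.
- apply: ereal_inf_lbound; exists (lo \o F) => // x [Xx Hx].
  have [k _ Fkx] := XF _ Xx; exists k => //=; case: (F k) Fkx => [[a b]|//] /= ab l.
  rewrite mxE; case: eqP => [->|_]; last exact: ab.
  by have /andP[-> bx] := ab i; rewrite le_min bx Hx.
- apply: ereal_inf_lbound; exists (hi \o F) => // x [Xx Hx].
  have [k _ Fkx] := XF _ Xx; exists k => //=; case: (F k) Fkx => [[a b]|//] /= ab l.
  rewrite mxE; case: eqP => [->|_]; last exact: ab.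
  by have /andP[ax ->] := ab i; rewrite gt_max ax ltNge; move/negP : Hx => ->.
Qed.

Lemma measurable_box_set (B : @box R n) : measurable (box_set B : set (Rn R n)).
Proof.
case: B => [[a b]|]; last exact: measurable0.
rewrite (_ : box_set _ = \bigcap_(l in [set: 'I_n])
  ([set x | (x ord0 l <= b ord0 l)%R] `\` [set x | (x ord0 l <= a ord0 l)%R])).
  apply: fin_bigcap_measurable => // l _.
  by apply: measurableD; exact: caratheodory_half_space.
apply/seteqP; split => [x ab l _|x ab l] /=.
  by have /andP[al bl] := ab l; split => //=; apply/negP; rewrite -ltNge.
have [bl al] := ab l I; apply/andP; split => //.
by rewrite ltNge; apply/negP.
Qed.

(** [U] is the union of the boxes with rational corners contained in it, and there are countably
    many of these. *)
Lemma open_measurable_Rn (U : set 'rV[R]_n) : open U -> measurable (U : set (Rn R n)).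
Proof.
move=> oU.
pose ratbox (p : {ffun 'I_n -> rat * rat}) : @box R n :=
  Some (\row_l ratr (p l).1, \row_l ratr (p l).2).
pose V p : set 'rV[R]_n := if `[< box_set (ratbox p) `<=` U >] then box_set (ratbox p) else set0.
rewrite (_ : U = \bigcup_p V p).
  apply: countable_bigcupT_measurable => [|p]; first exact: countableP.
  by rewrite /V; case: ifPn => _; [exact: measurable_box_set|exact: measurable0].
apply/seteqP; split => [x Ux|x [p _]]; last first.
  by rewrite /V; case: ifPn => // /asboolP; exact.
have /nbhs_ballP[e /= e0 eU] : nbhs x U by exact: open_nbhs_nbhs.
have rats l : {q : rat * rat |
    [/\ x ord0 l - e < ratr q.1, ratr q.1 < x ord0 l,
        x ord0 l <= ratr q.2 & ratr q.2 < x ord0 l + e]%R}.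
  apply: cid.
  have [|q1] := @rat_in_itvoo R (x ord0 l - e)%R (x ord0 l); first by lra.
  rewrite in_itv/= => /andP[? ?].
  have [|q2] := @rat_in_itvoo R (x ord0 l) (x ord0 l + e)%R; first by lra.
  by rewrite in_itv/= => /andP[? ?]; exists (q1, q2); split => //=; exact: ltW.
pose p : {ffun 'I_n -> rat * rat} := [ffun l => sval (rats l)].
exists p => //; rewrite /V; case: ifPn => [_|/asboolPn]; last first.
  case=> y py; apply: eU; split => // i l; rewrite ord1.
  have /andP[] := py l; rewrite !mxE ffunE; case: (rats l) => q [/= ? ? ? ?] ? ?.
  by rewrite /ball/= ltr_distlC; apply/andP; split; lra.
by move=> l; rewrite !mxE ffunE; case: (rats l) => q [/= ? -> -> ?].
Qed.

Lemma closed_measurable_Rn (U : set 'rV[R]_n) : closed U -> measurable (U : set (Rn R n)).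
Proof. by move=> cU; rewrite -[U]setCK; apply/measurableC/open_measurable_Rn/closed_openC. Qed.

Lemma continuous_measurable_Rn (D : set (Rn R n)) (phi : 'rV[R]_n -> R) :
  continuous phi -> measurable_fun D (phi : Rn R n -> R).
Proof.
move=> cphi mD; apply: (measurability _ (RGenOInfty.measurableE R)) => //.
move=> /= _ [_ [a ->] <-]; apply: measurableI => //; apply: open_measurable_Rn.
by apply: open_comp; [move=> x _; exact: cphi|exact: interval_open].
Qed.

Lemma bounded_mes_lty S : bounded_set S -> mes S < +oo.
Proof.
move=> /bounded_coord[D D0 SD].
apply: le_lt_trans (ltry _); apply: (@lebesgue_outer_box (Some (\row_l (- D - 1), \row_l D)%R)).
move=> x Sx l; rewrite !mxE; have := SD x Sx l; rewrite ler_norml => /andP[xl xr].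
by apply/andP; split => //; lra.
Qed.

(** The r-neighbourhood of a nonempty set of diameter at most d lies in the cube of side 2 (d + r)
    centred at any point of that set. *)
Lemma coverable_mes_neighborhood S (d r : R) (N : nat) :
  (0 <= d)%R -> (0 < r)%R -> coverable S d N ->
  mes (neighborhood S r) <= (N%:R * (2 * (d + r)) ^+ n)%:E.
Proof.
move=> d0 r0 [F [dF SF]].
have rd0 : (0 < d + r)%R by rewrite ltr_wpDl.
pose G (k : nat) : set 'rV[R]_n :=
  if insub k is Some i then neighborhood (F i) r else set0.
have GE (i : 'I_N) : G i = neighborhood (F i) r.
  by rewrite /G; case: insubP => [j _ /val_inj ->//|]; rewrite ltn_ord.
have -> : (N%:R * (2 * (d + r)) ^+ n)%:E = \sum_(k < N) ((2 * (d + r)) ^+ n)%:E.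
  by rewrite sumEFin sumr_const card_ord mulr_natl.
apply: (@le_trans _ _ (\sum_(k < N) lebesgue_outer (G k))).
  apply: le_trans (outer_measure_subadditive (@lebesgue_outer R n) G N).
  apply: le_lebesgue_outer => x [y /SF[i _ Fiy] xy].
  rewrite -bigcup_mkord; exists i; first exact: ltn_ord.
  by rewrite (GE i); exists y.
apply: lee_sum => k _; rewrite GE.
have [->|/set0P[z Fz]] := eqVneq (F k) set0.
  rewrite (_ : neighborhood _ _ = set0) ?lebesgue_outer0 ?lee_fin ?exprn_ge0//.
    by rewrite mulr_ge0// ltW.
  by rewrite -subset0 => x [].
have -> : ((2 * (d + r)) ^+ n)%R = @box_volume R n (Some
    (\row_l (z ord0 l - (d + r)), \row_l (z ord0 l + (d + r))))%R.
  rewrite /= (eq_bigr (fun=> (2 * (d + r))%R)); last first.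
    by move=> l _; rewrite !mxE max_r; lra.
  by rewrite prodr_const card_ord.
apply: lebesgue_outer_box => x [y Fy xy] l; rewrite !mxE.
have : (`|x ord0 l - z ord0 l| < d + r)%R.
  rewrite (le_lt_trans (coord_le_eucl_dist _ _ _))//.
  by rewrite (le_lt_trans (eucl_dist_triangle y _ _))// addrC ler_ltD//; exact: (dF k).
by rewrite ltr_distl => /andP[-> /ltW].
Qed.

Lemma ae_mesS (P Q : 'rV[R]_n -> Prop) : (forall x, P x -> Q x) ->
  {ae @mes R n, forall x, P x} -> {ae @mes R n, forall x, Q x}.
Proof.
move=> PQ; apply: (@filterS _ _ (ae_filter_ringOfSetsType (@mes R n))); exact: PQ.
Qed.

Lemma ae_mesS2 (P P' Q : 'rV[R]_n -> Prop) : (forall x, P x -> P' x -> Q x) ->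
  {ae @mes R n, forall x, P x} -> {ae @mes R n, forall x, P' x} ->
  {ae @mes R n, forall x, Q x}.
Proof.
move=> PQ; apply: (@filterS2 _ _ (ae_filter_ringOfSetsType (@mes R n))); exact: PQ.
Qed.

Lemma ae_mes_fin (I : finType) (C : I -> Prop) (P : I -> 'rV[R]_n -> Prop) :
  (forall i, C i -> {ae @mes R n, forall x, P i x}) ->
  {ae @mes R n, forall x, forall i, C i -> P i x}.
Proof.
move=> aeP.
have : {ae @mes R n, forall x, forall i, i \in enum I -> C i -> P i x}.
  elim: (enum I) => [|i s IH]; first exact: aeW.
  have [Ci|nCi] := pselect (C i).
    apply: ae_mesS2 (aeP i Ci) IH => x Pix sP j; rewrite inE => /orP[/eqP -> //|].
    exact: sP.
  apply: ae_mesS IH => x sP j; rewrite inE => /orP[/eqP -> //|]; exact: sP.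
by apply: ae_mesS => x + i; apply; rewrite mem_enum.
Qed.

End lebesgue_sets.

(** * Covering numbers and the volume of thin shells *)

Section fractal_dimension.
Context {R : realType} {n : nat}.
Implicit Types (x : 'rV[R]_n) (S w : set 'rV[R]_n).

Lemma continuous_eucl_dist x : continuous (eucl_dist x).
Proof.
move=> y; apply/(@cvgrPdist_le R R _ (nbhs y) (nbhs_filter y)) => e e0.
have d0 : 0 < e / (n%:R + 1) by rewrite divr_gt0// ltr_wpDl.
apply/nbhs_ballP; exists (e / (n%:R + 1)) => //= z /(le_ball_eucl_dist d0) yz.
have le_e : n%:R * (e / (n%:R + 1)) <= e.
  by rewrite mulrA ler_pdivrMr ?ltr_wpDl// mulrC ler_pM2l// lerDl.
have := eucl_dist_triangle y x z; have := eucl_dist_triangle z x y.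
rewrite (eucl_distC z y) ler_distlC => ? ?; apply/andP; split; lra.
Qed.

(* The point of [S] nearest to [x] is a boundary point. *)
Lemma neighborhood_boundary S (r : R) : compact S ->
  neighborhood S r `\` S `<=` neighborhood (boundary S) r.
Proof.
move=> cS x [[y Sy xy] nSx].
have S0 : S !=set0 by exists y.
have [|z] := compact_EVT_min (f := eucl_dist x) S0 cS.
  by apply: continuous_subspaceT; exact: continuous_eucl_dist.
rewrite inE => Sz zmin; exists z; last first.
  by rewrite (le_lt_trans _ xy)// zmin// inE.
split; first exact: subset_closure.
move=> /nbhs_ballP[e /= e0 zeS].
have xz0 : 0 < eucl_dist x z.
  rewrite lt_def eucl_dist_ge0 andbT; apply/eqP => xz0; apply: nSx.
  apply: zeS; apply: eucl_dist_ball; by rewrite eucl_distC xz0.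
pose d := eucl_dist x z.
(* If z were interior, moving from z towards x by the fraction t would cover a distance t d <= e /
   2, hence stay in S, and come strictly nearer to x. *)
pose t := Num.min 1 (e / (d + d)); have t0 : 0 < t.
  by rewrite lt_min ltr01 divr_gt0// addr_gt0.
have t1 : t <= 1 by rewrite ge_min lexx.
pose v := z + t *: (x - z).
have dist_scale (a b : 'rV[R]_n) (c : R) : 0 <= c ->
    (forall l, a ord0 l - b ord0 l = c * (x ord0 l - z ord0 l)) ->
    eucl_dist a b = c * d.
  move=> c0 abE; rewrite /eucl_dist (eq_bigr (fun l => c ^+ 2 * (x ord0 l - z ord0 l) ^+ 2)).
    by rewrite -mulr_sumr sqrtrM ?sqr_ge0// sqrtr_sqr ger0_norm.
  by move=> l _; rewrite abE exprMn.
have Sv : S v.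
  apply: zeS; apply: eucl_dist_ball; rewrite eucl_distC.
  rewrite (dist_scale _ _ t) ?(ltW t0)//; last by move=> l; rewrite !mxE; ring.
  rewrite (@le_lt_trans _ _ (e / 2))//; last by lra.
  rewrite (_ : e / 2 = e / (d + d) * d); last by (field; apply/eqP => dd0; move: xz0; rewrite -/d; lra).
  by rewrite ler_pM2r// ge_min lexx orbT.
have := zmin v; rewrite inE => /(_ Sv).
rewrite (dist_scale x v (1 - t)) ?subr_ge0//; last by move=> l; rewrite !mxE; ring.
by rewrite -/d leNgt gtr_pMl// gtrDl oppr_lt0 t0.
Qed.

(** Cubes of side r / (n + 1) have Euclidean diameter at most r, and [-D, D] needs at most 2 D (n +
    1) / r + 1 <= c / r of them in each coordinate. *)
Lemma bounded_coverable w (r c D : R) : 0 < r -> r <= 1 ->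
  (forall x, w x -> forall l, `|x ord0 l| <= D) -> 0 <= D ->
  c = 2 * D * (n%:R + 1) + 1 ->
  exists2 N, coverable w r N & N%:R <= (c / r) ^+ n.
Proof.
move=> r0 r1 wD D0 cE.
pose h := r / (n%:R + 1); have n1 : 0 < n%:R + 1 :> R by rewrite ltr_wpDl.
have h0 : 0 < h by rewrite divr_gt0.
pose M := (Num.truncn (2 * D / h)).+1.
have M0 : 0 <= 2 * D / h by rewrite divr_ge0 ?mulr_ge0// ltW.
have Mle : M%:R <= c / r.
  rewrite /M -natr1; have := truncn_le (2 * D / h); rewrite M0 => trM.
  rewrite (@le_trans _ _ (2 * D / h + 1))// ?lerD2r//.
  rewrite (_ : 2 * D / h = 2 * D * (n%:R + 1) / r); last by rewrite /h invf_div mulrA.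
  rewrite cE [leRHS]mulrDl mul1r lerD2l.
  by rewrite -[leLHS]invr1 lef_pV2 ?posrE.
exists (M ^ n)%N; last by rewrite natrX lerXn2r ?nnegrE ?(le_trans _ Mle).
have cardE : #|{ffun 'I_n -> 'I_M}| = (M ^ n)%N by rewrite card_ffun !card_ord.
pose G (j : {ffun 'I_n -> 'I_M}) : set 'rV[R]_n :=
  [set x | forall l, (j l)%:R * h <= x ord0 l + D <= (j l).+1%:R * h].
rewrite -cardE; exists (fun i => G (enum_val i)); split.
  move=> i x y Gx Gy; apply: (@le_trans _ _ (n%:R * h)).
    apply: eucl_dist_le; first exact: ltW.
    move=> l; have /andP[x1 x2] := Gx l; have /andP[y1 y2] := Gy l.
    move: x2 y2; rewrite -natr1 mulrDl mul1r => x2 y2.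
    by rewrite ler_distlC; apply/andP; split; lra.
  by rewrite /h mulrA ler_pdivrMr// mulrC ler_pM2l// lerDl.
move=> x wx.
have xD l : 0 <= x ord0 l + D <= 2 * D.
  by have := wD x wx l; rewrite ler_norml => /andP[? ?]; apply/andP; split; lra.
have trM l : (Num.truncn ((x ord0 l + D) / h) < M)%N.
  rewrite /M ltnS; apply: le_truncn; rewrite ler_pM2r ?invr_gt0//.
  by have /andP[] := xD l.
pose j : {ffun 'I_n -> 'I_M} := [ffun l => Ordinal (trM l)].
exists (enum_rank j) => //; rewrite enum_rankK => l.
rewrite (_ : nat_of_ord (j l) = Num.truncn ((x ord0 l + D) / h)); last by rewrite ffunE.
have /truncn_itv/andP[t1 t2] : 0 <= (x ord0 l + D) / h.
  by rewrite divr_ge0 ?(ltW h0)//; have /andP[] := xD l.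
by apply/andP; split; [rewrite -ler_pdivlMr|rewrite -ler_pdivrMr// ltW].
Qed.

(** Since [k] is the [fine] part of the dimension, the value +oo has to be excluded before [k] says
    anything about covering numbers. Taking r < 1/2 keeps ln (1/r) away from 0. *)
Lemma upper_fractal_dim_ltey w : bounded_set w -> (upper_fractal_dim w < +oo)%E.
Proof.
move=> /bounded_coord[D D0 wD].
pose c := 2 * D * (n%:R + 1) + 1.
have c1 : 1 <= c by rewrite /c lerDr mulr_ge0 ?mulr_ge0 ?addr_ge0// ltW.
pose K := n%:R * (ln c / ln 2 + 1).
apply: (@le_lt_trans _ _ K%:E); last exact: ltry.
rewrite /upper_fractal_dim; set f := (X in limf_esup X _).
apply: (@le_trans _ _ (ereal_sup (f @` `]0, 2^-1[%classic))).
  apply: ereal_inf_lbound; exists `]0, 2^-1[%classic => //.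
  by near=> r => /=; rewrite in_itv/=; apply/andP; split.
apply/ereal_supP => z [r /=]; rewrite in_itv/= => /andP[r0 r2] <-{z}.
have r1 : r <= 1 by lra.
have [N covN Nle] := bounded_coverable r0 r1 wD (ltW D0) (erefl c).
have cr0 : 0 < c / r by rewrite divr_gt0// (lt_le_trans _ c1).
have ln20 : 0 < ln 2 :> R by apply: ln_gt0; rewrite ltr1n.
have ln2r : ln 2 <= ln r^-1.
  by rewrite ler_ln ?posrE ?invr_gt0// -[leLHS]invrK lef_pV2 ?posrE ?invr_gt0// ltW.
have lnr0 : 0 < ln r^-1 by rewrite (lt_le_trans _ ln2r).
have cov0 : (0 <= covering_number w r)%E.
  by apply: le_ereal_inf_tmp => _ [N' _ <-]; rewrite lee_fin.
have : (lne (covering_number w r) <= (n%:R * (ln c + ln r^-1))%:E)%E.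
  have -> : n%:R * (ln c + ln r^-1) = ln ((c / r) ^+ n).
    by rewrite lnXn// lnM ?posrE ?invr_gt0 ?(lt_le_trans _ c1)// mulr_natl.
  rewrite -lne_EFin ?exprn_gt0// lee_lne ?in_itv/= ?cov0 ?leey//.
    by apply: (@le_trans _ _ N%:R%:E); [apply: ereal_inf_lbound; exists N|rewrite lee_fin].
  by rewrite lee_fin exprn_ge0// ltW.
move=> /(lee_wpmul2r (_ : 0 <= ((ln r^-1)^-1)%:E)%E) -/(_ _)/le_trans; apply.
  by rewrite lee_fin invr_ge0 ltW.
rewrite -EFinM lee_fin /K -mulrA ler_wpM2l// mulrDl divff ?gt_eqF// lerD2r.
by rewrite ler_wpM2l ?ln_ge0// lef_pV2.
Unshelve. all: end_near. Qed.

Lemma covering_powR S (k d : R) : bounded_set S ->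
  k = fine (upper_fractal_dim S) -> 0 < d ->
  exists2 r0 : R, 0 < r0 & forall r, 0 < r -> r < r0 ->
    exists2 N, coverable S r N & N%:R <= r `^ (- (k + d)).
Proof.
move=> bS kE d0.
(* The dimension may be -oo, as for the empty set; then k = 0 and the inequality still holds. *)
have dimk : (upper_fractal_dim S < (k + d)%:E)%E.
  have := upper_fractal_dim_ltey bS; rewrite kE.
  case: (upper_fractal_dim S) => [s|//|] _ /=; last by rewrite ltNyr.
  by rewrite lte_fin ltrDl.
have [_ [V V0 <-] supV] := ereal_inf_lt dimk.
have [e /= e0 eV] := V0.
exists (Num.min e 1); first by rewrite lt_min e0 ltr01.
move=> r r0; rewrite lt_min => /andP[re r1].
have Vr : V r by apply: eV => //=; rewrite sub0r normrN gtr0_norm.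
have lnr0 : 0 < ln r^-1 by apply: ln_gt0; rewrite invf_gt1.
have cov0 : (0 <= covering_number S r)%E.
  by apply: le_ereal_inf_tmp => _ [N' _ <-]; rewrite lee_fin.
have : (lne (covering_number S r) * ((ln r^-1)^-1)%:E < (k + d)%:E)%E.
  by apply: le_lt_trans supV; apply: ereal_sup_ubound; exists r.
rewrite lte_pdivrMr// -EFinM => covlt.
have : (covering_number S r < (r `^ (- (k + d)))%:E)%E.
  rewrite -lte_lne ?in_itv/= ?cov0 ?leey ?lee_fin ?powR_ge0//.
  by rewrite leNgt powR_gt0//= ln_powR mulNr -mulrN -lnV ?posrE.
move=> /ereal_inf_lt[_ [N covN <-]]; rewrite lte_fin => /ltW Nr.
by exists N.
Qed.

(** At scale r the boundary is covered by r^(-k-d) sets of diameter r, and the r-neighbourhood of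
    each fits in a cube of side 4 r. *)
Lemma mes_shell_le S (k d : R) : compact S ->
  k = fine (upper_fractal_dim (boundary S)) -> 0 < d ->
  exists2 r0 : R, 0 < r0 & forall r, 0 < r -> r < r0 ->
    (mes (neighborhood S r `\` S) <= (4 ^+ n * r `^ (n%:R - k - d))%:E)%E.
Proof.
move=> cS kE d0.
have bS : bounded_set (boundary S).
  have [M [Mr hM]] := compact_bounded cS; exists M; split=> // x Mx y [+ _].
  have cl : closed S by apply: compact_closed => //; exact: norm_hausdorff.
  by rewrite -(closure_id S).1// => Sy; exact: hM.
have [r0 r00 hr] := covering_powR bS kE d0; exists r0 => // r rgt0 rr0.
have [N covN Nle] := hr r rgt0 rr0.
apply: (@le_trans _ _ (mes (neighborhood (boundary S) r))).
  exact/le_lebesgue_outer/neighborhood_boundary.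
apply: le_trans (coverable_mes_neighborhood (ltW rgt0) rgt0 covN) _.
rewrite lee_fin (_ : 2 * (r + r) = 4 * r); last by ring.
rewrite exprMn mulrCA ler_pM2l ?exprn_gt0//.
rewrite (_ : n%:R - k - d = n%:R + - (k + d)); last by ring.
rewrite powRD; last by rewrite (gt_eqF rgt0) implybT.
by rewrite powR_mulrn ?(ltW rgt0)// [leRHS]mulrC ler_wpM2r// exprn_ge0// ltW.
Qed.

End fractal_dimension.

(** * The functions g and G *)

Section convexity.
Context {R : realType}.
Implicit Types (g : R -> R).

(* What the argument uses of a strictly convex [g] with [g 0 = 0]; the third
   clause is the supporting line of slope [s] at [y], the last one says that
   [g] vanishes at least linearly at [0]. *)
Record convex_gauge g : Prop := ConvexGauge {
  gauge0 : g 0 = 0;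
  gauge_gt0 : forall z, 0 < z -> 0 < g z;
  gauge_support : forall y, 0 < y -> exists2 s, 0 < s &
    forall z, 0 <= z -> g y + s * (z - y) <= g z;
  gauge_linear : exists K e, [/\ 0 < K, 0 < e & forall z, 0 < z -> z < e -> g z <= K * z]
}.

Lemma hfilter_proper (x : R) : 0 <= x -> ProperFilter (hfilter x).
Proof.
move=> x0; apply: Build_ProperFilter_ex => P [e /= e0 eP].
exists (x + e / 2); apply: eP; rewrite /= ?in_itv/=.
- by rewrite opprD addNKr normrN gtr0_norm ?divr_gt0//; lra.
- by rewrite gt_eqF// ltrDl divr_gt0.
- by rewrite andbT addr_ge0// divr_ge0// ltW.
Qed.

(** Within distance x of a point x > 0 the restriction to the half line excludes nothing, so the
    one-sided notion is the usual derivative there. *)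
Lemma hquot_is_derive g (x : R) : 0 < x -> hderivable g x ->
  is_derive x 1 g (hderiv g x).
Proof.
move=> x0 /cvg_ex[/= l gl].
have -> : hderiv g x = l.
  have := hfilter_proper (ltW x0) => PF.
  by apply: cvg_lim; [exact: norm_hausdorff|exact: gl].
apply/is_derive1_caratheodory.
exists (fun z => if z == x then l else hquot g x z); split; rewrite ?eqxx//.
  move=> z; case: eqP => [->|/eqP zx]; first by rewrite !subrr mulr0.
  by rewrite /hquot mulfVK// subr_eq0.
apply/continuous_withinNx; rewrite eqxx.
have : hquot g x y @[y --> x^'] --> l.
  move=> A /gl [e /= e0 he]; exists (Num.min e x); first by rewrite /= lt_min e0.
  move=> z /=; rewrite lt_min => /andP[ze zx] zNx; apply: he => //=.
  by move: zx; rewrite ltr_distlC in_itv/= andbT => /andP[+ _]; lra.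
apply: cvg_trans; apply: near_eq_cvg; near=> z.
rewrite ifF//; apply/negbTE; near: z; exact: nbhs_dnbhs_neq.
Unshelve. all: end_near. Qed.

(** The mean value theorem is used twice: g'' > 0 makes g' increasing, and this puts the graph above
    its tangents. Both uses stay inside (0, +oo); the end point 0 is reached by a limit argument. *)
Lemma C2_convex_gauge g : C2_half_line g -> g 0 = 0 ->
  (forall z : R, 0 < z -> [/\ 0 < g z, 0 < hderiv g z & 0 < hderiv (hderiv g) z]) ->
  convex_gauge g.
Proof.
move=> [dg ddg _] g0 gpos.
have Dg (x : R) : 0 < x -> is_derive x 1 g (hderiv g x).
  by move=> x0; apply: hquot_is_derive => //; exact/dg/ltW.
have DDg (x : R) : 0 < x -> is_derive x 1 (hderiv g) (hderiv (hderiv g) x).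
  by move=> x0; apply: hquot_is_derive => //; exact/ddg/ltW.
have cont (h dh : R -> R) (x y : R) : 0 < x ->
    (forall z : R, 0 < z -> is_derive z 1 h (dh z)) -> {within `[x, y], continuous h}.
  move=> x0 hdh; apply: derivable_within_continuous => z.
  rewrite in_itv/= => /andP[xz _]; apply: ex_derive; apply: hdh.
  exact: lt_le_trans xz.
have dg_incr (x y : R) : 0 < x -> x < y -> hderiv g x < hderiv g y.
  move=> x0 xy; have [||c] := @MVT _ (hderiv g) (hderiv (hderiv g)) x y xy.
  - by move=> z; rewrite in_itv/= => /andP[xz _]; apply: DDg; exact: lt_trans xz.
  - exact: (cont _ _ _ _ x0 DDg).
  - rewrite in_itv/= => /andP[xc _] dE.
    rewrite -subr_gt0 dE mulr_gt0 ?subr_gt0//.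
    by have [] := gpos _ (lt_trans x0 xc).
have support (y z : R) : 0 < y -> 0 < z -> g y + hderiv g y * (z - y) <= g z.
  move=> y0 z0; have [yz|zy|->] := ltgtP y z; last by rewrite subrr mulr0 addr0.
  - have [||c] := @MVT _ g (hderiv g) y z yz.
    + by move=> t; rewrite in_itv/= => /andP[yt _]; apply: Dg; exact: lt_trans yt.
    + exact: (cont _ _ _ _ y0 Dg).
    + rewrite in_itv/= => /andP[yc _] gE.
      rewrite -lerBrDl gE ler_pM2r ?subr_gt0// ltW// dg_incr//.
  - have [||c] := @MVT _ g (hderiv g) z y zy.
    + by move=> t; rewrite in_itv/= => /andP[yt _]; apply: Dg; exact: lt_trans yt.
    + exact: (cont _ _ _ _ z0 Dg).
    + rewrite in_itv/= => /andP[zc cy] gE.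
      have : hderiv g c * (y - z) <= hderiv g y * (y - z).
        rewrite ler_pM2r ?subr_gt0// ltW// dg_incr//; exact: lt_trans zc.
      by rewrite -gE; lra.
(* The quotient g(z) / z tends to the one-sided derivative l at 0, so it stays below |l| + 1 near
   0. *)
have [K [e [K0 e0 gK]]] : exists K e, [/\ 0 < K, 0 < e &
    forall z, 0 < z -> z < e -> g z <= K * z].
  have /cvg_ex[/= l gl] := dg 0 (lexx 0).
  have := hfilter_proper (lexx (0 : R)) => PF.
  have l1 : `|l| < `|l| + 1 by rewrite ltrDl.
  have [e /= e0 he] := cvgr_norm_lt _ gl _ l1.
  exists (`|l| + 1), e; split => // z z0 ze.
  have := he z; rewrite /ball_/= sub0r normrN gtr0_norm// => /(_ ze).
  rewrite gt_eqF// in_itv/= ltW// => /(_ isT isT).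
  rewrite /hquot g0 !subr0 => /ltW/(le_trans (ler_norm _)).
  by rewrite ler_pdivrMr.
split => //.
- by move=> z /gpos[].
- move=> y y0; exists (hderiv g y); first by have [] := gpos _ y0.
  move=> z; rewrite le_eqVlt => /orP[/eqP <-|]; last exact: support.
  rewrite g0 sub0r mulrN leNgt subr_gt0; apply/negP => gy.
  have gy0 : 0 < g y - hderiv g y * y by rewrite subr_gt0.
  (* If the tangent at y were positive at 0, it would at t still be at least the whole gap, whereas
     g(t) <= K t is at most half of it. *)
  pose t := Num.min (e / 2) ((g y - hderiv g y * y) / (2 * K)).
  have t0 : 0 < t by rewrite lt_min !divr_gt0// mulr_gt0.
  have te : t < e by rewrite (@le_lt_trans _ _ (e / 2)) ?ge_min ?lexx//; lra.
  have := support y t y0 t0; have := gK t t0 te.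
  have : K * t <= (g y - hderiv g y * y) / 2.
    rewrite -ler_pdivlMl// (le_trans (_ : t <= (g y - hderiv g y * y) / (2 * K)))//.
      by rewrite ge_min lexx orbT.
    by rewrite le_eqVlt; apply/orP; left; apply/eqP; field; rewrite gt_eqF.
  have : 0 < hderiv g y * t by rewrite mulr_gt0//; have [] := gpos _ y0.
  by lra.
- by exists K, e.
Qed.

Lemma gauge_ge0 g z : convex_gauge g -> 0 <= z -> 0 <= g z.
Proof.
by case=> g0 gp _ _; rewrite le_eqVlt => /orP[/eqP <-|/gp/ltW//]; rewrite g0.
Qed.

Lemma gauge_lt g x y : convex_gauge g -> 0 <= x -> x < y -> g x < g y.
Proof.
move=> [g0 gp gs _]; rewrite le_eqVlt => /orP[/eqP <-|x0] xy; first by rewrite g0 gp.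
have [s s0 hs] := gs _ x0.
rewrite (lt_le_trans _ (hs y (ltW (lt_trans x0 xy))))//.
by rewrite ltrDl mulr_gt0// subr_gt0.
Qed.

Lemma gauge_le g x y : convex_gauge g -> 0 <= x -> x <= y -> g x <= g y.
Proof.
move=> gg x0; rewrite le_eqVlt => /orP[/eqP ->//|xy]; exact/ltW/gauge_lt.
Qed.

Lemma gauge_unbounded g (M : R) : convex_gauge g -> exists2 z, 0 < z & M < g z.
Proof.
move=> [g0 gp gs _]; have [s s0 hs] := gs 1 ltr01.
exists (1 + `|M| / s); first by rewrite ltr_wpDr ?divr_ge0// ltW.
rewrite (lt_le_trans _ (hs _ _))//; last by rewrite addr_ge0 ?divr_ge0// ltW.
rewrite addrAC subrr add0r mulrC divfK ?gt_eqF//.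
by rewrite (le_lt_trans (ler_norm _))// ltrDr gp.
Qed.

Lemma measurable_gauge g (D : set R) : convex_gauge g -> measurable D ->
  D `<=` [set z | 0 <= z] -> measurable_fun D g.
Proof.
move=> gg mD D0; apply: (@eq_measurable_fun _ _ _ _ _ (fun z : R => g (Num.max 0 z))).
  by move=> z; rewrite inE => /D0 z0; rewrite max_r.
apply: nondecreasing_measurable => // x y xy; apply: gauge_le => //.
  by rewrite le_max lexx.
by rewrite ge_max !le_max lexx xy orbT.
Qed.

End convexity.

Section small_tail.
Context {d : measure_display} {T : measurableType d} {R : realType}.
Variable mu : {measure set T -> \bar R}.
Implicit Types (F : (set T)^nat) (h : T -> \bar R).
Local Open Scope ereal_scope.

(** Monotone convergence along [F]. It serves twice: for the tail of G at infinity, and for shells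
    shrinking to the singular set. *)
Lemma integral_small_tail F h (e : R) : nondecreasing_seq F ->
  (forall i, measurable (F i)) -> measurable_fun (\bigcup_i F i) h ->
  (forall x, (\bigcup_i F i) x -> 0 <= h x) -> \int[mu]_(x in \bigcup_i F i) h x < +oo ->
  (0 < e)%R -> exists N, \int[mu]_(x in (\bigcup_i F i) `\` F N) h x < e%:E.
Proof.
move=> ndF mF mh h0 hoo e0; set D := \bigcup_i F i.
have mD : measurable D by exact: bigcup_measurable.
have FD i : F i `<=` D by exact: bigcup_sup.
have split i : \int[mu]_(x in D) h x =
    \int[mu]_(x in F i) h x + \int[mu]_(x in D `\` F i) h x.
  rewrite -ge0_integral_setU ?setDUK//; first exact: measurableD.
  by apply/disj_setPS => x [? []].
have D0 : 0 <= \int[mu]_(x in D) h x by apply: integral_ge0 => x; exact: h0.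
have fD : \int[mu]_(x in D) h x \is a fin_num by rewrite ge0_fin_numE.
have cvgF : \int[mu]_(x in F i) h x @[i --> \oo] --> \int[mu]_(x in D) h x.
  apply: ge0_nondecreasing_set_cvg_integral => //.
  - by move=> i; exact: measurable_funS (FD i) mh.
  - by move=> i x Fix; apply: h0; exact: FD Fix.
have [N hN] : exists N, \int[mu]_(x in D) h x - e%:E < \int[mu]_(x in F N) h x.
  apply: contrapT => /forallNP hN.
  have : \int[mu]_(x in D) h x <= \int[mu]_(x in D) h x - e%:E.
    rewrite -[leLHS](cvg_lim _ cvgF)//; apply: lime_le; first by apply/cvg_ex; eexists; exact: cvgF.
    by near=> i; rewrite leNgt; apply/negP; exact: hN.
  by rewrite leNgt lteBlDr// lteDl// lte_fin e0.
exists N; have := hN.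
have F0 : 0 <= \int[mu]_(x in F N) h x.
  by apply: integral_ge0 => x Fx; apply: h0; exact: FD Fx.
have fF : \int[mu]_(x in F N) h x \is a fin_num.
  rewrite ge0_fin_numE//; apply: le_lt_trans hoo; rewrite (split N).
  by rewrite leeDl// integral_ge0// => x [Dx _]; exact: h0.
by rewrite lteBlDr// (split N) lteD2lE.
Unshelve. all: end_near. Qed.

End small_tail.

(** * The function G as a decreasing bijection of the positive half line *)

Section tail_function.
Context {R : realType}.
Variables (m : nat) (g : R -> R).
Hypotheses (m0 : (0 < m)%N) (gg : convex_gauge g).
Hypothesis G1 : (tail_integral m g 1 < +oo)%E.

Definition ko_density (z : R) : R := g z `^ (- m%:R^-1) * z `^ (m%:R^-1 - 1).

Let im0 : 0 < m%:R^-1 :> R. Proof. by rewrite invr_gt0 ltr0n. Qed.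

Lemma ko_density_ge0 z : 0 <= ko_density z.
Proof. by rewrite mulr_ge0// powR_ge0. Qed.

Lemma ko_density_nonincreasing x y : 0 < x -> x <= y -> ko_density y <= ko_density x.
Proof.
move=> x0 xy; have y0 := lt_le_trans x0 xy.
have powN (p a b : R) : 0 <= p -> 0 < a -> a <= b -> b `^ (- p) <= a `^ (- p).
  move=> p0 a0 ab; rewrite !powRN lef_pV2 ?posrE ?powR_gt0 ?(lt_le_trans a0 ab)//.
  by rewrite ge0_ler_powR ?nnegrE ?(ltW a0)// (le_trans (ltW a0)).
apply: ler_pM; rewrite ?powR_ge0//.
  apply: powN; first exact: ltW.
    exact: gauge_gt0.
  by apply: gauge_le => //; exact: ltW.
rewrite (_ : m%:R^-1 - 1 = - (1 - m%:R^-1)); last by ring.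
by apply: powN => //; rewrite subr_ge0 invf_le1 ?ler1n// ltr0n.
Qed.

Lemma measurable_ko_density (D : set R) : measurable D -> D `<=` [set z | 0 < z] ->
  measurable_fun D ko_density.
Proof.
move=> mD D0; apply: measurable_funM.
  apply: (measurableT_comp (measurable_powR _)).
  by apply: measurable_gauge => // z /D0 /ltW.
by apply: measurable_funTS; exact: measurable_powR.
Qed.

Local Notation mu := (@lebesgue_measure R).

Lemma tail_integral_split (a b : R) : 0 < a -> a <= b ->
  (tail_integral m g a =
   \int[mu]_(z in `[a, b[) (ko_density z)%:E + tail_integral m g b)%E.
Proof.
move=> a0 ab; rewrite /tail_integral -/(ko_density _).
have U : `[a, +oo[%classic = `[a, b[%classic `|` `[b, +oo[%classic.
  by rewrite -itv_bndbnd_setU// bnd_simp.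
rewrite U ge0_integral_setU//.
- rewrite -U; apply/measurable_EFinP; apply: measurable_ko_density => // z /=.
  by rewrite in_itv/= andbT; exact: lt_le_trans.
- by move=> z _; rewrite lee_fin ko_density_ge0.
- apply/disj_setPS => z [] /=; rewrite !in_itv/= andbT => /andP[_ zb] bz.
  by move: zb; rewrite ltNge bz.
Qed.

Lemma integral_ko_density_bounds (a b : R) : 0 < a -> a <= b ->
  ((ko_density b * (b - a))%:E <= \int[mu]_(z in `[a, b[) (ko_density z)%:E
   <= (ko_density a * (b - a))%:E)%E.
Proof.
move=> a0 ab.
have cstE c : (\int[mu]_(z in `[a, b[) (c%:E) = (c * (b - a))%:E)%E.
  rewrite integral_cst//= lebesgue_measure_itv/= lte_fin.
  move: ab; rewrite le_eqVlt => /orP[/eqP ->|->]; last by rewrite -EFinD -EFinM.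
  by rewrite ltxx subrr mulr0 mule0.
have mI : measurable_fun `[a, b[ (EFin \o ko_density).
  apply/measurable_EFinP; apply: measurable_ko_density => // z /=.
  by rewrite in_itv/= => /andP[az _]; exact: lt_le_trans az.
rewrite -!cstE; apply/andP; split; apply: ge0_le_integral => // z /=;
  rewrite in_itv/= lee_fin ?ko_density_ge0// => /andP[az zb].
  by apply: ko_density_nonincreasing; [exact: lt_le_trans az|exact: ltW].
exact: ko_density_nonincreasing.
Qed.

Lemma tail_integral_ge0 t : (0 <= tail_integral m g t)%E.
Proof. by apply: integral_ge0 => z _; rewrite lee_fin mulr_ge0// powR_ge0. Qed.

Lemma tail_integral_lty t : 0 < t -> (tail_integral m g t < +oo)%E.
Proof.
move=> t0; have [t1|/ltW t1] := leP t 1.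
  rewrite (tail_integral_split t0 t1) lte_add_pinfty//.
  have /andP[_ h] := integral_ko_density_bounds t0 t1.
  exact: le_lt_trans h (ltry _).
apply: le_lt_trans G1; rewrite (tail_integral_split ltr01 t1) leeDr//.
by apply: integral_ge0 => z _; rewrite lee_fin ko_density_ge0.
Qed.

Definition tail_fun (t : R) : R := fine (tail_integral m g t).

Lemma tail_funE t : 0 < t -> tail_integral m g t = (tail_fun t)%:E.
Proof.
move=> t0; rewrite /tail_fun fineK// ge0_fin_numE ?tail_integral_lty//.
exact: tail_integral_ge0.
Qed.

Lemma tail_fun_bounds (a b : R) : 0 < a -> a <= b ->
  ko_density b * (b - a) <= tail_fun a - tail_fun b <= ko_density a * (b - a).
Proof.
move=> a0 ab; have := tail_integral_split a0 ab.
have /andP[] := integral_ko_density_bounds a0 ab.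
rewrite !tail_funE ?(lt_le_trans a0 ab)//.
case: (integral _ _ _) => [s| |] //; rewrite !lee_fin -EFinD => h1 h2 [E].
by rewrite E addrK h1.
Qed.

Lemma tail_fun_ge0 t : 0 <= tail_fun t.
Proof. exact/fine_ge0/tail_integral_ge0. Qed.

Lemma tail_fun_nonincreasing (a b : R) : 0 < a -> a <= b -> tail_fun b <= tail_fun a.
Proof.
move=> a0 ab; have /andP[h _] := tail_fun_bounds a0 ab.
by rewrite -subr_ge0 (le_trans _ h)// mulr_ge0 ?ko_density_ge0// subr_ge0.
Qed.

Lemma continuous_tail_fun (a b : R) : 0 < a -> {within `[a, b], continuous tail_fun}.
Proof.
move=> a0; apply: continuous_in_subspaceT => x; rewrite inE/= in_itv/= => /andP[ax _].
have x0 := lt_le_trans a0 ax.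
apply/cvgrPdist_le => e e0.
have K0 : 0 < ko_density (x / 2) + 1 by rewrite ltr_wpDl ?ko_density_ge0.
have x20 : 0 < x / 2 by rewrite divr_gt0.
near=> y.
have yx : x / 2 <= y by near: y; apply: lt_le_nbhsr; lra.
have xy : `|x - y| <= e / (ko_density (x / 2) + 1).
  near: y; apply: cvgr_dist_le; first exact: cvg_id.
  by rewrite divr_gt0.
apply: (@le_trans _ _ (ko_density (x / 2) * `|x - y|)).
  have [le_xy|/ltW le_yx] := leP x y.
    have /andP[h1 h2] := tail_fun_bounds x0 le_xy.
    have h3 : 0 <= tail_fun x - tail_fun y.
      by rewrite subr_ge0 tail_fun_nonincreasing.
    rewrite ger0_norm// distrC ger0_norm ?subr_ge0// (le_trans h2)//.
    rewrite ler_wpM2r ?subr_ge0// ko_density_nonincreasing//; lra.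
  have y0 : 0 < y by lra.
  have /andP[h1 h2] := tail_fun_bounds y0 le_yx.
  have h3 : 0 <= tail_fun y - tail_fun x.
    by rewrite subr_ge0 tail_fun_nonincreasing.
  rewrite distrC ger0_norm// ger0_norm ?subr_ge0// (le_trans h2)//.
  by rewrite ler_wpM2r ?subr_ge0// ko_density_nonincreasing.
rewrite (le_trans (ler_wpM2l (ko_density_ge0 _) xy))//.
by rewrite mulrCA ger_pMr// ler_pdivrMr// mul1r lerDl.
Unshelve. all: end_near. Qed.

(** On [y/2, y] the decreasing density is at least its value at y, and y times this value is (y /
    g(y))^(1/m). This converts differences of G into the step lengths of the Keller-Osserman
    iteration. *)
Lemma dyadic_le_tail_fun y : 0 < y ->
  (y / g y) `^ m%:R^-1 <= 2 * (tail_fun (y / 2) - tail_fun y).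
Proof.
move=> y0; have y20 : 0 < y / 2 by rewrite divr_gt0.
have y2y : y / 2 <= y by lra.
have /andP[h _] := tail_fun_bounds y20 y2y.
rewrite -ler_pdivrMl// (le_trans _ h)// (_ : y - y / 2 = 2^-1 * y); last by field.
rewrite mulrCA ler_pM2l ?invr_gt0// /ko_density -mulrA.
have gy := gauge_gt0 gg y0.
rewrite -[X in _ * (_ * X)](powRr1 (ltW y0)) -powRD; last by rewrite (gt_eqF y0) implybT.
rewrite subrK powRM ?invr_ge0 ?(ltW y0) ?(ltW gy)//.
by rewrite powRN mulrC -[(g y)^-1](powR_inv1 (ltW gy)) -powRrM mulN1r powRN.
Qed.

(** As g(z) <= K z near 0, every dyadic interval [t/2, t] close to 0 contributes at least the fixed
    amount [c]. *)
Lemma tail_fun_large (s : R) : exists2 t, 0 < t & s <= tail_fun t.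
Proof.
have [K [e [K0 e0 gK]]] := gauge_linear gg.
pose t (N : nat) := (e / 2) / 2 ^+ N.
have t0 N : 0 < t N by rewrite !divr_gt0 ?exprn_gt0.
pose c := K^-1 `^ m%:R^-1 / 2.
have c0 : 0 < c by rewrite divr_gt0// powR_gt0// invr_gt0.
have tN N : c * N%:R <= tail_fun (t N).
  elim: N => [|N IH]; first by rewrite mulr0 tail_fun_ge0.
  have tE : t N.+1 = t N / 2 by rewrite /t exprS; field; rewrite expf_neq0.
  have := dyadic_le_tail_fun (t0 N); rewrite -tE.
  have : K^-1 `^ m%:R^-1 <= (t N / g (t N)) `^ m%:R^-1.
    rewrite ge0_ler_powR ?nnegrE ?invr_ge0 ?(ltW K0) ?(ltW im0)//.
      by rewrite divr_ge0 ?(ltW (t0 N))// gauge_ge0// ltW.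
    rewrite ler_pdivlMr ?(gauge_gt0 gg)// mulrC ler_pdivrMr// mulrC gK//.
    rewrite /t ltr_pdivrMr ?exprn_gt0// (@lt_le_trans _ _ e)//; first by lra.
    by rewrite ler_peMr ?(ltW e0)// exprn_ege1// ler1n.
  have -> : K^-1 `^ m%:R^-1 = 2 * c by rewrite /c; field.
  by rewrite -(natr1 N) [c * _]mulrDr mulr1; lra.
exists (t (Num.bound (`|s| / c))) => //; apply: le_trans (tN _).
rewrite mulrC -ler_pdivrMr// (le_trans (_ : s / c <= `|s| / c))//.
  by rewrite ler_pM2r ?invr_gt0// ler_norm.
by apply/ltW/archi_boundP; rewrite divr_ge0// ltW.
Qed.

Lemma tail_fun_small (s : R) : 0 < s -> exists2 t, 0 < t & tail_fun t <= s.
Proof.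
move=> s0; pose F (N : nat) := `[1, 1 + N%:R[%classic : set R.
have FE : \bigcup_N F N = `[1, +oo[%classic.
  apply/seteqP; split=> [z [N _]|z]; rewrite /F /= !in_itv/= andbT; first by case/andP.
  move=> z1; exists (Num.bound z) => //=; rewrite in_itv/= z1/=.
  rewrite (lt_le_trans (archi_boundP _))//; first by rewrite (le_trans ler01).
  by rewrite lerDr.
have := @integral_small_tail _ _ R mu F (EFin \o ko_density) s.
rewrite FE => /(_ _ _ _ _ G1 s0)[].
- apply/nondecreasing_seqP => N; rewrite subsetEset => z; rewrite /F /= !in_itv/=.
  by move=> /andP[-> zN]; rewrite (lt_le_trans zN)// lerD2l ler_nat.
- by move=> i; exact: measurable_itv.
- apply/measurable_EFinP; apply: measurable_ko_density => // z /=.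
  by rewrite in_itv/= andbT; exact: lt_le_trans.
- by move=> z _; rewrite lee_fin ko_density_ge0.
move=> N; rewrite (_ : _ `\` _ = `[1 + N%:R, +oo[%classic).
  have N0 : 0 < 1 + N%:R :> R by rewrite ltr_wpDr.
  move=> h; exists (1 + N%:R) => //.
  by rewrite -lee_fin -tail_funE//; exact: ltW.
apply/seteqP; split=> z; rewrite /F /= !in_itv/= !andbT.
  by move=> [z1 /negP]; rewrite z1/= -leNgt.
move=> Nz; have z1 : 1 <= z by rewrite (le_trans _ Nz)// lerDl.
by split => //; apply/negP; rewrite z1/= -leNgt.
Qed.

Lemma tail_fun_surj (s : R) : 0 < s -> exists2 t, 0 < t & tail_fun t = s.
Proof.
move=> s0; have [a a0 sa] := tail_fun_large s; have [b b0 bs] := tail_fun_small s0.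
have [ab|/ltW ba] := leP a b; last first.
  exists a => //; apply/eqP; rewrite eq_le sa andbT (le_trans _ bs)//.
  exact: tail_fun_nonincreasing.
have [|c] := IVT ab (continuous_tail_fun (b := b) a0) (v := s).
  by rewrite ge_min le_max bs sa orbT.
by rewrite in_itv/= => /andP[ac _] cs; exists c => //; exact: lt_le_trans ac.
Qed.

End tail_function.

(** * The blow-up argument *)

Section blow_up.
Context {R : realType}.
Variables (m : nat) (g : R -> R).
Hypotheses (m0 : (0 < m)%N) (gg : convex_gauge g).
Hypothesis G1 : (tail_integral m g 1 < +oo)%E.

Lemma powR_invn_expn (x : R) : 0 <= x -> (x `^ m%:R^-1) ^+ m = x.
Proof.
move=> x0; rewrite -powR_mulrn ?powR_ge0// -powRrM mulVf ?powRr1//.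
by rewrite pnatr_eq0 -lt0n.
Qed.

(* Keller--Osserman: along the levels [g z_i], [z_i = 2 ^ (i + 1) T], the steps
   needed to pass from one level to the next have a sum bounded by [tail_fun T],
   so that [J] would be infinite at [r / 4]. *)
Lemma keller_osserman (J : R -> R) (kappa r T : R) :
  0 < T -> 0 < kappa -> 0 < r ->
  (forall r1 r2, 0 < r1 -> r1 <= r2 -> r2 <= r -> J r2 <= J r1) ->
  (forall r1 r2, 0 < r1 -> r1 < r2 -> r2 <= r ->
     J r2 + g (kappa * (r2 - r1) ^+ m * J r2) <= J r1) ->
  2 * (2 / kappa) `^ m%:R^-1 * tail_fun m g T <= r / 4 ->
  J (r / 2) < g (2 * T).
Proof.
move=> T0 k0 r0 Jmono Jstep GT; rewrite ltNge; apply/negP => gJ.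
pose z (i : nat) := 2 ^+ i.+1 * T.
have z0 i : 0 < z i by rewrite mulr_gt0// exprn_gt0.
have gz0 i : 0 < g (z i) by exact: gauge_gt0.
(* [h i] solves kappa (h i)^m g(z_i) = 2 z_i = z_(i+1): a step of this length raises J from g(z_i)
   to at least g(z_(i+1)). *)
pose h (i : nat) := (2 / kappa * (z i / g (z i))) `^ m%:R^-1.
have hb i : 0 < 2 / kappa * (z i / g (z i)) by rewrite mulr_gt0// divr_gt0.
have h0 i : 0 < h i by rewrite powR_gt0.
pose c := (2 / kappa) `^ m%:R^-1.
have hsum N : \sum_(i < N) h i <= 2 * c * (tail_fun m g T - tail_fun m g (2 ^+ N * T)).
  elim: N => [|N IH]; first by rewrite big_ord0 expr0 mul1r subrr mulr0.
  rewrite big_ord_recr/=.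
  have zE : z N / 2 = 2 ^+ N * T by rewrite /z exprS; field.
  have := dyadic_le_tail_fun m0 gg G1 (z0 N); rewrite zE.
  have c_ge0 : 0 <= c by rewrite powR_ge0.
  move=> /(ler_wpM2l c_ge0) hN.
  have -> : h N = c * (z N / g (z N)) `^ m%:R^-1.
    by rewrite /h [LHS]powRM//; apply: divr_ge0 => //; exact: ltW.
  rewrite -/(z N); move: IH hN; set a := tail_fun m g T.
  by rewrite -/(z N); nra.
(* Starting from r / 2, the radii therefore never go below r / 4. *)
have hr N : \sum_(i < N) h i <= r / 4.
  rewrite (le_trans (hsum N))// (le_trans _ GT)// ler_wpM2l ?mulr_ge0 ?powR_ge0//.
  by rewrite gerBl tail_fun_ge0.
have level N : g (z N) <= J (r / 2 - \sum_(i < N) h i).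
  elim: N => [|N IH]; first by rewrite big_ord0 subr0 /z expr1.
  have hN := hr N.+1; rewrite big_ord_recr/= in hN *.
  set rho := r / 2 - \sum_(i < N) h i in IH.
  have -> : r / 2 - (\sum_(i < N) h i + h N) = rho - h N by rewrite /rho; ring.
  have s0 : 0 <= \sum_(i < N) h i by apply: sumr_ge0 => i _; exact: ltW.
  have hN0 := h0 N.
  have Js : J rho + g (kappa * (rho - (rho - h N)) ^+ m * J rho) <= J (rho - h N).
    by apply: Jstep; rewrite /rho; lra.
  apply: le_trans Js; rewrite (_ : rho - (rho - h N) = h N); last by ring.
  have J0 : 0 < J rho by exact: lt_le_trans IH.
  rewrite /h powR_invn_expn; last exact: ltW.
  rewrite ler_wpDl//; first exact: ltW.
  apply: gauge_le => //; first exact: ltW.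
  have -> : z N.+1 = kappa * (2 / kappa * (z N / g (z N))) * g (z N).
    rewrite (_ : z N.+1 = 2 * z N); last by rewrite /z exprS; ring.
    by field; rewrite (gt_eqF (gz0 N)) (gt_eqF k0).
  by rewrite ler_pM2l// mulr_gt0.
have [y y0 Jy] := gauge_unbounded (J (r / 4)) gg.
pose N := Num.bound (y / T).
have yz : y <= z N.
  rewrite /z -ler_pdivrMr//.
  apply/ltW/(lt_le_trans (archi_boundP _)); first by rewrite divr_ge0// ltW.
  rewrite -natrX ler_nat (leq_trans _ (ltnW (ltn_expl _ _)))//.
have : g (z N) <= J (r / 4).
  apply: le_trans (level N) _.
  have s0 : 0 <= \sum_(i < N) h i by apply: sumr_ge0 => i _; exact: ltW.
  by have hrN := hr N; apply: Jmono; lra.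
have := gauge_le gg (ltW y0) yz; lra.
Qed.

End blow_up.

(** * Consequences of the limit hypothesis on the weight f *)

Section weight.
Context {R : realType} {n : nat}.
Variables (m : nat) (g : R -> R) (S : set 'rV[R]_n) (f : 'rV[R]_n -> R).
Variables (p rho : R).
Hypotheses (m0 : (0 < m)%N) (gg : convex_gauge g).
Hypothesis G1 : (tail_integral m g 1 < +oo)%E.
Hypotheses (rho0 : 0 < rho) (f0 : forall x, neighborhood S rho x -> 0 <= f x).

(** The partial inverse [pinv] is a genuine inverse only on the image of G; that every s > 0 belongs
    to it is [tail_fun_surj]. *)
Lemma tail_integral_inv_fin (s : R) : 0 < s ->
  exists2 T, 0 < T & tail_integral_inv m g s%:E = T%:E /\ tail_fun m g T = s.
Proof.
move=> s0; rewrite /tail_integral_inv eqe gt_eqF//.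
have [t t0 ts] := tail_fun_surj m0 gg G1 s0.
have sim : (tail_integral m g @` `]0, +oo[%classic) s%:E.
  by exists t; rewrite /= ?in_itv/= ?t0// tail_funE ?ts.
set T := 'pinv_ _ _ _ _.
have T0 : 0 < T.
  have /(_ T) := @surjpinv_image_sub _ _ (fun=> 0 : R) `]0, +oo[%classic
    (tail_integral m g @` `]0, +oo[%classic) (tail_integral m g) (fun _ h => h).
  by rewrite /= in_itv/= andbT; apply; exists s%:E.
exists T => //; split => //.
have : tail_integral m g T = s%:E by apply: pinvK; rewrite inE.
by rewrite tail_funE// => -[].
Qed.

(* [T] plays the role of G^-1(C r q), and [q] that of ess inf f^(1/m); the
   inequalities also cover an infinite essential infimum. *)
Lemma weight_lower_bound (C e : R) : 0 < C -> 0 < e ->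
  ((r `^ p)%:E * tail_integral_inv m g (C%:E * r%:E *
     ess_inf_on (neighborhood S r `\` S) (fun x => (f x `^ m%:R^-1)%R)))%E
     @[r --> 0^'+] --> 0%E ->
  exists2 r0, 0 < r0 & forall r, 0 < r -> r < r0 ->
    exists q T, [/\ 0 < q, 0 < T, tail_fun m g T <= C * r * q, r `^ p * T <= e &
      {ae @mes R n, forall x, (neighborhood S r `\` S) x -> q ^+ m <= f x}].
Proof.
move=> C0 e0 /fine_cvgP[finu cvgu].
have [d1 /= d10 hd1] := finu.
have [d2 /= d20 hd2] := (cvgrPdist_lt _ _).1 cvgu e e0.
exists (Num.min rho (Num.min d1 d2)); first by rewrite !lt_min rho0 d10 d20.
move=> r r0; rewrite !lt_min => /and3P[rrho rd1 rd2].
have := hd1 r; have := hd2 r; rewrite /= !sub0r !normrN (gtr0_norm r0).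
move=> /(_ rd2 r0) small /(_ rd1 r0) fin; move: small fin.
set E := ess_inf_on _ _ => small fin.
have rp0 : 0 < r `^ p by rewrite powR_gt0.
have E0 : (0 <= E)%E.
  apply/ess_infP; apply: aeW => x; rewrite /patch; case: ifPn => _ /=.
    by rewrite lee_fin powR_ge0.
  by rewrite leey.
have aeE : {ae @mes R n, forall x, (neighborhood S r `\` S) x ->
    (E <= (f x `^ m%:R^-1)%:E)%E}.
  have := @ess_inf_le _ _ R (@mes R n) (patch (cst +oo%E) (neighborhood S r `\` S)
    (EFin \o (fun x => f x `^ m%:R^-1))).
  by apply: ae_mesS => x; rewrite /patch -/(ess_inf_on _ _) => hx Sx; move: hx; rewrite mem_set.
have aeq q : 0 <= q -> (q%:E <= E)%E ->
    {ae @mes R n, forall x, (neighborhood S r `\` S) x -> q ^+ m <= f x}.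
  move=> q0 qE; apply: ae_mesS aeE => x + Sx => /(_ Sx)/(le_trans qE).
  rewrite lee_fin => qf.
  have fx0 : 0 <= f x by apply: f0; apply: neighborhoodS (ltW rrho) _ _; case: Sx.
  by rewrite -(powR_invn_expn m0 fx0) lerXn2r ?nnegrE// powR_ge0.
case: E => [q| |] in E0 fin small aeE aeq *.
(* For q = 0 the convention G^-1(0) = +oo would make the product infinite, while it is finite for
   small r. *)
- have q0 : 0 < q.
    move: E0; rewrite lee_fin lt_def => ->; rewrite andbT; apply/eqP => q0; move: fin.
    by rewrite q0 mule0 /tail_integral_inv eqxx gt0_muley ?lte_fin.
  have [T T0 [TE TG]] := tail_integral_inv_fin (mulr_gt0 (mulr_gt0 C0 r0) q0).
  exists q, T; split => //; first by rewrite TG.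
    by move: small; rewrite -!EFinM TE -EFinM/= => /ltW/(le_trans (ler_norm _)).
  exact: aeq (ltW q0) (lexx _).
(* For an infinite essential infimum every q is a lower bound. As the inverse has only a default
   value at +oo, T is taken as large as r^p T <= e allows, and then q large enough for this T. *)
- pose T := e / r `^ p; have T0 : 0 < T by rewrite divr_gt0.
  pose q := tail_fun m g T / (C * r) + 1.
  have q0 : 0 < q by rewrite ltr_wpDl// divr_ge0 ?tail_fun_ge0// ltW// mulr_gt0.
  exists q, T; split => //.
  + by rewrite /q mulrDr mulrC divfK ?gt_eqF ?mulr_gt0// lerDl mulr1 ltW// mulr_gt0.
  + by rewrite /T mulrC divfK// gt_eqF.
  + by apply: aeq (ltW q0) _; rewrite leey.
- by [].
Qed.

End weight.

(** * Measurability and integrals *)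

Section composition.
Context {R : realType} {n : nat}.
Implicit Types (D : set (Rn R n)).

Lemma null_measurable_fun D (h : Rn R n -> R) : (@mes R n).-negligible D -> measurable_fun D h.
Proof.
move=> D0 mD Y mY; apply: (@measure_is_complete_caratheodory R _ (@lebesgue_outer R n)).
by apply: negligibleS D0; exact: subIsetl.
Qed.

(** u is rounded down to multiples of 1 / (k + 1). For each k the composition is measurable on
    countably many pieces where the second argument is constant, and continuity in that argument
    gives convergence off the null set [N], on which completeness of the measure suffices. *)
Lemma caratheodory_comp_measurable D (b : 'rV[R]_n -> R -> R) (u : 'rV[R]_n -> R) :
  measurable D -> caratheodory_function D b -> measurable_fun D (u : Rn R n -> R) ->
  measurable_fun D ((fun x => b x (u x)) : Rn R n -> R).
Proof.
move=> mD [mb [N [mN N0 cN]]] mu.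
have -> : D = (D `\` N) `|` (D `&` N) by rewrite setUC setUIDK.
have mDN : measurable (D `\` N) by exact: measurableD.
apply/(measurable_funU _ mDN (measurableI _ _ mD mN)); split; last first.
  apply: null_measurable_fun; exists N; split => //; exact: subIsetr.
pose step (k : nat) (j : int) : R := j%:~R / k.+1%:R.
pose idx (k : nat) (x : Rn R n) : int := Num.floor (k.+1%:R * u x).
have idxP k x j : (idx k x = j) <-> step k j <= u x < step k (j + 1).
  rewrite /step /idx; have k0 : 0 < k.+1%:R :> R by rewrite ltr0n.
  rewrite ler_pdivrMr// ltr_pdivlMr// ![u x * _]mulrC; split=> [<-|/floor_def //].
  exact: floor_itv.
pose uk (k : nat) (x : Rn R n) : R := b x (step k (idx k x)).
apply: (@measurable_fun_cvg _ _ _ (D `\` N) uk) => [k|x [Dx Nx]].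
  move=> _ Y mY.
  rewrite (_ : _ `&` _ = \bigcup_(j : int) ((D `&` u @^-1` `[step k j, step k (j + 1)[%classic)
      `&` (D `&` (b ^~ (step k j)) @^-1` Y) `&` (D `\` N))).
    apply: countable_bigcupT_measurable => [|j]; first exact: countableP.
    apply: measurableI => //; apply: measurableI; first exact: mu.
    exact: mb.
  apply/seteqP; split=> [x [DNx bY]|x [j _ [[[Dx uj] [_ bY]] DNx]]].
    exists (idx k x) => //; have [Dx _] := DNx.
    do 2!split => //; split => //=; rewrite in_itv/=; exact/(idxP k x).
  split=> //; rewrite /preimage/= /uk; suff -> : idx k x = j by [].
  by apply/idxP; move: uj; rewrite /= in_itv.
have cbx : continuous (b x).
  by apply: contrapT => ncb; apply: Nx; apply: cN => /= /(_ Dx).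
apply: (@cvg_comp _ _ _ (fun k => step k (idx k x)) (b x) \oo (nbhs (u x))); last exact: cbx.
apply/cvgrPdist_le => e e0; near=> k.
have k0 : 0 < k.+1%:R :> R by rewrite ltr0n.
have /andP[l r] := (idxP k x (idx k x)).1 erefl.
rewrite ger0_norm ?subr_ge0//.
rewrite lerBlDl (le_trans (ltW r))// /step intrD mulrDl mul1r lerD2l.
by apply: ltW; near: k; exact: (near_infty_natSinv_lt (PosNum e0)).
Unshelve. all: end_near. Qed.

Lemma compact_neighborhood_sub (S U : set 'rV[R]_n) : compact S -> open U -> S `<=` U ->
  exists2 r : R, 0 < r & neighborhood S r `<=` U.
Proof.
move=> /compact_near_coveringP cS oU SU.
have [|e /= e0 he] := cS R (0^'+) (fun r y => forall x, eucl_dist x y < r -> U x).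
- move=> y Sy; have /nbhs_ballP[e /= e0 eU] : nbhs y U.
    by apply: open_nbhs_nbhs; split => //; exact: SU.
  have e2 : 0 < e / 2 by rewrite divr_gt0.
  exists (ball y (e / 2), `]0, (e / 2)[%classic).
    split; first exact: nbhsx_ballx.
    by near=> r => /=; rewrite in_itv/=; apply/andP; split.
  move=> [y' r] [/= yy']; rewrite in_itv/= => /andP[r0 re] x xy'.
  apply: eU; rewrite [e]splitr; apply: ball_triangle yy' _.
  by apply: eucl_dist_ball; rewrite eucl_distC; exact: lt_trans re.
exists (e / 2); first by rewrite divr_gt0.
move=> x [y Sy xy]; apply: (he (e / 2) _ _ y Sy x xy); last by rewrite divr_gt0.
by rewrite /= sub0r normrN gtr0_norm ?divr_gt0//; lra.
Unshelve. all: end_near. Qed.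

End composition.

Section integrals.
Context {d : measure_display} {T : measurableType d} {R : realType}.
Variable mu : {measure set T -> \bar R}.
Implicit Types (D E : set T) (f h : T -> R).

Lemma measurable_integrable D f : mu.-integrable D (EFin \o f) -> measurable_fun D f.
Proof. by move=> /measurable_int/measurable_EFinP. Qed.

Lemma integrable_bounded_by D f h : measurable D -> measurable_fun D f ->
  (forall x, D x -> `|f x| <= h x) -> mu.-integrable D (EFin \o h) ->
  mu.-integrable D (EFin \o f).
Proof.
move=> mD mf fh ih; apply: le_integrable ih => //; first exact/measurable_EFinP.
move=> x Dx; rewrite /= lee_fin (le_trans (fh _ Dx))// ger0_norm//.
exact: le_trans (fh _ Dx).
Qed.

(** f agrees almost everywhere with min(f, h), which is below h at every point. *)
Lemma ae_le_Rintegral D f h : measurable D ->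
  mu.-integrable D (EFin \o f) -> mu.-integrable D (EFin \o h) ->
  {ae mu, forall x, D x -> f x <= h x} ->
  \int[mu]_(x in D) f x <= \int[mu]_(x in D) h x.
Proof.
move=> mD intf inth fh.
have mf := measurable_integrable intf; have mh := measurable_integrable inth.
pose k x := Num.min (f x) (h x).
have mk : measurable_fun D k by exact: measurable_minr.
have ik : mu.-integrable D (EFin \o k).
  apply: (@integrable_bounded_by _ _ (fun x => `|f x| + `|h x|)) => //.
    by move=> x Dx; rewrite /k /= minEle; case: ifP => _; rewrite ?lerDl ?lerDr.
  have := integrableD mD (integrable_abse intf) (integrable_abse inth).
  by apply: eq_integrable => // x _; rewrite /= EFinD.
have -> : \int[mu]_(x in D) f x = \int[mu]_(x in D) k x.
  congr fine; apply: ae_eq_integral => //; try exact/measurable_EFinP.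
  apply: filterS fh => x fhx Dx; rewrite /k min_l//; exact: fhx.
by apply: le_Rintegral => // x _; rewrite /k ge_min lexx orbT.
Qed.

Lemma restrict_eq D E f : E `<=` D -> (forall x, D x -> ~ E x -> f x = 0) ->
  f \_ D = f \_ E.
Proof.
move=> ED f0; apply/funext => x; rewrite /patch.
have [xE|xE] := boolP (x \in E).
  by rewrite ifT//; rewrite !inE in xE *; exact: ED.
case: ifPn => //; rewrite inE => Dx; apply: f0 => // Ex.
by move/negP: xE; apply; rewrite inE.
Qed.

Lemma integrable_extend0 D E f : measurable D -> measurable E -> E `<=` D ->
  (forall x, D x -> ~ E x -> f x = 0) ->
  mu.-integrable E (EFin \o f) -> mu.-integrable D (EFin \o f).
Proof.
move=> mD mE ED f0 /integrable_mkcond => /(_ mE) iE.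
apply/integrable_mkcond => //; move: iE.
by rewrite !restrict_EFin (restrict_eq ED f0).
Qed.

Lemma Rintegral_extend0 D E f : E `<=` D -> (forall x, D x -> ~ E x -> f x = 0) ->
  \int[mu]_(x in D) f x = \int[mu]_(x in E) f x.
Proof.
by move=> ED f0; rewrite Rintegral_mkcond [RHS]Rintegral_mkcond (restrict_eq ED f0).
Qed.

Lemma integral_extend0 D E f : E `<=` D -> (forall x, D x -> ~ E x -> f x = 0) ->
  (\int[mu]_(x in D) (f x)%:E = \int[mu]_(x in E) (f x)%:E)%E.
Proof.
by move=> ED f0; rewrite integral_mkcond [RHS]integral_mkcond !restrict_EFin (restrict_eq ED f0).
Qed.

Lemma EFin_Rintegral D f : mu.-integrable D (EFin \o f) -> measurable D ->
  (\int[mu]_(x in D) (f x)%:E)%E = (\int[mu]_(x in D) f x)%:E.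
Proof. by move=> iD mD; rewrite /Rintegral fineK// integrable_fin_num. Qed.

Lemma le_Rintegral_subset D E f : measurable D -> measurable E -> E `<=` D ->
  mu.-integrable D (EFin \o f) -> (forall x, D x -> 0 <= f x) ->
  \int[mu]_(x in E) f x <= \int[mu]_(x in D) f x.
Proof.
move=> mD mE ED iD f0.
have iE : mu.-integrable E (EFin \o f) by exact: integrableS iD.
apply: fine_le; [exact: integrable_fin_num|exact: integrable_fin_num|].
apply: ge0_subset_integral => //; first exact: measurable_int iD.
Qed.

Lemma integrable_union D E f : measurable D -> measurable E ->
  mu.-integrable D (EFin \o f) -> mu.-integrable E (EFin \o f) ->
  mu.-integrable (D `|` E) (EFin \o f).
Proof.
move=> mD mE iD iE.
have mDE : measurable (D `|` E) by exact: measurableU.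
have mfDE : measurable_fun (D `|` E) f.
  by apply/measurable_funU => //; split; exact: measurable_integrable.
apply/integrable_mkcond => //; rewrite restrict_EFin.
apply: (@integrable_bounded_by _ _ (fun x => `|(f \_ D) x| + `|(f \_ E) x|)) => //.
- exact/(measurable_restrictT f).
- move=> x _; rewrite /patch in_setU.
  by case: (x \in D); case: (x \in E); rewrite /= ?normr0 ?addr0 ?add0r ?lerDl.
- have := integrableD measurableT (integrable_abse (proj1 (integrable_mkcond _ mD) iD))
    (integrable_abse (proj1 (integrable_mkcond _ mE) iE)).
  by apply: eq_integrable => // x _; rewrite /= !restrict_EFin.
Qed.

Lemma integrable_ae_bounded_by D f h : measurable D -> measurable_fun D f ->
  (forall x, D x -> 0 <= h x) ->
  {ae mu, forall x, D x -> `|f x| <= h x} -> mu.-integrable D (EFin \o h) ->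
  mu.-integrable D (EFin \o f).
Proof.
move=> mD mf h0 fh ih; apply/integrableP; split; first exact/measurable_EFinP.
have /integrableP[mh hoo] := ih.
apply: le_lt_trans hoo; apply: ae_ge0_le_integral => //.
- by do 2!apply: measurableT_comp => //; exact/measurable_EFinP.
- by apply: measurableT_comp.
- by apply: filterS fh => x fhx Dx; rewrite /= lee_fin (ger0_norm (h0 _ Dx)); exact: fhx.
Qed.

End integrals.

(** * Products of test functions and cut-offs *)

Section test_functions.
Context {R : realType} {n : nat}.
Implicit Types (phi eta : 'rV[R]_n -> R) (x : 'rV[R]_n) (S U : set 'rV[R]_n).
Implicit Types (s : seq 'I_n).

Lemma smooth_scale (c : R) phi : smooth phi -> smooth (fun x => c * phi x).
Proof. move=> sphi; exact: (smoothM (smooth_cst c) sphi). Qed.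

Lemma iter_partial_scale (c : R) phi s : smooth phi ->
  iter_partial (fun x => c * phi x) s = (fun x => c * iter_partial phi s x).
Proof.
move=> sphi; elim: s => [//|i s IH].
rewrite [LHS]/= -/(iter_partial _ _) IH (partialM i (smooth_cst c) (smooth_iter_partial s sphi)).
by apply/funext => x; rewrite partial_cst mul0r add0r.
Qed.

Lemma smooth_hole (k : nat) :
  exists2 K : R, 0 < K & forall S (r1 r2 : R), bounded_set S -> r1 < r2 ->
    exists eta : 'rV[R]_n -> R,
    [/\ smooth eta, forall x, 0 <= eta x <= 1,
        forall x, neighborhood S r1 x -> eta x = 0,
        forall x, ~ neighborhood S ((r1 + r2) / 2) x -> eta x = 1
      & forall s, (size s <= k)%N -> forall x,
          `|iter_partial eta s x| <= K / (r2 - r1) ^+ size s].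
Proof.
have [K K0 hK] := @smooth_cutoff R n k.
(* The extra 1 pays for the constant in eta = 1 - theta, which is felt only at order 0. *)
exists (K + 1); first by rewrite addr_gt0.
move=> S r1 r2 bS r12.
have [th [sth th01 th1 thS thK]] := hK S r1 r2 bS r12.
exists (fun x => 1 + -1 * th x); split.
- by apply: smoothD; [exact: smooth_cst|exact: smooth_scale].
- by move=> x; have /andP[? ?] := th01 x; apply/andP; split; lra.
- by move=> x /th1 ->; lra.
- move=> x nSx; suff -> : th x = 0 by lra.
  by apply/eqP/negPn/negP => /thS.
- move=> s sk x; rewrite iter_partialD; [|exact: smooth_cst|exact: smooth_scale].
  rewrite iter_partial_cst iter_partial_scale//.
  rewrite (le_trans (ler_normD _ _))// addrC mulrDl lerD//.
    by rewrite normrM normrN1 mul1r; exact: thK.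
  have d0 : 0 < r2 - r1 by rewrite subr_gt0.
  case: s {sk} => [|i s]; first by rewrite normr1 expr0 divr1.
  by rewrite normr0 divr_ge0// exprn_ge0// ltW.
Qed.

Lemma bounded_iter_partial k phi : smooth phi -> compact (closure [set x | phi x != 0]) ->
  exists2 B : R, 0 < B & forall s, (size s <= k)%N -> forall x, `|iter_partial phi s x| <= B.
Proof.
set K := closure _ => sphi cK.
have phi0 x : ~ K x -> phi x = 0.
  by move=> nKx; apply/eqP/negPn/negP => px; apply: nKx; exact: subset_closure.
(* [K] is detached from phi: the induction applies to partial derivatives, which vanish off the same
   compact set although their supports may be smaller. *)
move: phi0 sphi; move: K cK => K cK.
have clK : closed K by apply: compact_closed => //; exact: norm_hausdorff.
have bounded0 psi : smooth psi -> (forall x, ~ K x -> psi x = 0) ->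
    exists2 B : R, 0 < B & forall x, `|psi x| <= B.
  move=> spsi psi0.
  have : compact (psi @` K).
    apply: continuous_compact cK; apply: continuous_subspaceT.
    exact: smooth_continuous.
  move=> /compact_bounded[M [_ hM]].
  exists (Num.max 0 (M + 1) + 1); first by rewrite ltr_wpDl// le_max lexx.
  move=> x; have [Kx|/psi0 ->] := pselect (K x); last first.
    by rewrite normr0 addr_ge0// le_max lexx.
  apply: le_trans (hM (M + 1) _ (psi x) _) _; [by rewrite ltrDl|by exists x|].
  by rewrite ler_wpDr// le_max lexx orbT.
elim: k phi => [|k IH] phi phi0 sphi.
  have [B B0 hB] := bounded0 phi sphi phi0; exists B => // -[|//] _ x; exact: hB.
have partial0 i x : ~ K x -> partial i phi x = 0.
  move=> nKx; have := @iter_partial_local R n phi (fun=> 0) (~` K) [:: i].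
  by rewrite /= partial_cst; apply => //; exact: closed_openC.
have /fin_all_exists[B hB] : forall i, exists B : R, 0 < B /\
    forall s, (size s <= k)%N -> forall x, `|iter_partial (partial i phi) s x| <= B.
  move=> i; have [B B0 hB] := IH (partial i phi) (partial0 i) (smooth_partial i sphi).
  by exists B.
have [B0 B00 hB0] := bounded0 phi sphi phi0.
exists (B0 + \sum_i B i).
  by rewrite ltr_wpDr// sumr_ge0// => i _; have [/ltW] := hB i.
move=> s sk x; case/lastP: s sk => [_|s i].
  rewrite (le_trans (hB0 x))// lerDl sumr_ge0// => i _; by have [/ltW] := hB i.
rewrite size_rcons ltnS iter_partial_rcons => sk.
have [_ hBi] := hB i; rewrite (le_trans (hBi s sk x))//.
rewrite (bigD1 i)//= addrCA lerDl addr_ge0 ?(ltW B00)// sumr_ge0// => j _.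
by have [/ltW] := hB j.
Qed.

Section product.
Variables (S : set 'rV[R]_n) (r1 r2 : R) (eta phi : 'rV[R]_n -> R).
Hypotheses (r12 : r1 < r2) (seta : smooth eta) (sphi : smooth phi).
Hypothesis eta0 : forall x, neighborhood S r1 x -> eta x = 0.
Hypothesis eta1 : forall x, ~ neighborhood S ((r1 + r2) / 2) x -> eta x = 1.

Lemma product_iter_partial_in s x : neighborhood S r1 x ->
  iter_partial (fun y => phi y * eta y) s x = 0.
Proof.
move=> Sx; rewrite (@iter_partial_local _ _ _ (fun=> 0) (neighborhood S r1))//.
- by rewrite iter_partial_cst; case: s.
- exact: open_neighborhood.
- by move=> y /eta0 ->; rewrite mulr0.
Qed.

(** Since eta is 1 already beyond the middle radius, the product equals phi on a whole ball around
    [x], and not merely at [x]. *)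
Lemma product_iter_partial_out s x : ~ neighborhood S r2 x ->
  iter_partial (fun y => phi y * eta y) s x = iter_partial phi s x.
Proof.
move=> nSx; apply: (@iter_partial_local _ _ _ _ (neighborhood [set x] ((r2 - r1) / 2))).
- exact: open_neighborhood.
- move=> y [_ -> yx]; rewrite eta1 ?mulr1// => Sy; apply: nSx.
  rewrite (_ : r2 = (r1 + r2) / 2 + (r2 - r1) / 2); last by field.
  by apply: neighborhood_widen Sy _; rewrite eucl_distC ltW.
- by apply: neighborhood_sub => //; rewrite divr_gt0// subr_gt0.
Qed.

(** As r2 - r1 <= 1, the bound B may be weakened to B / (r2 - r1)^j to fit Leibniz' rule, and the
    power of order m dominates all lower ones. *)
Lemma product_iter_partial_le (m : nat) (B K : R) s x : r2 - r1 <= 1 -> 0 <= B -> 0 <= K ->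
  (forall s, (size s <= m)%N -> forall x, `|iter_partial phi s x| <= B) ->
  (forall s, (size s <= m)%N -> forall x,
    `|iter_partial eta s x| <= K / (r2 - r1) ^+ size s) ->
  (size s <= m)%N ->
  `|iter_partial (fun y => phi y * eta y) s x| <= 2 ^+ m * B * K / (r2 - r1) ^+ m.
Proof.
move=> r21 B0 K0 hB hK sm.
have d0 : 0 < r2 - r1 by rewrite subr_gt0.
have dle k : (k <= m)%N -> ((r2 - r1) ^+ k)^-1 <= ((r2 - r1) ^+ m)^-1.
  by move=> km; rewrite lef_pV2 ?posrE ?exprn_gt0// ler_wiXn2l// ltW.
have d1 k : 1 <= ((r2 - r1) ^+ k)^-1.
  by rewrite -[leLHS]invr1 lef_pV2 ?posrE ?exprn_gt0// exprn_ile1// ltW.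
have := @iter_partialM_le R n phi eta m (r2 - r1) B K x d0 sphi seta.
move=> /(_ _ (fun s sm => hK s sm x) s sm).
have hB' t : (size t <= m)%N -> `|iter_partial phi t x| <= B / (r2 - r1) ^+ size t.
  by move=> tm; rewrite (le_trans (hB t tm x))// ler_peMr.
move=> /(_ hB')/le_trans; apply.
apply: ler_pM; last exact: dle.
- by rewrite !mulr_ge0// exprn_ge0.
- by rewrite invr_ge0 exprn_ge0// ltW.
- do 2!(apply: ler_wpM2r => //).
  by rewrite ler_weXn2l// ler1n.
Qed.

Lemma product_test_function (Omega : set 'rV[R]_n) : 0 < r1 -> test_function Omega phi ->
  test_function (Omega `\` S) (fun y => phi y * eta y).
Proof.
move=> r10 [_ cphi phiO].
have sub : [set x | phi x * eta x != 0] `<=` [set x | phi x != 0].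
  by move=> x /=; rewrite mulf_eq0 negb_or => /andP[].
split; first exact: smoothM.
  apply: subclosed_compact cphi (closure_subset sub); exact: closed_closure.
move=> x cx; split; first by apply: phiO; exact: closure_subset sub _ cx.
move=> Sx; have [y [/= + Sy]] : [set x | phi x * eta x != 0] `&` neighborhood S r1 !=set0.
  apply: cx; apply: open_nbhs_nbhs; split; first exact: open_neighborhood.
  exact: neighborhood_sub.
by rewrite eta0// mulr0 eqxx.
Qed.

End product.

Lemma closure_neighborhood S (a b : R) : a < b ->
  closure (neighborhood S a) `<=` neighborhood S b.
Proof.
move=> ab x cx.
have [y [Sy [_ -> yx]]] : neighborhood S a `&` neighborhood [set x] (b - a) !=set0.
  apply: cx; apply: open_nbhs_nbhs; split; first exact: open_neighborhood.
  by apply: neighborhood_sub => //; rewrite subr_gt0.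
rewrite (_ : b = a + (b - a)); last by ring.
by apply: neighborhood_widen Sy _; rewrite eucl_distC ltW.
Qed.

Lemma test_function_one S (Omega : set 'rV[R]_n) (r : R) : bounded_set S -> 0 < r ->
  neighborhood S (2 * r) `<=` Omega ->
  exists phi, [/\ test_function Omega phi, forall x, 0 <= phi x
    & forall x, neighborhood S r x -> phi x = 1].
Proof.
move=> bS r0 SO.
have [K _ hK] := @smooth_cutoff R n 0.
have r2 : r < 2 * r by lra.
have [th [sth th01 th1 thS _]] := hK S r (2 * r) bS r2.
have cl : closure [set x | th x != 0] `<=` neighborhood S (2 * r).
  apply: (subset_trans (closure_subset thS)).
  by apply: closure_neighborhood; lra.
exists th; split => //; last by move=> x; have /andP[] := th01 x.
split => //; last exact: subset_trans cl SO.
apply: bounded_closed_compact; last exact: closed_closure.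
have [M [Mr hM]] := bounded_neighborhood (2 * r) bS.
by exists M; split => // M' MM' x /cl; exact: hM.
Qed.

End test_functions.

(** * Removability *)

Section removability.
Context {R : realType} {n m : nat}.
Variables (a : multi_index n m -> 'rV[R]_n -> R -> R) (A : R).
Variables (f : 'rV[R]_n -> R) (g : R -> R) (Omega S : set 'rV[R]_n) (u : 'rV[R]_n -> R).
Hypotheses (m0 : (0 < m)%N) (oO : open Omega) (cS : compact S).
Hypothesis car : forall alpha, multi_order alpha = m -> caratheodory_function Omega (a alpha).
Hypothesis A0 : 0 < A.
Hypothesis aA : forall alpha, multi_order alpha = m ->
  {ae @mes R n, forall x, Omega x -> forall z, `|a alpha x z| <= A * `|z|}.
Hypothesis f0 : forall x, Omega x -> 0 <= f x.
Hypothesis gg : convex_gauge g.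
Hypothesis sol : weak_solution a f g Omega S u.

(* [absu] and [source] are |u| and f g(|u|) for u extended by 0 to S. *)
Definition ext0 : Rn R n -> R := patch (cst 0) (~` S) u.
Definition absu (x : Rn R n) : R := `|ext0 x|.
Definition source (x : Rn R n) : R := f x * g (absu x).
Definition outside (r : R) : set (Rn R n) := Omega `\` neighborhood S r.
Definition shell (r1 r2 : R) : set (Rn R n) := outside r1 `&` neighborhood S r2.

Lemma ext0_in x : S x -> ext0 x = 0.
Proof. by move=> Sx; rewrite /ext0 /patch ifF//; apply/negbTE; rewrite notin_setE => /(_ Sx). Qed.

Lemma ext0_out x : ~ S x -> ext0 x = u x.
Proof. by move=> Sx; rewrite /ext0 /patch ifT//; rewrite inE. Qed.

Lemma mes_measurable_Omega : measurable (Omega : set (Rn R n)).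
Proof. exact: open_measurable_Rn. Qed.
Let mO := mes_measurable_Omega.

Lemma closed_singular : closed S.
Proof. by apply: compact_closed => //; exact: norm_hausdorff. Qed.

Lemma measurable_singular : measurable (S : set (Rn R n)).
Proof. exact/closed_measurable_Rn/closed_singular. Qed.

Lemma measurable_nbd r : measurable (neighborhood S r : set (Rn R n)).
Proof. exact/open_measurable_Rn/open_neighborhood. Qed.

Lemma measurable_outside r : measurable (outside r).
Proof. by apply: measurableD => //; exact: measurable_nbd. Qed.

Lemma measurable_shell r1 r2 : measurable (shell r1 r2).
Proof. by apply: measurableI; [exact: measurable_outside|exact: measurable_nbd]. Qed.

Lemma absu_ge0 x : 0 <= absu x. Proof. exact: normr_ge0. Qed.

Lemma source_ge0 x : Omega x -> 0 <= source x.
Proof. by move=> Ox; apply: mulr_ge0; [exact: f0|apply: gauge_ge0 => //; exact: absu_ge0]. Qed.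

Lemma outside_nS r x : 0 < r -> outside r x -> ~ S x.
Proof. by move=> r0 [_ nSx] Sx; apply: nSx; exact: neighborhood_sub. Qed.

Lemma integrable_ext0 r : 0 < r -> (@mes R n).-integrable (outside r) (EFin \o ext0).
Proof.
move=> r0; have [/(_ r r0)[iu _] _] := sol.
apply: eq_integrable iu; first exact: measurable_outside.
by move=> x; rewrite inE => /(outside_nS r0) nSx; rewrite /= ext0_out.
Qed.

Lemma integrable_absu r : 0 < r -> (@mes R n).-integrable (outside r) (EFin \o absu).
Proof.
move=> r0; have := integrable_abse (integrable_ext0 r0).
by apply: eq_integrable => //; exact: measurable_outside.
Qed.

Lemma integrable_source r : 0 < r -> (@mes R n).-integrable (outside r) (EFin \o source).
Proof.
move=> r0; have [/(_ r r0)[_ iu] _] := sol.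
apply: eq_integrable iu; first exact: measurable_outside.
by move=> x; rewrite inE => /(outside_nS r0) nSx; rewrite /= /source /absu ext0_out.
Qed.

Definition exhaust (k : nat) : set (Rn R n) := outside k.+1%:R^-1.

Lemma bigcup_exhaust : \bigcup_k exhaust k = Omega `\` S.
Proof.
apply/seteqP; split=> [x [k _ [Ox nSx]]|x [Ox nSx]].
  by split => // Sx; apply: nSx; apply: neighborhood_sub => //; rewrite invr_gt0.
have /nbhs_ballP[e /= e0 eS] : nbhs x (~` S).
  by apply: open_nbhs_nbhs; split => //; exact: closed_openC closed_singular.
have [k ke] : exists k, k.+1%:R^-1 < e.
  by have [k _ hk] := near_infty_natSinv_lt (PosNum e0); exists k; exact: (hk k (leqnn k)).
exists k => //; split => // -[y Sy xy]; apply: (eS y) => //.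
by apply: eucl_dist_ball; exact: lt_trans ke.
Qed.

Lemma exhaust_mono : nondecreasing_seq exhaust.
Proof.
apply/nondecreasing_seqP => k; rewrite subsetEset => x [Ox nSx]; split => // Sx.
apply: nSx; apply: neighborhoodS Sx.
by rewrite lef_pV2 ?posrE ?ltr0n// ler_nat.
Qed.

(** The definition of a weak solution controls u only off each S_r; the exhaustion reaches Omega \
    S, and the extension by 0 supplies S. *)
Lemma measurable_fun_from_exhaust (h : Rn R n -> R) :
  (forall r, 0 < r -> measurable_fun (outside r) h) -> (forall x, S x -> h x = 0) ->
  measurable_fun (Omega : set (Rn R n)) h.
Proof.
move=> mh hS.
have -> : Omega = (Omega `\` S) `|` (Omega `&` S) by rewrite setUC setUIDK.
have mOS : measurable (Omega `\` S : set (Rn R n)).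
  by apply: measurableD => //; exact: measurable_singular.
have mOI : measurable (Omega `&` S : set (Rn R n)).
  by apply: measurableI => //; exact: measurable_singular.
apply/(measurable_funU _ mOS mOI); split.
  rewrite -bigcup_exhaust; apply/measurable_fun_bigcup.
    by move=> k; exact: measurable_outside.
  by move=> k; apply: mh; rewrite invr_gt0.
apply: (@eq_measurable_fun _ _ _ _ _ (fun=> 0 : R)); last exact: measurable_cst.
by move=> x; rewrite inE => -[_ /hS].
Qed.

Lemma measurable_ext0 : measurable_fun (Omega : set (Rn R n)) ext0.
Proof.
apply: measurable_fun_from_exhaust; last exact: ext0_in.
by move=> r r0; exact: measurable_integrable (integrable_ext0 r0).
Qed.

Lemma measurable_absu : measurable_fun (Omega : set (Rn R n)) absu.
Proof. by apply: measurableT_comp => //; exact: measurable_ext0. Qed.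

Lemma measurable_source : measurable_fun (Omega : set (Rn R n)) source.
Proof.
apply: measurable_fun_from_exhaust => [r r0|x Sx].
  exact: measurable_integrable (integrable_source r0).
by rewrite /source /absu ext0_in// normr0 (gauge0 gg) mulr0.
Qed.

Definition operator (psi : 'rV[R]_n -> R) (x : Rn R n) : R :=
  \sum_(alpha : multi_index n m | multi_order alpha == m)
    (-1) ^+ m * a alpha x (ext0 x) * multi_partial alpha psi x.

Lemma measurable_operator psi : smooth psi -> measurable_fun (Omega : set (Rn R n)) (operator psi).
Proof.
move=> spsi; rewrite /operator.
rewrite (_ : (fun x => _) = fun x : Rn R n => \sum_(alpha <- index_enum (multi_index n m))
  if multi_order alpha == m then (-1) ^+ m * a alpha x (ext0 x) * multi_partial alpha psi x
  else 0); last by apply/funext => x; rewrite big_mkcond.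
apply: measurable_sum => alpha; case: eqP => [am|_]; last exact: measurable_cst.
apply: measurable_funM; last first.
  apply: continuous_measurable_Rn; rewrite multi_partialE.
  exact/smooth_continuous/smooth_iter_partial.
apply: measurable_funM; first exact: measurable_cst.
exact: (caratheodory_comp_measurable mO (car am) measurable_ext0).
Qed.

Definition good (x : Rn R n) : Prop := Omega x ->
  forall alpha, multi_order alpha = m -> forall z, `|a alpha x z| <= A * `|z|.

Lemma ae_good : {ae @mes R n, forall x, good x}.
Proof.
have := ae_mes_fin aA; apply: ae_mesS => x h Ox alpha am; exact: h.
Qed.

Definition num_alpha : R := \sum_(alpha : multi_index n m | multi_order alpha == m) 1.

Lemma num_alpha_ge0 : 0 <= num_alpha. Proof. by apply: sumr_ge0. Qed.

(** The family [b] is arbitrary because the bound is applied both to the derivatives of one function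
    and to a difference of such families. *)
Lemma operator_le x (b : multi_index n m -> R) (B : R) : good x -> Omega x ->
  (forall alpha, multi_order alpha = m -> `|b alpha| <= B) ->
  `|\sum_(alpha : multi_index n m | multi_order alpha == m)
    (-1) ^+ m * a alpha x (ext0 x) * b alpha| <= A * num_alpha * B * absu x.
Proof.
move=> gx Ox bB; rewrite (le_trans (ler_norm_sum _ _ _))//.
rewrite (_ : A * num_alpha * B * absu x = \sum_(alpha : multi_index n m | multi_order alpha == m)
  A * absu x * B); last first.
  rewrite (_ : \sum_(_ | _) _ =
    \sum_(alpha : multi_index n m | multi_order alpha == m) 1 * (A * absu x * B)).
    by rewrite -mulr_suml -/num_alpha; ring.
  by apply: eq_bigr => alpha _; rewrite mul1r.
apply: ler_sum => alpha /eqP am.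
rewrite !normrM normrX normrN1 expr1n mul1r; apply: ler_pM => //; first exact: gx.
exact: bB.
Qed.

Lemma multi_partial_le (psi : 'rV[R]_n -> R) x (alpha : multi_index n m) (B : R) :
  multi_order alpha = m ->
  (forall s, (size s <= m)%N -> `|iter_partial psi s x| <= B) ->
  `|multi_partial alpha psi x| <= B.
Proof. by move=> am; rewrite multi_partialE; apply; rewrite size_multi_order am. Qed.

(** The term 2^m B K accounts for the derivatives of phi eta, the term B for eta times those of
    phi. *)
Definition cutoff_const (K B : R) := A * num_alpha * (2 ^+ m * B * K + B).

(** The test function is phi eta. Only the commutator of the operator with multiplication by eta is
    estimated; it lives on the shell. Keeping [eta x * operator phi x] exact lets one inequality
    serve both for phi equal to 1 near S and for the passage to the limit with arbitrary phi. *)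
Lemma key_inequality : exists2 K : R, 0 < K &
  forall (phi : 'rV[R]_n -> R) (B : R), test_function Omega phi ->
  (forall x, 0 <= phi x) -> 0 < B ->
  (forall s, (size s <= m)%N -> forall x, `|iter_partial phi s x| <= B) ->
  forall r1 r2, 0 < r1 -> r1 < r2 -> r2 - r1 <= 1 ->
  exists eta : 'rV[R]_n -> R, [/\ continuous eta, forall x, 0 <= eta x <= 1,
    forall x, neighborhood S r1 x -> eta x = 0,
    forall x, ~ neighborhood S r2 x -> eta x = 1 & [/\
    (@mes R n).-integrable (outside r1) (EFin \o (fun x => source x * (phi x * eta x))),
    (@mes R n).-integrable (outside r1) (EFin \o (fun x => eta x * operator phi x)) &
    \int[@mes R n]_(x in outside r1) (source x * (phi x * eta x)) <=
    \int[@mes R n]_(x in outside r1) (eta x * operator phi x) +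
    cutoff_const K B / (r2 - r1) ^+ m * \int[@mes R n]_(x in shell r1 r2) absu x]].
Proof.
have [K K0 hK] := @smooth_hole R n m; exists K => //.
move=> phi B tphi phi0 B0 phiB r1 r2 r10 r12 r21.
have bS := compact_bounded cS.
have [eta [seta eta01 eta0 eta1 etaK]] := hK S r1 r2 bS r12.
have d0 : 0 < r2 - r1 by rewrite subr_gt0.
have sphi : smooth phi by case: tphi.
have eta1' x : ~ neighborhood S r2 x -> eta x = 1.
  by move=> nSx; apply: eta1 => Sx; apply: nSx; apply: neighborhoodS Sx; lra.
exists eta; split => //; first exact: smooth_continuous.
pose psi := fun y => phi y * eta y.
have spsi : smooth psi by exact: (smoothM sphi seta).
have tpsi : test_function (Omega `\` S) psi by exact: (product_test_function seta sphi eta0 r10 tphi).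
have psi0 x : 0 <= psi x by rewrite mulr_ge0//; have /andP[] := eta01 x.
have psi_in x : neighborhood S r1 x -> psi x = 0.
  by move=> /eta0 e; rewrite /psi e mulr0.
have partial_in alpha x : neighborhood S r1 x -> multi_partial alpha psi x = 0.
  by move=> Sx; rewrite multi_partialE; exact: (product_iter_partial_in phi eta0 _ Sx).
have mE := measurable_outside r1.
have EO : outside r1 `<=` Omega by exact: subDsetl.
have iw := integrable_absu r10.
have iW := integrable_source r10.
have iZ c : (@mes R n).-integrable (outside r1) (EFin \o (fun x => c * absu x)).
  by have := integrableZl mE c iw; apply: eq_integrable.
have integrable_op (h : Rn R n -> R) c : 0 <= c -> measurable_fun (Omega : set (Rn R n)) h ->
    (forall x, good x -> Omega x -> `|h x| <= c * absu x) ->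
    (@mes R n).-integrable (outside r1) (EFin \o h).
  move=> c0 mh hc; apply: (integrable_ae_bounded_by _ _ _ _ (iZ c)) => //.
  - exact: measurable_funS EO mh.
  - by move=> x _; rewrite mulr_ge0 ?absu_ge0.
  - by apply: ae_mesS ae_good => x gx /EO; exact: hc.
have c_ge0 b : 0 <= b -> 0 <= A * num_alpha * b.
  by move=> b0; rewrite !mulr_ge0 ?num_alpha_ge0// ltW.
have iQpsi : (@mes R n).-integrable (outside r1) (EFin \o operator psi).
  apply: (@integrable_op _ (A * num_alpha * (2 ^+ m * B * K / (r2 - r1) ^+ m))).
  - by rewrite c_ge0// divr_ge0 ?exprn_ge0 ?(ltW d0)// !mulr_ge0 ?exprn_ge0// ltW.
  - exact: measurable_operator.
  - move=> x gx Ox; apply: operator_le => // alpha am.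
    apply: multi_partial_le => // s sm.
    by apply: (product_iter_partial_le r12 seta sphi x r21 (ltW B0) (ltW K0) phiB etaK).
have Qphi_le x : good x -> Omega x -> `|operator phi x| <= A * num_alpha * B * absu x.
  move=> gx Ox; apply: operator_le => // alpha am.
  by apply: multi_partial_le => // s sm; exact: phiB.
have eta_norm x : `|eta x| <= 1.
  by have /andP[e0 e1] := eta01 x; rewrite ger0_norm.
have ietaQ : (@mes R n).-integrable (outside r1) (EFin \o (fun x => eta x * operator phi x)).
  apply: (@integrable_op _ (A * num_alpha * B)); first by rewrite c_ge0// ltW.
    apply: measurable_funM; last exact: measurable_operator.
    exact/continuous_measurable_Rn/smooth_continuous.
  move=> x gx Ox; rewrite normrM -[leRHS]mul1r; apply: ler_pM => //; exact: Qphi_le.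
have iWpsi : (@mes R n).-integrable (outside r1) (EFin \o (fun x => source x * psi x)).
  apply: (@integrable_bounded_by _ _ _ _ _ _ (fun x => B * source x) mE).
  - apply: measurable_funM; first exact: measurable_integrable iW.
    exact/continuous_measurable_Rn/smooth_continuous.
  - move=> x /EO Ox; rewrite normrM mulrC (ger0_norm (source_ge0 Ox)) ler_wpM2r ?source_ge0//.
    rewrite /psi normrM -[leRHS]mulr1; apply: ler_pM => //.
    exact: (phiB [::] isT).
  - by have := integrableZl mE B iW; apply: eq_integrable.
have ineq : \int[@mes R n]_(x in outside r1) (source x * psi x) <=
    \int[@mes R n]_(x in outside r1) operator psi x.
  have [_ /(_ psi tpsi psi0)] := sol; rewrite /integral_inequality.
  have notE x : Omega x -> ~ outside r1 x -> neighborhood S r1 x.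
    by move=> Ox nEx; apply: contrapT => nSx; apply: nEx; split.
  rewrite (@integral_extend0 _ _ _ (@mes R n) Omega (outside r1))//; last first.
    by move=> x Ox /(notE _ Ox) /psi_in ->; rewrite mulr0.
  rewrite (@integral_extend0 _ _ _ (@mes R n) Omega (outside r1))//; last first.
    move=> x Ox /(notE _ Ox) Sx; rewrite big1// => alpha _.
    by rewrite partial_in// mulr0.
  rewrite -lee_fin -!EFin_Rintegral//; congr (_ <= _)%E.
    apply: eq_integral => x; rewrite inE => /(outside_nS r10) nSx.
    by rewrite /source /absu ext0_out.
  apply: eq_integral => x; rewrite inE => /(outside_nS r10) nSx.
  by rewrite /operator ext0_out.
split => //; apply: (le_trans ineq).
pose c := cutoff_const K B / (r2 - r1) ^+ m.
(* The integral over the shell is rewritten over [outside r1], so that the claim reduces to a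
   pointwise comparison of integrands. *)
have mwS : measurable_fun (outside r1) (absu \_ (neighborhood S r2)).
  apply/(measurable_restrict absu (measurable_nbd r2) mE).
  by apply: measurable_funS measurable_absu => // x [/EO].
have iwS : (@mes R n).-integrable (outside r1) (EFin \o absu \_ (neighborhood S r2)).
  apply: (@integrable_bounded_by _ _ _ _ _ _ absu mE mwS) iw => x _.
  rewrite /patch; case: ifP => _; last by rewrite normr0 absu_ge0.
  by rewrite ger0_norm ?absu_ge0.
rewrite [X in _ + _ * X]Rintegral_mkcondr -/c -(RintegralZl c mE iwS) -RintegralD//; last first.
  by have := integrableZl mE c iwS; apply: eq_integrable.
apply: ae_le_Rintegral => //.
  have := integrableD mE ietaQ (integrableZl mE c iwS).
  by apply: eq_integrable.
apply: ae_mesS ae_good => x gx [Ox nS1].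
rewrite -lerBlDl (le_trans (ler_norm _))//.
have -> : operator psi x - eta x * operator phi x =
    \sum_(alpha : multi_index n m | multi_order alpha == m)
    (-1) ^+ m * a alpha x (ext0 x) * (multi_partial alpha psi x - eta x * multi_partial alpha phi x).
  rewrite /operator mulr_sumr -sumrB; apply: eq_bigr => alpha _; ring.
rewrite /patch; case: ifPn => [_|]; last first.
  rewrite notin_setE => nSx.
  rewrite big1 ?normr0 ?mulr0// => alpha _.
  rewrite eta1'// mul1r !multi_partialE.
  by rewrite (product_iter_partial_out phi r12 eta1 _ nSx) subrr mulr0.
have -> : c = A * num_alpha * ((2 ^+ m * B * K + B) / (r2 - r1) ^+ m).
  by rewrite /c /cutoff_const !mulrA.
apply: operator_le => // alpha am.
rewrite (le_trans (ler_normB _ _))// mulrDl lerD//.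
  apply: multi_partial_le => // s sm.
  by apply: (product_iter_partial_le r12 seta sphi x r21 (ltW B0) (ltW K0) phiB etaK).
rewrite normrM.
have phB : `|multi_partial alpha phi x| <= B.
  by apply: multi_partial_le => // s sm; exact: phiB.
rewrite (@le_trans _ _ B)//.
  by rewrite -[leRHS]mul1r; apply: ler_pM.
rewrite ler_peMr ?(ltW B0)// -[leLHS]invr1 lef_pV2 ?posrE ?exprn_gt0//.
by rewrite exprn_ile1// ltW.
Qed.

(* Jensen's inequality, through the supporting line at the mean. *)
Lemma jensen_source (E : set (Rn R n)) (M q : R) : measurable E -> E `<=` Omega ->
  (@mes R n).-integrable E (EFin \o absu) -> (@mes R n).-integrable E (EFin \o source) ->
  0 < M -> (mes E <= M%:E)%E -> 0 < q ->
  {ae @mes R n, forall x, E x -> q <= f x} ->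
  q * M * g ((\int[@mes R n]_(x in E) absu x) / M) <= \int[@mes R n]_(x in E) source x.
Proof.
move=> mE EO iw iW M0 EM q0 qf.
set U := \int[@mes R n]_(x in E) absu x; set y := U / M.
have U0 : 0 <= U by apply: Rintegral_ge0 => x _; exact: absu_ge0.
have : 0 <= y by rewrite divr_ge0// ltW.
rewrite le_eqVlt => /orP[/eqP <-|y0].
  rewrite (gauge0 gg) mulr0; apply: Rintegral_ge0 => x /EO; exact: source_ge0.
have [s s0 hs] := gauge_support gg y0.
have finE : (@mes R n E < +oo)%E by exact: le_lt_trans EM (ltry _).
have icst c : (@mes R n).-integrable E (EFin \o (fun=> c)).
  apply/integrableP; split; first exact: measurable_cst.
  by rewrite /= integral_cst// lte_mul_pinfty.
have il : (@mes R n).-integrable E (EFin \o (fun x => q * (g y - s * y) + q * s * absu x)).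
  have := integrableD mE (icst (q * (g y - s * y))) (integrableZl mE (q * s) iw).
  by apply: eq_integrable.
apply: (@le_trans _ _ (\int[@mes R n]_(x in E) (q * (g y - s * y) + q * s * absu x))).
  rewrite RintegralD//; last first.
    by have := integrableZl mE (q * s) iw; apply: eq_integrable.
  rewrite Rintegral_cst// RintegralZl// -/U.
  have -> : U = y * M by rewrite /y divfK// gt_eqF.
  (* The supporting line is at most g(0) = 0 at the origin. Its constant term being nonpositive, the
     measure of [E] may be replaced by the upper bound [M]. *)
  have gy : g y - s * y <= 0.
    by have := hs 0 (lexx 0); rewrite (gauge0 gg) sub0r mulrN.
  have mM : fine (@mes R n E) <= M.
    by rewrite -lee_fin fineK// ge0_fin_numE.
  have : (g y - s * y) * M <= (g y - s * y) * fine (@mes R n E) by rewrite ler_wnM2l.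
  move=> /(ler_wpM2l (ltW q0)); lra.
apply: ae_le_Rintegral => //; apply: ae_mesS qf => x + Ex => /(_ Ex) qfx.
apply: (@le_trans _ _ (q * g (absu x))).
  rewrite -mulrA -mulrDr ler_pM2l//.
  have := hs (absu x) (absu_ge0 x); lra.
by apply: ler_wpM2r qfx; apply: gauge_ge0 => //; exact: absu_ge0.
Qed.

Hypotheses (bO : bounded_set Omega) (SO : S `<=` Omega).
Hypothesis G1 : (tail_integral m g 1 < +oo)%E.
(** In the application p = n - k - m - delta and M0 = 4^n. Writing the shell measure as r^p r^m lets
    r^p combine with T, while r^m cancels the cut-off factor. *)
Variables (p M0 : R).
Hypothesis M00 : 0 < M0.
Hypothesis weight : forall C e : R, 0 < C -> 0 < e ->
  exists2 r0, 0 < r0 & forall r, 0 < r -> r < r0 ->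
    exists q T, [/\ 0 < q, 0 < T, tail_fun m g T <= C * r * q, r `^ p * T <= e &
      {ae @mes R n, forall x, (neighborhood S r `\` S) x -> q ^+ m <= f x}].
Hypothesis thin : exists2 r0 : R, 0 < r0 & forall r, 0 < r -> r < r0 ->
  (mes (neighborhood S r `\` S) <= (M0 * (r `^ p * r ^+ m))%:E)%E.

Lemma shell_sub r1 r2 : 0 < r1 -> shell r1 r2 `<=` neighborhood S r2 `\` S.
Proof. by move=> r10 x [E1 N2]; split => //; exact: outside_nS E1. Qed.

Lemma shell_outside r1 r2 : shell r1 r2 `<=` outside r1.
Proof. exact: subIsetl. Qed.

Lemma outside_Omega r : outside r `<=` Omega.
Proof. exact: subDsetl. Qed.

Lemma integrable_shell (h : Rn R n -> R) r1 r2 :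
  (@mes R n).-integrable (outside r1) (EFin \o h) ->
  (@mes R n).-integrable (shell r1 r2) (EFin \o h).
Proof.
apply: integrableS; [exact: measurable_outside|exact: measurable_shell|].
exact: shell_outside.
Qed.

Definition source_mass (r1 r2 : R) : R := \int[@mes R n]_(x in shell r1 r2) source x.
Definition absu_mass (r1 r2 : R) : R := \int[@mes R n]_(x in shell r1 r2) absu x.

Lemma absu_mass_ge0 r1 r2 : 0 <= absu_mass r1 r2.
Proof. by apply: Rintegral_ge0 => x _; exact: absu_ge0. Qed.

Lemma source_mass_ge0 r1 r2 : 0 <= source_mass r1 r2.
Proof. by apply: Rintegral_ge0 => x [/outside_Omega Ox _]; exact: source_ge0. Qed.

Lemma source_mass_split r1 r2 r3 : 0 < r1 -> r1 <= r2 -> r2 <= r3 ->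
  source_mass r1 r3 = source_mass r1 r2 + source_mass r2 r3.
Proof.
move=> r10 r12 r23; rewrite /source_mass -Rintegral_setU.
- congr (fine (integral _ _ _)); apply/seteqP; split=> x.
    move=> [[Ox n1] N3]; have [N2|n2] := pselect (neighborhood S r2 x); first by left.
    by right.
  move=> [[[Ox n1] N2]|[[Ox n2] N3]]; split => //.
    exact: neighborhoodS N2.
  by split => // N1; apply: n2; exact: neighborhoodS N1.
- exact: measurable_shell.
- exact: measurable_shell.
- have iW := integrable_source r10.
  apply: integrableS iW; [exact: measurable_outside| |].
    by apply: measurableU; exact: measurable_shell.
  move=> x [[]//|[[Ox n2] N3]]; split => // N1; apply: n2; exact: neighborhoodS N1.
- by apply/disj_setPS => x [[_ N2] [[_ n2] _]].
Qed.

Lemma powR_expn_invn (q : R) : 0 <= q -> (q ^+ m) `^ m%:R^-1 = q.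
Proof.
move=> q0; rewrite -powR_mulrn// -powRrM mulfV ?powRr1//.
by rewrite pnatr_eq0 -lt0n.
Qed.

Lemma jensen_shell r1 r2 (M q : R) : 0 < r1 -> 0 < M -> 0 < q ->
  (mes (neighborhood S r2 `\` S) <= M%:E)%E ->
  {ae @mes R n, forall x, (neighborhood S r2 `\` S) x -> q ^+ m <= f x} ->
  q ^+ m * M * g (absu_mass r1 r2 / M) <= source_mass r1 r2.
Proof.
move=> r10 M1 q0 sM qf; apply: jensen_source => //.
- exact: measurable_shell.
- exact: subset_trans (@shell_outside _ _) (@outside_Omega _).
- exact/integrable_shell/integrable_absu.
- exact/integrable_shell/integrable_source.
- by apply: le_trans sM; apply: le_lebesgue_outer; exact: shell_sub.
- by rewrite exprn_gt0.
- by apply: ae_mesS qf => x qx /(shell_sub r10); exact: qx.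
Qed.

(* Testing with a function equal to 1 near [S]. *)
Lemma source_mass_le : exists r3 C bnd, [/\ 0 < r3, 0 < C, 1 <= bnd &
  forall r1 r2, 0 < r1 -> r1 < r2 -> r2 <= r3 ->
    source_mass r2 r3 <= C / (r2 - r1) ^+ m * absu_mass r1 r2 + bnd].
Proof.
have [R0 R00 NR0] := compact_neighborhood_sub cS oO SO.
(* Half of R0 leaves room in Omega for a test function equal to 1 on S_r3; the bound 1 makes every
   shell width admissible in [key_inequality]. *)
pose r3 := Num.min (R0 / 2) 1.
have r30 : 0 < r3 by rewrite lt_min ltr01 andbT divr_gt0.
have r31 : r3 <= 1 by rewrite ge_min lexx orbT.
have N3 : neighborhood S (2 * r3) `<=` Omega.
  apply: subset_trans NR0; apply: neighborhoodS.
  by rewrite -ler_pdivlMl// mulrC /r3 ge_min lexx.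
have [phi [tphi phi0 phi1]] := test_function_one (compact_bounded cS) r30 N3.
have [sphi cphi _] := tphi.
have [B B0 phiB] := bounded_iter_partial m sphi cphi.
have [K K0 key] := key_inequality.
have num0 := num_alpha_ge0.
have C0 : 0 <= cutoff_const K B.
  by rewrite /cutoff_const !mulr_ge0// ?(ltW A0)// addr_ge0 ?(ltW B0)//
    !mulr_ge0 ?exprn_ge0 ?(ltW B0) ?(ltW K0).
pose bnd := A * num_alpha * B * \int[@mes R n]_(x in outside r3) absu x + 1.
exists r3, (cutoff_const K B + 1), bnd; split => //.
- by rewrite ltr_wpDl.
- rewrite /bnd lerDr !mulr_ge0 ?(ltW A0) ?(ltW B0)//.
  by apply: Rintegral_ge0 => x _; exact: absu_ge0.
move=> r1 r2 r10 r12 r23.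
have d0 : 0 < r2 - r1 by rewrite subr_gt0.
have r21 : r2 - r1 <= 1 by lra.
have [eta [ceta eta01 eta0 eta1 [iWpsi ietaQ ineq]]] :=
  key phi B tphi phi0 B0 phiB r1 r2 r10 r12 r21.
have eta_ge0 x : 0 <= eta x by have /andP[] := eta01 x.
have sub : shell r2 r3 `<=` outside r1.
  by move=> x [[Ox n2] _]; split => // N1; apply: n2; apply: neighborhoodS N1; exact: ltW.
have mE1 := measurable_outside r1; have mE3 := measurable_outside r3.
have sub31 : outside r3 `<=` outside r1.
  by move=> x [Ox n3]; split => // N1; apply: n3; apply: neighborhoodS N1; lra.
have le1 : source_mass r2 r3 <= \int[@mes R n]_(x in outside r1) (source x * (phi x * eta x)).
  apply: (@le_trans _ _ (\int[@mes R n]_(x in shell r2 r3) (source x * (phi x * eta x)))).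
    rewrite /source_mass; under eq_Rintegral => x.
      rewrite inE => -[[Ox n2] N3x].
      rewrite (_ : source x = source x * (phi x * eta x)); last first.
        by rewrite phi1// eta1// !mulr1.
      over.
    by [].
  apply: le_Rintegral_subset => //; first exact: measurable_shell.
  move=> x [Ox _]; apply: mulr_ge0; first exact: source_ge0.
  by apply: mulr_ge0; [exact: phi0|exact: eta_ge0].
have le2 : \int[@mes R n]_(x in outside r1) (eta x * operator phi x) <=
    A * num_alpha * B * \int[@mes R n]_(x in outside r3) absu x.
  have iw3 := integrable_absu r30.
  have iw3' : (@mes R n).-integrable (outside r1) (EFin \o (absu \_ (outside r3))).
    apply: (@integrable_extend0 _ _ _ _ _ (outside r3)) => //.
      by move=> x _ nx; rewrite /patch ifF//; apply/negbTE; rewrite notin_setE.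
    apply: eq_integrable iw3 => // x xE.
    by rewrite /= /patch xE.
  have -> : \int[@mes R n]_(x in outside r3) absu x =
      \int[@mes R n]_(x in outside r1) (absu \_ (outside r3)) x.
    rewrite -Rintegral_mkcondr; congr (fine (integral _ _ _)).
    by apply/esym/setIidPr.
  rewrite -(RintegralZl _ mE1 iw3').
  apply: ae_le_Rintegral => //.
    by have := integrableZl mE1 (A * num_alpha * B) iw3'; apply: eq_integrable.
  apply: ae_mesS ae_good => x gx [Ox n1].
  rewrite (le_trans (ler_norm _))//.
  (* On S_r3 phi is constant, and order m >= 1 means at least one derivative, so [operator phi]
     vanishes there. What remains is an integral over [outside r3], which does not depend on r1 and
     r2. *)
  have [N3x|n3] := pselect (neighborhood S r3 x).
    suff -> : operator phi x = 0.
      rewrite mulr0 normr0 !mulr_ge0 ?(ltW A0) ?(ltW B0)//.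
      by rewrite /patch; case: ifP => _; rewrite ?absu_ge0.
    rewrite /operator big1// => alpha /eqP am; rewrite multi_partialE.
    rewrite (@iter_partial_local _ _ phi (fun=> 1) (neighborhood S r3))//; last first.
      exact: open_neighborhood.
    rewrite iter_partial_cst; move: (size_multi_order alpha); rewrite am.
    by case: (flatten _) => [/= m_eq0|? ? _]; [move: m0; rewrite -m_eq0|rewrite mulr0].
  rewrite /patch ifT; last by rewrite inE.
  rewrite normrM -[leRHS]mul1r; apply: ler_pM => //.
    by have /andP[e0 e1] := eta01 x; rewrite ger0_norm.
  apply: operator_le => // alpha am; apply: multi_partial_le => // s sm; exact: phiB.
rewrite (le_trans le1)// (le_trans ineq)// addrC lerD//.
  rewrite ler_wpM2r ?absu_mass_ge0// ler_pM2r ?invr_gt0 ?exprn_gt0//.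
  by rewrite lerDl.
by rewrite (le_trans le2)// /bnd lerDl.
Qed.

(** The bound is 2 bnd. If it failed at one radius [rs], it would fail at every smaller one, because
    the mass grows as the inner radius shrinks; the whole argument then takes place on (0, rs]. *)
Lemma source_mass_bounded : exists r3 L, 0 < r3 /\
  forall r, 0 < r -> r <= r3 -> source_mass r r3 <= L.
Proof.
have [r3 [C [bnd [r30 C0 bnd1 massle]]]] := source_mass_le.
have bnd0 : 0 < bnd by rewrite (lt_le_trans _ bnd1).
exists r3, (2 * bnd); split => // rs rs0 rs3; rewrite leNgt; apply/negP => big.
have F_ge r : 0 < r -> r <= rs -> source_mass rs r3 <= source_mass r r3.
  move=> r0 rrs; rewrite (source_mass_split r0 rrs rs3) lerDr; exact: source_mass_ge0.
(* A mass above 2 bnd is at most twice its excess over bnd, so absorbing bnd costs a factor 2. *)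
pose C2 := 2 * C; have C20 : 0 < C2 by rewrite mulr_gt0.
have massle2 r1 r2 : 0 < r1 -> r1 < r2 -> r2 <= rs ->
    source_mass r2 r3 <= C2 / (r2 - r1) ^+ m * absu_mass r1 r2.
  move=> r10 r12 r2s; have := massle r1 r2 r10 r12 (le_trans r2s rs3).
  have := F_ge r2 (lt_trans r10 r12) r2s.
  rewrite /C2 -[2 * C / _]mulrA -[2 * (C / _) * _]mulrA; lra.
(* For kappa = q^m / C2 below, (2 / kappa)^(1/m) equals c0 / q. The choice C0' = 1 / (8 c0) turns
   G(T) <= C0' r q into the bound r / 4 asked by [keller_osserman], and [e] makes the last estimate
   of the mass at most 1. *)
pose c0 := (2 * C2) `^ m%:R^-1.
have c00 : 0 < c0 by rewrite powR_gt0// mulr_gt0.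
pose C0' := (8 * c0)^-1; have C0'0 : 0 < C0' by rewrite invr_gt0 mulr_gt0.
pose e := (C2 * 2 ^+ m * 2 * M0)^-1.
have e0 : 0 < e by rewrite invr_gt0 !mulr_gt0 ?exprn_gt0.
have [d1 d10 hd1] := weight C0'0 e0.
have [d2 d20 hd2] := thin.
have min0 : 0 < Num.min rs (Num.min d1 d2) by rewrite !lt_min rs0 d10 d20.
have [r r0 rlt] : exists2 r, 0 < r & r < Num.min rs (Num.min d1 d2).
  exists (Num.min rs (Num.min d1 d2) / 2); first by rewrite divr_gt0.
  by rewrite ltr_pdivrMr// ltr_pMr// ltr1n.
move: (rlt); rewrite !lt_min => /and3P[rrs rd1 rd2].
have [q [T [q0 T0 tailT rT qf]]] := hd1 r r0 rd1.
have sM := hd2 r r0 rd2.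
set M := M0 * (r `^ p * r ^+ m) in sM.
have rp0 : 0 < r `^ p by rewrite powR_gt0.
have M1 : 0 < M by rewrite !mulr_gt0 ?exprn_gt0.
have qM0 : 0 < q ^+ m * M by rewrite mulr_gt0 ?exprn_gt0.
have jensen r1 r2 : 0 < r1 -> r1 <= r2 -> r2 <= r ->
    q ^+ m * M * g (absu_mass r1 r2 / M) <= source_mass r1 r3 - source_mass r2 r3.
  move=> r10 r12 r2r.
  have r23 : r2 <= r3 by rewrite (le_trans r2r)// (le_trans (ltW rrs)).
  rewrite (source_mass_split r10 r12 r23) addrK; apply: jensen_shell => //.
    by apply: le_trans sM; apply: le_lebesgue_outer => x [/(neighborhoodS r2r)].
  by apply: ae_mesS qf => x qx [/(neighborhoodS r2r) Nx nSx]; exact: qx.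
(* With this normalisation Jensen's inequality loses its prefactor and becomes the step hypothesis
   of [keller_osserman]. *)
pose J s := source_mass s r3 / (q ^+ m * M).
pose kappa := q ^+ m / C2.
have kappa0 : 0 < kappa by rewrite divr_gt0 ?exprn_gt0.
have Jr : J (r / 2) < g (2 * T).
  apply: (keller_osserman m0 gg G1 T0 kappa0 r0).
  - move=> r1 r2 r10 r12 r2r; rewrite /J ler_pM2r ?invr_gt0//.
    rewrite (source_mass_split r10 r12) ?lerDr ?source_mass_ge0//.
    by rewrite (le_trans r2r)// (le_trans (ltW rrs)).
  - move=> r1 r2 r10 r12 r2r.
    have d0 : 0 < r2 - r1 by rewrite subr_gt0.
    have gle : g (kappa * (r2 - r1) ^+ m * J r2) <= g (absu_mass r1 r2 / M).
      apply: gauge_le => //.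
        apply: mulr_ge0; last by apply: divr_ge0; [exact: source_mass_ge0|exact: ltW].
        by apply: mulr_ge0; [exact: ltW|rewrite exprn_ge0// ltW].
      have := massle2 r1 r2 r10 r12 (le_trans r2r (ltW rrs)).
      rewrite -ler_pdivrMl ?divr_gt0 ?exprn_gt0// => h; rewrite /J /kappa.
      rewrite ler_pdivlMr//; apply: le_trans h.
      rewrite le_eqVlt; apply/orP; left; apply/eqP; field.
      by rewrite !expf_eq0 !gt_eqF// ?andbF.
    have : q ^+ m * M * g (kappa * (r2 - r1) ^+ m * J r2) <=
        source_mass r1 r3 - source_mass r2 r3.
      apply: (le_trans (ler_wpM2l (ltW qM0) gle)).
      by apply: jensen => //; exact: ltW.
    rewrite -ler_pdivlMl// mulrBr ![(q ^+ m * M)^-1 * _]mulrC => h2.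
    by rewrite /J; lra.
  - have -> : (2 / kappa) `^ m%:R^-1 = c0 / q.
      have C22 : 0 <= 2 * C2 by apply: mulr_ge0 => //; exact: ltW.
      rewrite /kappa invf_div mulrA powRM//; last by rewrite invr_ge0 exprn_ge0 ?(ltW q0).
      congr (_ * _); rewrite -exprVn powR_expn_invn// invr_ge0; exact: ltW.
    apply: (@le_trans _ _ (2 * (c0 / q) * (C0' * r * q))).
      by rewrite ler_wpM2l// mulr_ge0// divr_ge0 ?(ltW c00) ?(ltW q0).
    rewrite le_eqVlt; apply/orP; left; apply/eqP; rewrite /C0'; field.
    by rewrite !gt_eqF.
have r20 : 0 < r / 2 by rewrite divr_gt0.
have r2r : r / 2 < r by lra.
have Ule : absu_mass (r / 2) r / M < 2 * T.
  (* If the normalised mass of |u| were at least 2 T, Jensen's inequality on this shell would give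
     J(r/2) >= g(2 T). *)
  rewrite ltNge; apply/negP => Tle.
  have := jensen (r / 2) r r20 (ltW r2r) (lexx r).
  have T20 : 0 <= 2 * T by rewrite mulr_ge0// ltW.
  have := gauge_le gg T20 Tle.
  move: Jr; rewrite /J ltr_pdivrMr// [X in _ < X]mulrC => Jr gT js.
  have : q ^+ m * M * g (2 * T) <= q ^+ m * M * g (absu_mass (r / 2) r / M).
    by rewrite ler_pM2l.
  by move/le_trans/(_ js); rewrite leNgt; have := source_mass_ge0 r r3; lra.
have := massle2 (r / 2) r r20 r2r (ltW rrs).
have -> : r - r / 2 = r / 2 by field.
move: Ule; rewrite ltr_pdivrMr// => Ule.
have : C2 / (r / 2) ^+ m * absu_mass (r / 2) r <= C2 / (r / 2) ^+ m * (2 * T * M).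
  by rewrite ler_wpM2l ?(ltW Ule)// divr_ge0 ?(ltW C20)// exprn_ge0// ltW.
have -> : C2 / (r / 2) ^+ m * (2 * T * M) = C2 * 2 ^+ m * 2 * M0 * (r `^ p * T).
  have rm0 : r ^+ m != 0 by rewrite expf_neq0// gt_eqF.
  have tm0 : (2 : R) ^+ m != 0 by rewrite expf_neq0.
  rewrite /M expr_div_n; field; apply/andP; split; [exact: tm0|exact: rm0].
(* The mass at r is then at most 1, although it exceeds 2 bnd >= 2. *)
have : C2 * 2 ^+ m * 2 * M0 * (r `^ p * T) <= 1.
  have K0 : 0 < C2 * 2 ^+ m * 2 * M0 by rewrite -invr_gt0.
  rewrite -[leRHS](mulfV (lt0r_neq0 K0)).
  by apply: ler_wpM2l; [exact: ltW|exact: rT].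
have := F_ge r r0 (ltW rrs); lra.
Qed.

Lemma integrable_from_exhaust (h : Rn R n -> R) (L : R) :
  measurable_fun (Omega : set (Rn R n)) h -> (forall x, Omega x -> 0 <= h x) ->
  (forall x, S x -> h x = 0) ->
  (forall r, 0 < r -> (@mes R n).-integrable (outside r) (EFin \o h)) ->
  (forall r, 0 < r -> \int[@mes R n]_(x in outside r) h x <= L) ->
  (@mes R n).-integrable (Omega : set (Rn R n)) (EFin \o h).
Proof.
move=> mh h0 hS ih hL.
have mOS : measurable (Omega `\` S : set (Rn R n)).
  by apply: measurableD => //; exact: measurable_singular.
have mhOS : measurable_fun (Omega `\` S : set (Rn R n)) h.
  by apply: measurable_funS mh => // x [].
have OSO : Omega `\` S `<=` Omega by exact: subDsetl.
apply: (integrable_extend0 mO mOS OSO).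
  by move=> x Ox nx; apply: hS; apply: contrapT => nSx; apply: nx.
apply/integrableP; split; first exact/measurable_EFinP.
have -> : (\int[@mes R n]_(x in Omega `\` S) `|(EFin \o h) x| =
    \int[@mes R n]_(x in \bigcup_k exhaust k) (EFin \o h) x)%E.
  rewrite bigcup_exhaust; apply: eq_integral => x; rewrite inE => -[Ox _].
  by rewrite /= ger0_norm ?h0.
apply: (@le_lt_trans _ _ L%:E); last exact: ltry.
have cvgF : (\int[@mes R n]_(x in exhaust k) (EFin \o h) x @[k --> \oo] -->
    \int[@mes R n]_(x in \bigcup_k exhaust k) (EFin \o h) x)%E.
  apply: ge0_nondecreasing_set_cvg_integral.
  - exact: exhaust_mono.
  - by move=> k; exact: measurable_outside.
  - move=> k; apply/measurable_EFinP; apply: measurable_funS mh => //.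
    exact: outside_Omega.
  - by move=> k x /outside_Omega Ox; rewrite /= lee_fin h0.
rewrite -(cvg_lim _ cvgF)//; apply: lime_le.
  by apply/cvg_ex; eexists; exact: cvgF.
near=> k; have k0 : 0 < k.+1%:R^-1 :> R by rewrite invr_gt0.
rewrite /exhaust (EFin_Rintegral (ih _ k0) (measurable_outside _)) lee_fin; exact: hL.
Unshelve. all: end_near. Qed.

Lemma integrable_source_Omega :
  (@mes R n).-integrable (Omega : set (Rn R n)) (EFin \o source).
Proof.
have [r3 [L [r30 massL]]] := source_mass_bounded.
pose L3 := \int[@mes R n]_(x in outside r3) source x.
have L30 : 0 <= L3 by apply: Rintegral_ge0 => x /outside_Omega; exact: source_ge0.
have L0 : 0 <= L by exact: le_trans (source_mass_ge0 r3 r3) (massL _ r30 (lexx _)).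
apply: (@integrable_from_exhaust _ (L + L3)).
- exact: measurable_source.
- exact: source_ge0.
- by move=> x Sx; rewrite /source /absu ext0_in// normr0 (gauge0 gg) mulr0.
- by move=> r; exact: integrable_source.
move=> r r0; have [rr3|/ltW r3r] := leP r r3; last first.
  apply: (@le_trans _ _ L3); last by rewrite lerDr.
  apply: le_Rintegral_subset; [exact: measurable_outside|exact: measurable_outside| | |].
  - by move=> x [Ox nx]; split => // N3; apply: nx; exact: neighborhoodS N3.
  - exact: integrable_source.
  - by move=> x /outside_Omega; exact: source_ge0.
have -> : outside r = shell r r3 `|` outside r3.
  apply/seteqP; split=> [x [Ox nx]|x [[]//|[Ox n3]]].
    by have [N3|n3] := pselect (neighborhood S r3 x); [left|right].
  by split => // Nx; apply: n3; exact: neighborhoodS Nx.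
have iU : (@mes R n).-integrable (shell r r3 `|` outside r3) (EFin \o source).
  apply: integrable_union; [exact: measurable_shell|exact: measurable_outside| |].
    exact/integrable_shell/integrable_source.
  exact: integrable_source.
rewrite (Rintegral_setU (measurable_shell _ _) (measurable_outside _) iU).
  by rewrite lerD2r; exact: massL.
by apply/disj_setPS => x [[_ N3] [_ n3]].
Qed.

Lemma mes_Omega_lty : (@mes R n Omega < +oo)%E.
Proof. exact: bounded_mes_lty. Qed.

Lemma integrable_absu_Omega :
  (@mes R n).-integrable (Omega : set (Rn R n)) (EFin \o absu).
Proof.
have [d d0 hd] := weight (ltr01 : 0 < 1 :> R) (ltr01 : 0 < 1 :> R).
have r0 : 0 < d / 2 by rewrite divr_gt0.
have rd : d / 2 < d by lra.
have [q [T [q0 _ _ _ qf]]] := hd _ r0 rd.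
(* The supporting line at 1 bounds z by 1 + g(z) / s; with f >= q^m near S this bounds |u| there by
   1 + c f g(|u|). *)
have [s s0 hs] := gauge_support gg ltr01.
have mE := measurable_outside (d / 2).
have gle z : 0 <= z -> z <= 1 + g z / s.
  move=> z0; have := hs z z0; have := gauge_gt0 gg ltr01 => g10 hz.
  by rewrite -lerBlDl ler_pdivlMr// mulrC; lra.
pose c := (s * q ^+ m)^-1.
have c0 : 0 < c by rewrite invr_gt0 mulr_gt0// exprn_gt0.
pose h (x : Rn R n) := (absu \_ (outside (d / 2))) x + (1 + c * source x).
have patch_ge0 x : 0 <= (absu \_ (outside (d / 2))) x.
  by rewrite /patch; case: ifP => _ //; exact: absu_ge0.
have ip : (@mes R n).-integrable (Omega : set (Rn R n)) (EFin \o (absu \_ (outside (d / 2)))).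
  apply: (integrable_extend0 mO mE (@outside_Omega _)).
  - by move=> x _ nx; rewrite /patch ifF//; apply/negbTE; rewrite notin_setE.
  - apply: eq_integrable (integrable_absu r0) => // x xE; by rewrite /= /patch xE.
have i1 : (@mes R n).-integrable (Omega : set (Rn R n)) (EFin \o (fun=> 1 : R)).
  apply/integrableP; split; first exact: measurable_cst.
  by rewrite /= integral_cst// lte_mul_pinfty// mes_Omega_lty.
apply: (@integrable_ae_bounded_by _ _ _ _ _ _ h) => //.
- exact: measurable_absu.
- move=> x Ox; rewrite /h addr_ge0// addr_ge0// mulr_ge0 ?(ltW c0)//; exact: source_ge0.
- apply: ae_mesS qf => x qx Ox; rewrite ger0_norm ?absu_ge0//.
  have s1 : 0 <= 1 + c * source x.
    by rewrite addr_ge0// mulr_ge0 ?(ltW c0)//; exact: source_ge0.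
  have [Sx|nSx] := pselect (S x).
    by rewrite /absu ext0_in// normr0 /h addr_ge0.
  have [Nx|nx] := pselect (neighborhood S (d / 2) x); last first.
    by rewrite /h /patch ifT ?inE// lerDl.
  rewrite /h ler_wpDl// (le_trans (gle _ (absu_ge0 x)))// lerD2l.
  have qm0 : q ^+ m != 0 by rewrite expf_neq0// gt_eqF.
  rewrite (_ : g (absu x) / s = c * (q ^+ m * g (absu x))); last first.
    by rewrite /c; field; rewrite qm0 gt_eqF.
  rewrite ler_pM2l//.
  by apply: ler_wpM2r; [apply: gauge_ge0 => //; exact: absu_ge0|exact: qx].
- have i2 := integrableD mO i1 (integrableZl mO c integrable_source_Omega).
  by have := integrableD mO ip i2; apply: eq_integrable.
Qed.

(** [E] must avoid [S], which may have positive measure: the sets S_d \ S shrink to the empty set,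
    the neighbourhoods S_d do not. *)
Lemma tail_small (h : Rn R n -> R) (e : R) : 0 < e ->
  (@mes R n).-integrable (Omega : set (Rn R n)) (EFin \o h) ->
  (forall x, Omega x -> 0 <= h x) ->
  exists2 d, 0 < d & forall E : set (Rn R n), measurable E -> E `<=` Omega ->
    E `<=` neighborhood S d `\` S -> \int[@mes R n]_(x in E) h x <= e.
Proof.
move=> e0 ih h0; have OSO : Omega `\` S `<=` Omega by exact: subDsetl.
have mOS : measurable (Omega `\` S : set (Rn R n)).
  by apply: measurableD => //; exact: measurable_singular.
have iOS : (@mes R n).-integrable (Omega `\` S : set (Rn R n)) (EFin \o h).
  exact: integrableS ih.
have := @integral_small_tail _ _ _ (@mes R n) exhaust (EFin \o h) e.
rewrite bigcup_exhaust => /(_ exhaust_mono (fun k => measurable_outside _)).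
move=> /(_ (measurable_int _ iOS)) /(_ _ _ e0)[].
- by move=> x /OSO Ox; rewrite /= lee_fin h0.
- have /integrableP[_] := iOS; apply: le_lt_trans.
  rewrite le_eqVlt; apply/orP; left; apply/eqP; apply: eq_integral => x.
  by rewrite inE => /OSO Ox; rewrite /= ger0_norm ?h0.
move=> k hk; exists k.+1%:R^-1; first by rewrite invr_gt0.
move=> E mE EO ES; set D := (Omega `\` S) `\` exhaust k in hk.
have mD : measurable (D : set (Rn R n)).
  by apply: measurableD => //; exact: measurable_outside.
have iD : (@mes R n).-integrable (D : set (Rn R n)) (EFin \o h).
  by apply: integrableS iOS => // x [].
apply: (@le_trans _ _ (\int[@mes R n]_(x in D) h x)).
  apply: le_Rintegral_subset => //; last by move=> x [/OSO Ox _]; exact: h0.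
  by move=> x Ex; have [Nx nSx] := ES _ Ex; split; [split => //; exact: EO|move=> [_]].
by rewrite -lee_fin -EFin_Rintegral//; exact: ltW.
Qed.

(** Let y be the mass of |u| on the shell divided by M. If y <= 2 T, the mass is at most 2 T M,
    which is small against r^m because r^p T is. Otherwise y / 2 > T, so that the dyadic bound gives
    y <= (2 r q)^m g(y), and Jensen's inequality bounds q^m M g(y) by the mass of the source, now
    known to tend to 0. The first case fixes e / (2 M0), the second e / 2^m. *)
Lemma absu_mass_small (e : R) : 0 < e -> exists2 d, 0 < d & forall r, 0 < r -> r < d ->
  absu_mass (r / 2) r <= e * r ^+ m.
Proof.
move=> e0; have e'0 : 0 < e / (2 * M0) by rewrite divr_gt0// mulr_gt0.
have [d1 d10 hd1] := weight (ltr01 : 0 < 1 :> R) e'0.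
have [d2 d20 hd2] := thin.
have e20 : 0 < e / 2 ^+ m by rewrite divr_gt0 ?exprn_gt0.
have [d3 d30 hd3] := tail_small e20 integrable_source_Omega source_ge0.
exists (Num.min d1 (Num.min d2 d3)); first by rewrite !lt_min d10 d20 d30.
move=> r r0; rewrite !lt_min => /and3P[rd1 rd2 rd3].
have [q [T [q0 T0 tailT rT qf]]] := hd1 r r0 rd1.
have sM := hd2 r r0 rd2.
set M := M0 * (r `^ p * r ^+ m) in sM.
have rp0 : 0 < r `^ p by rewrite powR_gt0.
have rm0 : 0 < r ^+ m by rewrite exprn_gt0.
have M1 : 0 < M by rewrite !mulr_gt0.
have r20 : 0 < r / 2 by rewrite divr_gt0.
have jen := jensen_shell r20 M1 q0 sM qf.
have mass_le : source_mass (r / 2) r <= e / 2 ^+ m.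
  apply: hd3; first exact: measurable_shell.
    by move=> x /shell_outside /outside_Omega.
  move=> x /(shell_sub r20)[Nx nSx]; split => //; exact: neighborhoodS (ltW rd3) _ Nx.
pose y := absu_mass (r / 2) r / M.
have yE : absu_mass (r / 2) r = y * M by rewrite /y divfK// gt_eqF.
rewrite -/y in jen; rewrite yE.
have [yT|Ty] := leP y (2 * T).
  apply: (@le_trans _ _ (2 * T * M)); first by rewrite ler_pM2r.
  rewrite /M (_ : 2 * T * _ = 2 * M0 * (r `^ p * T) * r ^+ m); last by ring.
  by rewrite ler_pM2r// -ler_pdivlMl ?mulr_gt0// [leRHS]mulrC.
have y0 : 0 < y by rewrite (lt_trans _ Ty)// mulr_gt0.
have gy0 := gauge_gt0 gg y0.
have tail_le : (y / g y) `^ m%:R^-1 <= 2 * (1 * r * q).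
  apply: le_trans (dyadic_le_tail_fun m0 gg G1 y0) _; rewrite ler_pM2l//.
  apply: le_trans tailT.
  rewrite (@le_trans _ _ (tail_fun m g (y / 2)))// ?gerBl ?tail_fun_ge0//.
  by apply: tail_fun_nonincreasing => //; lra.
have : y / g y <= (2 * (1 * r * q)) ^+ m.
  rewrite -(powR_invn_expn m0 (ltW (divr_gt0 y0 gy0))) lerXn2r ?nnegrE ?powR_ge0//.
  by rewrite !mulr_ge0// ltW.
rewrite ler_pdivrMr// => yle.
apply: (@le_trans _ _ ((2 * (1 * r * q)) ^+ m * g y * M)); first by rewrite ler_pM2r.
rewrite mul1r !exprMn (_ : _ * M = 2 ^+ m * (q ^+ m * M * g y) * r ^+ m); last by ring.
rewrite ler_pM2r//.
apply: (@le_trans _ _ (2 ^+ m * (e / 2 ^+ m))).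
  by rewrite ler_pM2l ?exprn_gt0// (le_trans jen).
by rewrite mulrC divfK// expf_neq0.
Qed.

Lemma singular_set_removable : removable a f g Omega S u.
Proof.
have iw := integrable_absu_Omega; have iW := integrable_source_Omega.
rewrite /removable -/ext0; split => //.
- apply/integrableP; split; first exact/measurable_EFinP/measurable_ext0.
  have /integrableP[_] := iw; congr (_ < _)%E; apply: eq_integral => x _.
  by rewrite /= /absu normr_id.
move=> phi tphi phi0; rewrite /integral_inequality.
have [sphi cphi _] := tphi.
have [B B0 phiB] := bounded_iter_partial m sphi cphi.
have [K K0 key] := key_inequality.
have num0 := num_alpha_ge0.
have AB0 : 0 <= A * num_alpha * B by rewrite !mulr_ge0// ltW.
have C0 : 0 <= cutoff_const K B.
  by rewrite /cutoff_const !mulr_ge0// ?(ltW A0)// addr_ge0 ?(ltW B0)//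
    !mulr_ge0 ?exprn_ge0 ?(ltW B0) ?(ltW K0).
have mphi : measurable_fun (Omega : set (Rn R n)) phi.
  exact/continuous_measurable_Rn/smooth_continuous.
have mQ := measurable_operator sphi.
have phi_le x : phi x <= B.
  by have := phiB [::] isT x; rewrite /= ger0_norm.
have Q_le x : good x -> Omega x -> `|operator phi x| <= A * num_alpha * B * absu x.
  move=> gx Ox; apply: operator_le => // alpha am.
  by apply: multi_partial_le => // s sm; exact: phiB.
have iWphi : (@mes R n).-integrable (Omega : set (Rn R n)) (EFin \o (fun x => source x * phi x)).
  apply: (@integrable_bounded_by _ _ _ _ _ _ (fun x => B * source x) mO).
  - by apply: measurable_funM => //; exact: measurable_source.
  - move=> x Ox; rewrite ger0_norm; last by rewrite mulr_ge0 ?source_ge0.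
    by rewrite mulrC ler_wpM2r ?source_ge0.
  - by have := integrableZl mO B iW; apply: eq_integrable.
have iQ : (@mes R n).-integrable (Omega : set (Rn R n)) (EFin \o operator phi).
  apply: (@integrable_ae_bounded_by _ _ _ _ _ _ (fun x => A * num_alpha * B * absu x) mO mQ).
  - by move=> x _; rewrite mulr_ge0 ?absu_ge0.
  - by apply: ae_mesS ae_good => x gx Ox; exact: Q_le.
  - by have := integrableZl mO (A * num_alpha * B) iw; apply: eq_integrable.
rewrite -[X in (X <= _)%E]/(\int[@mes R n]_(x in Omega) (source x * phi x)%:E)%E.
rewrite -[X in (_ <= X)%E]/(\int[@mes R n]_(x in Omega) (operator phi x)%:E)%E.
rewrite !EFin_Rintegral// lee_fin; apply/ler_addgt0Pr => e e0.
(* [H] dominates the integrand that eta suppresses. Half of e is reserved for its integral near S,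
   half for the cut-off term on the shell. *)
pose H (x : Rn R n) := B * source x + A * num_alpha * B * absu x.
have H0 x : Omega x -> 0 <= H x.
  move=> Ox; apply: addr_ge0.
    by apply: mulr_ge0; [exact: ltW|exact: source_ge0].
  by apply: mulr_ge0 => //; exact: absu_ge0.
have iH : (@mes R n).-integrable (Omega : set (Rn R n)) (EFin \o H).
  have := integrableD mO (integrableZl mO B iW) (integrableZl mO (A * num_alpha * B) iw).
  by apply: eq_integrable.
have e20 : 0 < e / 2 by rewrite divr_gt0.
have [d1 d10 hd1] := tail_small e20 iH H0.
pose e' := e / 2 / ((cutoff_const K B + 1) * 2 ^+ m).
have e'0 : 0 < e' by rewrite divr_gt0// mulr_gt0 ?exprn_gt0// ltr_wpDl.
have [d2 d20 hd2] := absu_mass_small e'0.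
have min0 : 0 < Num.min 1 (Num.min d1 d2) by rewrite !lt_min ltr01 d10 d20.
have [r r0] : exists2 r, 0 < r & r < Num.min 1 (Num.min d1 d2).
  exists (Num.min 1 (Num.min d1 d2) / 2); first by rewrite divr_gt0.
  by rewrite ltr_pdivrMr// ltr_pMr// ltr1n.
rewrite !lt_min => /and3P[r1 rd1 rd2].
have r20 : 0 < r / 2 by rewrite divr_gt0.
have r2r : r / 2 < r by rewrite ltr_pdivrMr// ltr_pMr// ltr1n.
have rr : r - r / 2 = r / 2 by field.
have rr1 : r - r / 2 <= 1 by rewrite rr (le_trans (ltW r2r))// ltW.
have [eta [ceta eta01 eta0 eta1 [iWpsi ietaQ ineq]]] :=
  key phi B tphi phi0 B0 phiB _ _ r20 r2r rr1.
rewrite rr in ineq.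
have U_le : cutoff_const K B / (r / 2) ^+ m * absu_mass (r / 2) r <= e / 2.
  have := hd2 r r0 rd2; move=> /(ler_wpM2l (_ : 0 <= cutoff_const K B / (r / 2) ^+ m)).
  move=> /(_ (divr_ge0 C0 (exprn_ge0 _ (ltW r20))))/le_trans; apply.
  rewrite /e' expr_div_n.
  have rm0 : r ^+ m != 0 by rewrite expf_neq0// gt_eqF.
  have tm0 : (2 : R) ^+ m != 0 by rewrite expf_neq0.
  have c10 : cutoff_const K B + 1 != 0 by rewrite gt_eqF// ltr_wpDl.
  rewrite (_ : cutoff_const K B / (r ^+ m / 2 ^+ m) *
      (e / 2 / ((cutoff_const K B + 1) * 2 ^+ m) * r ^+ m) =
      (e / 2) * (cutoff_const K B / (cutoff_const K B + 1))); last first.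
    by field; repeat (apply/andP; split); assumption.
  by apply: ler_piMr; [exact: ltW|rewrite ler_pdivrMr ?ltr_wpDl// mul1r lerDl].
have sub : outside (r / 2) `<=` Omega by exact: outside_Omega.
have notE x : Omega x -> ~ outside (r / 2) x -> neighborhood S (r / 2) x.
  by move=> Ox nEx; apply: contrapT => nSx; apply: nEx; split.
have mE := measurable_outside (r / 2).
have iD1 : (@mes R n).-integrable (Omega : set (Rn R n))
    (EFin \o (fun x => source x * (phi x * eta x))).
  apply: (integrable_extend0 mO mE sub) => // x Ox /(notE _ Ox)/eta0 ->.
  by rewrite !mulr0.
have iD2 : (@mes R n).-integrable (Omega : set (Rn R n))
    (EFin \o (fun x => eta x * operator phi x)).
  apply: (integrable_extend0 mO mE sub) => // x Ox /(notE _ Ox)/eta0 ->.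
  by rewrite mul0r.
have ineqO : \int[@mes R n]_(x in Omega) (source x * (phi x * eta x)) <=
    \int[@mes R n]_(x in Omega) (eta x * operator phi x) + e / 2.
  rewrite (Rintegral_extend0 _ sub); last first.
    by move=> x Ox /(notE _ Ox)/eta0 ->; rewrite !mulr0.
  rewrite [X in _ <= X + _](Rintegral_extend0 _ sub); last first.
    by move=> x Ox /(notE _ Ox)/eta0 ->; rewrite mul0r.
  by rewrite (le_trans ineq)// lerD2l.
pose D : set (Rn R n) := Omega `&` (neighborhood S r `\` S).
have mD : measurable D.
  apply: measurableI => //; apply: measurableD; last exact: measurable_singular.
  exact: measurable_nbd.
have DO : D `<=` Omega by exact: subIsetl.
have iHD : (@mes R n).-integrable (Omega : set (Rn R n)) (EFin \o (H \_ D)).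
  apply: (integrable_extend0 mO mD DO).
    by move=> x _ nx; rewrite /patch ifF//; apply/negbTE; rewrite notin_setE.
  have : (@mes R n).-integrable D (EFin \o H) by exact: integrableS iH.
  by apply: eq_integrable => // x xD; rewrite /= /patch xD.
have HD_le : \int[@mes R n]_(x in Omega) (H \_ D) x <= e / 2.
  rewrite -Rintegral_mkcondr (_ : Omega `&` D = D); last exact/setIidPr.
  apply: hd1 => // x [_ [Nx nSx]]; split => //; exact: neighborhoodS (ltW rd1) _ Nx.
(* The two integrands without [H] differ by (1 - eta)(source phi - operator phi), which is zero off
   S_r and at most [H] in absolute value on S_r \ S. *)
have main : \int[@mes R n]_(x in Omega) (source x * phi x - operator phi x) <=
    \int[@mes R n]_(x in Omega) (source x * (phi x * eta x) - eta x * operator phi x + (H \_ D) x).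
  apply: ae_le_Rintegral => //.
  - by have := integrableB mO iWphi iQ; apply: eq_integrable.
  - have := integrableD mO (integrableB mO iD1 iD2) iHD.
    by apply: eq_integrable.
  apply: ae_mesS ae_good => x gx Ox.
  have Qx := Q_le x gx Ox.
  (* On S itself nothing is small in measure; instead u is 0 there, so that the source vanishes and,
     by the growth condition, so does the operator. *)
  have [Sx|nSx] := pselect (S x).
    have a0 : absu x = 0 by rewrite /absu ext0_in// normr0.
    have Q0 : operator phi x = 0.
      by apply/eqP; rewrite -normr_le0 (le_trans Qx)// a0 mulr0.
    rewrite Q0 /source a0 (gauge0 gg) !mulr0 !mul0r !subr0 add0r /patch.
    by case: ifP => _ //; exact: H0.
  have [Nx|nx] := pselect (neighborhood S r x); last first.
    rewrite eta1// !mulr1 mul1r lerDl /patch; case: ifP => _ //; exact: H0.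
  rewrite {1}/patch ifT; last by rewrite inE; split.
  have /andP[e0' e1'] := eta01 x.
  have Wx := source_ge0 Ox.
  rewrite -lerBlDl.
  rewrite (_ : _ - _ = (1 - eta x) * (source x * phi x - operator phi x)); last by ring.
  apply: (le_trans (ler_norm _)); rewrite normrM -[leRHS]mul1r.
  apply: ler_pM => //; first by rewrite ger0_norm ?subr_ge0// gerBl.
  rewrite (le_trans (ler_normB _ _))// /H lerD//.
  by rewrite normrM (ger0_norm Wx) (ger0_norm (phi0 x)) mulrC; exact: ler_wpM2r.
have iDD : (@mes R n).-integrable (Omega : set (Rn R n))
    (EFin \o (fun x => source x * (phi x * eta x) - eta x * operator phi x)).
  by have := integrableB mO iD1 iD2; apply: eq_integrable.
move: main; rewrite RintegralB// RintegralD// RintegralB//.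
by move: ineqO HD_le; lra.
Qed.

End removability.

Theorem theorem2p1 (R : realType) (m n : nat) (Omega S : set 'rV[R]_n)
    (a : multi_index n m -> 'rV[R]_n -> R -> R) (A : R)
    (f : 'rV[R]_n -> R) (g : R -> R) (k : R) :
  (1 <= m)%N -> (1 <= n)%N ->
  domain Omega -> bounded_set Omega -> compact S -> S `<=` Omega ->
  (forall alpha, multi_order alpha = m -> caratheodory_function Omega (a alpha)) ->
  0 < A ->
  (forall alpha, multi_order alpha = m ->
     {ae @mes R n, forall x, Omega x ->
        forall z, `|a alpha x z| <= A * `|z|}) ->
  (forall x, Omega x -> 0 <= f x) ->
  measurable_fun (Omega : set (Rn R n)) f ->
  C2_half_line g -> g 0 = 0 ->
  (forall z, 0 < z ->
     [/\ 0 < g z, 0 < hderiv g z & 0 < hderiv (hderiv g) z]) ->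
  (tail_integral m g 1 < +oo)%E ->
  (\int[@mes R n]_(x in Omega `\` S) gamma_recip g (f x) < +oo)%E ->
  k = fine (upper_fractal_dim (boundary S)) ->
  (exists2 delta : R, 0 < delta & forall C : R, 0 < C ->
     ((r `^ (n%:R - k - m%:R - delta))%:E *
      tail_integral_inv m g
        (C%:E * r%:E *
         ess_inf_on (neighborhood S r `\` S) (fun x => (f x `^ m%:R^-1)%R)))%E
     @[r --> 0^'+] --> 0%E) ->
  forall u : 'rV[R]_n -> R,
    weak_solution a f g Omega S u -> removable a f g Omega S u.
Proof.
move=> m0 _ [_ oO _] bO cS SO car A0 aA f0 _ C2g g0 gpos G1 _ kE [delta delta0 lim0] u sol.
have gg := C2_convex_gauge C2g g0 gpos.
have [rho rho0 Srho] := compact_neighborhood_sub cS oO SO.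
have f0' x : neighborhood S rho x -> 0 <= f x by move=> /Srho; exact: f0.
apply: (singular_set_removable m0 oO cS car A0 aA f0 gg sol bO SO G1
  (p := n%:R - k - m%:R - delta) (M0 := 4 ^+ n)).
- by rewrite exprn_gt0.
- move=> C e C0 e0; apply: (weight_lower_bound m0 gg G1 rho0 f0' C0 e0).
  exact: lim0.
(* The loss delta allowed by the hypothesis is exactly the loss of exponent in the covering
   estimate: p + m = n - k - delta. *)
- have [r0 r00 hr] := mes_shell_le cS kE delta0; exists r0 => // r rgt0 rr0.
  apply: le_trans (hr r rgt0 rr0) _; rewrite lee_fin ler_pM2l ?exprn_gt0//.
  rewrite -powR_mulrn ?(ltW rgt0)// -powRD; last by rewrite (gt_eqF rgt0) implybT.
  by rewrite (_ : _ + m%:R = n%:R - k - delta)//; ring.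
Qed.
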